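(* Let $H=(H_i)_{i\in\mathbb I}$ be a family of continuous Hamiltonians on $\mathbb T^n\times\mathbb R^n\times\mathbb R^m$ that is coercive, convex and monotone, and let $L=(L_i)_{i\in\mathbb I}$ be its Lagrangian. Let $(z,k,\lambda)\in\mathbb T^n\times\mathbb I\times(0,\infty)$ and let $v^\lambda\in C(\mathbb T^n)^m$ be the solution of $(P_\lambda)$. Then there exists $\mu\in\mathfrak C(z,k,\lambda)$ such that \[ v_k^\lambda(z)=\langle\mu,L\rangle=\min_{\nu\in\mathfrak C(z,k,\lambda)}\langle\nu,L\rangle . \]
   Context: $n,m\in\mathbb N$; $\mathbb T^n$ is the $n$-dimensional flat torus; $\mathbb I=\{1,\dots,m\}$; each $H_i:\mathbb T^n\times\mathbb R^n\times\mathbb R^m\to\mathbb R$ is continuous; $B_R^m$ is the open ball in $\mathbb R^m$ with center at the origin and radius $R$; $\mathbf 1=(1,\dots,1)\in\mathbb R^m$. For $\lambda>0$, $(P_\lambda)$ is the system $\lambda v_i(x)+H_i(x,Dv_i(x),v(x))=0$ in $\mathbb T^n$, $i\in\mathbb I$, for $v=(v_i)_{i\in\mathbb I}:\mathbb T^n\to\mathbb R^m$. Solutions are in the viscosity sense: a continuous $v$ is a subsolution (resp. supersolution) if whenever $i\in\mathbb I$, $\varphi\in C^1(\mathbb T^n)$ and $v_i-\varphi$ has a maximum (resp. minimum) at $x$, then $\lambda v_i(x)+H_i(x,D\varphi(x),v(x))\le 0$ (resp. $\ge 0$); a solution is both. Coercive: for any $i\in\mathbb I$ and $R>0$, $\lim_{|p|\to\infty}\inf_{(x,u)\in\mathbb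 T^n\times B_R^m}H_i(x,p,u)=\infty$. Convex: for any $(x,i)$, $(p,u)\mapsto H_i(x,p,u)$ is convex on $\mathbb R^n\times\mathbb R^m$. Monotone: for any $(x,p)$ and $u,v\in\mathbb R^m$, if $u_k-v_k=\max_{i\in\mathbb I}(u_i-v_i)\ge 0$, then $H_k(x,p,u)\ge H_k(x,p,v)$. It is well known that if $H$ is coercive and monotone and $\lambda>0$, then $(P_\lambda)$ has a unique continuous solution, and it is Lipschitz continuous. Lagrangian: $L_i(x,\xi,\eta)=\sup_{(p,u)\in\mathbb R^n\times\mathbb R^m}[\xi\cdot p+\eta\cdot u-H_i(x,p,u)]\in(-\infty,\infty]$. Measures: $\mathbb M_+(X)$ is the set of nonnegative finite Borel measures on $X$. For $\mu=(\mu_i)_{i\in\mathbb I}\in\mathbb M_+(\mathbb T^n\times\mathbb R^n\times\mathbb R^m)^m$ and $\phi=(\phi_i)_{i\in\mathbb I}$, $\langle\mu,\phi\rangle=\sum_{i\in\mathbb I}\langle\mu_i,\phi_i\rangle=\sum_{i\in\mathbb I}\int\phi_i(x,\xi,\eta)\,\mu_i(dx\,d\xi\,d\eta)$; $\langle\mu,L\rangle\in(-\infty,\infty]$ is well defined since each $L_i$ is lower semicontinuous and bounded below. For $\lambda>0$ put $S^\lambda(\eta)=\lambda+\sum_{i\in\mathbb I}\eta_i$ for $\eta\in\mathbb R^m$, and let $\mathbb P^\lambda$ be the set of all $\mu\in\mathbb M_+(\mathbb T^n\times\mathbb R^n\times\mathbb R^m)^m$ with $\langle\mu_i,|\xi|+|\eta|\rangle<\infty$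 for all $i\in\mathbb I$ and $\langle\mu,S^\lambda\mathbf 1\rangle=1$. For $(z,k,\lambda)\in\mathbb T^n\times\mathbb I\times(0,\infty)$, $\mathfrak C(z,k,\lambda)$ is the set of all $\mu\in\mathbb P^\lambda$ such that \[ \langle\mu,\xi\cdot D\psi+\eta\cdot\psi\,\mathbf 1+\lambda\psi\rangle=\psi_k(z)\quad\text{for all }\psi=(\psi_i)_{i\in\mathbb I}\in C^1(\mathbb T^n)^m, \] where the $i$-th component of the integrand is $\xi\cdot D\psi_i(x)+\eta\cdot\psi(x)+\lambda\psi_i(x)$. *)

(* Defs.v *)
From HB Require Import structures.
From mathcomp Require Import all_boot all_order all_algebra.
From mathcomp Require Import generic_quotient.
From mathcomp Require Import all_classical all_reals all_analysis.

Set Implicit Arguments.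
Unset Strict Implicit.
Unset Printing Implicit Defensive.

Import Order.TTheory GRing.Theory Num.Theory.
Import numFieldNormedType.Exports.

Local Open Scope classical_set_scope.
Local Open Scope ring_scope.

Section Euclidean.
Context {R : realType} {n : nat}.

Definition dotp (x y : 'rV[R]_n) : R := \sum_(j < n) x 0 j * y 0 j.

(* The library norm `|x| on 'rV[R]_n is the sup norm. *)
Definition enorm (x : 'rV[R]_n) : R := Num.sqrt (dotp x x).

Definition gradient (f : 'rV[R]_n -> R) (x : 'rV[R]_n) : 'rV[R]_n :=
  \row_(j < n) 'D_(delta_mx 0 j) f x.

End Euclidean.

(* The flat torus is R^n / Z^n with the quotient topology. *)
Section Torus.
Variables (R : realType) (n : nat).

Definition lattice_rel : rel 'rV[R]_n :=
  fun x y => [forall j, x 0 j - y 0 j \is a Num.int].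

Lemma lattice_rel_refl : reflexive lattice_rel.
Proof. by move=> x; apply/forallP => j; rewrite subrr rpred0. Qed.

Lemma lattice_rel_sym : symmetric lattice_rel.
Proof. by move=> x y; apply: eq_forallb => j; rewrite -opprB rpredN. Qed.

Lemma lattice_rel_trans : transitive lattice_rel.
Proof.
move=> y x z /forallP xy /forallP yz; apply/forallP => j.
by rewrite -(subrKA (y 0 j)) rpredD ?xy ?yz.
Qed.

Canonical lattice_equiv :=
  EquivRel lattice_rel lattice_rel_refl lattice_rel_sym lattice_rel_trans.

Definition torus : Type := quotient_topology {eq_quot lattice_equiv}%qT.

HB.instance Definition _ := PointedTopological.on torus.

Definition to_torus (y : 'rV[R]_n) : torus :=
  (\pi_{eq_quot lattice_equiv} y)%qT.

Definition of_torus (x : torus) : 'rV[R]_n :=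
  repr (x : {eq_quot lattice_equiv}%qT).

End Torus.

Section TorusCalculus.
Context {R : realType} {n : nat}.

Definition periodic_lift (phi : torus R n -> R) : 'rV[R]_n -> R :=
  fun y => phi (to_torus y).

Definition C1_torus (phi : torus R n -> R) : Prop :=
  (forall y, differentiable (periodic_lift phi) y) /\
  continuous (gradient (periodic_lift phi)).

(* The lift is periodic, so the value does not depend on the representative. *)
Definition torus_gradient (phi : torus R n -> R) (x : torus R n) : 'rV[R]_n :=
  gradient (periodic_lift phi) (of_torus x).

End TorusCalculus.

Section Hamiltonian.
Context {R : realType} {n m : nat}.
Implicit Type H : 'I_m -> torus R n -> 'rV[R]_n -> 'rV[R]_m -> R.

Definition hamiltonian_continuous H : Prop :=
  forall i, continuous
    (fun w : torus R n * 'rV[R]_n * 'rV[R]_m => H i w.1.1 w.1.2 w.2).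

Definition hamiltonian_coercive H : Prop :=
  forall (i : 'I_m) (r : R), 0 < r ->
  forall M : R, exists K : R, forall p : 'rV[R]_n, K < enorm p ->
    (M%:E < ereal_inf [set (H i xu.1 p xu.2)%:E |
              xu in [set xu : torus R n * 'rV[R]_m | (enorm xu.2 < r)%R]])%E.

Definition hamiltonian_convex H : Prop :=
  forall (x : torus R n) (i : 'I_m),
    @convex_function R ('rV[R]_n * 'rV[R]_m)%type setT
      (fun pu => H i x pu.1 pu.2).

Definition hamiltonian_monotone H : Prop :=
  forall (x : torus R n) (p : 'rV[R]_n) (u v : 'rV[R]_m) (k : 'I_m),
    (forall i, u 0 i - v 0 i <= u 0 k - v 0 k) -> 0 <= u 0 k - v 0 k ->
    H k x p v <= H k x p u.

Definition tuple_at (v : 'I_m -> torus R n -> R) (x : torus R n) : 'rV[R]_m :=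
  \row_(i < m) v i x.

Definition viscosity_subsolution H (lambda : R)
    (v : 'I_m -> torus R n -> R) : Prop :=
  (forall i, continuous (v i)) /\
  forall (i : 'I_m) (phi : torus R n -> R) (x : torus R n), C1_torus phi ->
    (forall y, v i y - phi y <= v i x - phi x) ->
    lambda * v i x + H i x (torus_gradient phi x) (tuple_at v x) <= 0.

Definition viscosity_supersolution H (lambda : R)
    (v : 'I_m -> torus R n -> R) : Prop :=
  (forall i, continuous (v i)) /\
  forall (i : 'I_m) (phi : torus R n -> R) (x : torus R n), C1_torus phi ->
    (forall y, v i x - phi x <= v i y - phi y) ->
    0 <= lambda * v i x + H i x (torus_gradient phi x) (tuple_at v x).

Definition viscosity_solution H (lambda : R)
    (v : 'I_m -> torus R n -> R) : Prop :=
  viscosity_subsolution H lambda v /\ viscosity_supersolution H lambda v.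

Definition lagrangian H (i : 'I_m) (x : torus R n) (xi : 'rV[R]_n)
    (eta : 'rV[R]_m) : \bar R :=
  ereal_sup [set (dotp xi pu.1 + dotp eta pu.2 - H i x pu.1 pu.2)%:E |
              pu in [set: 'rV[R]_n * 'rV[R]_m]].

End Hamiltonian.

Section Measures.
Variables (R : realType) (n m : nat).

(* T^n * R^n * R^m with the Borel sigma-algebra of the product topology;
   points are written ((x, xi), eta). *)
Definition phase_space :=
  g_sigma_algebraType (@open (torus R n * 'rV[R]_n * 'rV[R]_m)%type).

HB.instance Definition _ := Measurable.on phase_space.

Definition measure_family : Type :=
  'I_m -> {finite_measure set phase_space -> \bar R}.

(* Integrands are curried functions of (x, xi, eta). *)
Definition pairing (mu : measure_family)
    (phi : 'I_m -> torus R n -> 'rV[R]_n -> 'rV[R]_m -> \bar R) : \bar R :=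
  (\sum_(i < m) \int[mu i]_w phi i w.1.1 w.1.2 w.2)%E.

Definition prob_family (lambda : R) : set measure_family :=
  [set mu : measure_family |
    (forall i, (\int[mu i]_w (enorm w.1.2 + enorm w.2)%:E < +oo)%E) /\
    pairing mu (fun _ _ _ eta => (lambda + \sum_(j < m) eta 0 j)%:E) = 1%E].

Definition closed_family (z : torus R n) (k : 'I_m) (lambda : R) :
    set measure_family :=
  [set mu : measure_family | prob_family lambda mu /\
    forall psi : 'I_m -> torus R n -> R, (forall i, C1_torus (psi i)) ->
      pairing mu (fun i x xi eta =>
        (dotp xi (torus_gradient (psi i) x) + dotp eta (tuple_at psi x)
           + lambda * psi i x)%:E)
      = (psi k z)%:E].

End Measures.

(* Main.v *)
(* Write A w (i, x, xi, eta) = xi.Dw_i + eta.w + lambda w_i.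

   Lower bound: v is Lipschitz by coercivity, and averaging it over small cubes
   gives C^1 functions W within e of v with A W <= L + e: for fixed
   (x, xi, eta) this inequality is linear in W, hence preserved by averages.
   Integrating it against any closed measure nu gives v_k(z) <= <nu, L>.

   Attainment: if A w <= s L on a large box of (xi, eta), with w of class C^1
   and s >= 0, then w_k(z) <= s v_k(z); this compares a convex combination of w
   and W with the supersolution v, the box being reached through subgradients
   of H. By Hahn-Banach there is then a positive linear functional Lam on
   bounded functions on the box with Lam (A w) = w_k(z) and Lam F <= v_k(z) for
   F <= L. Parametrizing the box by the Cantor space, whose clopen sets form a
   basis, turns Lam into measures mu, which belong to C(z, k, lambda). As L is
   an increasing limit of continuous functions, <mu, L> <= v_k(z). *)

Require Import Defs.
From HB Require Import structures.
From mathcomp Require Import all_boot all_order all_algebra.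
From mathcomp Require Import generic_quotient finmap.
From mathcomp Require Import all_classical all_reals all_analysis.
From mathcomp Require Import measurable_realfun.
From mathcomp Require Import ring lra.
Set Implicit Arguments.
Unset Strict Implicit.
Unset Printing Implicit Defensive.
Import Order.TTheory GRing.Theory Num.Theory.
Import numFieldNormedType.Exports.
Local Open Scope classical_set_scope.
Local Open Scope ring_scope.

(** * Linear functionals below a cone *)

(** Two obstacles shape the proof. First, the phase space is not compact, so mass could escape to
    infinity. The box is therefore fixed before the functional is built: subgradients of [H] are
    bounded on bounded sets, and a test family enters weak duality only with a small weight, so one
    radius serves all families and no tightness argument arises. Second, [v] is merely Lipschitz,
    while A W <= L + e has to hold everywhere, since nu may charge any null set. So the viscosity
    inequality is turned into a finite-difference inequality along segments, affine in [v], which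
    averages over cubes preserve; these averages are iterated one-dimensional ones, so that
    primitives of continuous functions replace multiple integrals. The multiplier s >= 0 in weak
    duality comes from Hahn-Banach, which needs inequalities stable under sums and positive scaling:
    s = 0 yields the closedness constraints, s = 1 the bound on L. *)

Section HahnBanach.
Variables (R : realType) (V : lmodType R) (D : set V).
Hypotheses (D_lin : forall a u v, D u -> D v -> D (a *: u + v)) (D0 : D 0).

Let D_add u v : D u -> D v -> D (u + v).
Proof. by move=> /(D_lin 1) + /[dup] Dv => /(_ v Dv); rewrite scale1r. Qed.

Let D_scale a u : D u -> D (a *: u).
Proof. by move=> Du; rewrite -[_ *: _]addr0; exact: D_lin. Qed.

Let D_opp u : D u -> D (- u).
Proof. by rewrite -scaleN1r; exact: D_scale. Qed.

Definition sublinear_on (q : V -> R) :=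
  (forall t u, 0 < t -> D u -> q (t *: u) <= t * q u) /\
  (forall u v, D u -> D v -> q (u + v) <= q u + q v).

Lemma sublinear_on0 q : sublinear_on q -> 0 <= q 0.
Proof. by move=> [_ /(_ 0 0 D0 D0)]; rewrite addr0; lra. Qed.

(** [S u r] is to be read as: r is an admissible upper bound at u. The infimum is finite because a
    member s of [S (- u)] added to any member of [S u] lies in [S 0], so that -s is a lower
    bound. *)
Lemma cone_infimum (S : V -> R -> Prop) :
  (forall t u r, 0 < t -> D u -> S u r -> S (t *: u) (t * r)) ->
  (forall u v r s, D u -> D v -> S u r -> S v s -> S (u + v) (r + s)) ->
  (forall u, D u -> exists r, S u r) -> (forall r, S 0 r -> 0 <= r) ->
  (forall u r, D u -> S u r -> inf (S u) <= r) /\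
  sublinear_on (fun u => inf (S u)).
Proof.
move=> SZ SD Sex S0.
have Sinf u : D u -> has_inf (S u).
  move=> Du; split; first exact: Sex.
  have [s sN] := Sex _ (D_opp Du); exists (- s) => r ru.
  by have := SD _ _ _ _ Du (D_opp Du) ru sN; rewrite subrr => /S0; lra.
have le_inf u r : D u -> S u r -> inf (S u) <= r.
  by move=> /Sinf[_ lbS] /(ge_inf lbS).
split=> //; split=> [t u t0 Du|u v Du Dv].
  rewrite -ler_pdivrMl//; apply: lb_le_inf; first exact: Sex.
  by move=> r /(SZ _ _ _ t0 Du) /(le_inf _ _ (D_scale t Du)); rewrite ler_pdivrMl.
rewrite -lerBlDr; apply: lb_le_inf; first exact: Sex.
move=> r ru; rewrite lerBlDr -lerBlDl; apply: lb_le_inf; first exact: Sex.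
move=> s sv; rewrite lerBlDl; apply: le_inf; first exact: D_add.
exact: SD.
Qed.

(** Zorn's lemma for the reversed pointwise order on [D]. In a chain the smaller of two members
    serves both summands, so [cone_infimum] makes the infimum over the chain sublinear again. *)
Lemma minimal_sublinear_on (p : V -> R) : sublinear_on p ->
  exists q, [/\ sublinear_on q, (forall u, D u -> q u <= p u) &
    forall q', sublinear_on q' -> (forall u, D u -> q' u <= q u) ->
      forall u, D u -> q u <= q' u].
Proof.
move=> hp.
pose T := {q : V -> R | sublinear_on q /\ forall u, D u -> q u <= p u}.
pose p0 : T := exist _ p (conj hp (fun u _ => lexx _)).
pose le (q1 q2 : T) := `[< forall u, D u -> sval q2 u <= sval q1 u >].
have [||A totA|q qmin] := @ZL_preorder T p0 le.
- by move=> q; apply/asboolP.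
- move=> q1 q2 q3 /asboolP h12 /asboolP h23; apply/asboolP => u Du.
  exact: le_trans (h23 _ Du) (h12 _ Du).
- have [[a Aa]|/forallNP A0] := pselect (exists a, A a); last first.
    by exists p0 => s /A0.
  pose S u r := exists2 b : T, A b & sval b u <= r.
  have [|||r|Sle Ssub] := @cone_infimum S.
  + move=> t u r t0 Du [b Ab br]; exists b => //.
    have [[bZ _] _] := svalP b; apply: le_trans (bZ _ _ t0 Du) _.
    by rewrite ler_pM2l.
  + move=> u v r s Du Dv [b Ab br] [c Ac cs].
    have [/asboolP bc|/asboolP cb] := totA _ _ Ab Ac.
      exists c => //; have [[_ cD] _] := svalP c.
      by apply: le_trans (cD _ _ Du Dv) _; rewrite lerD// (le_trans (bc _ Du)).
    exists b => //; have [[_ bD] _] := svalP b.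
    by apply: le_trans (bD _ _ Du Dv) _; rewrite lerD// (le_trans (cb _ Dv)).
  + by move=> u Du; exists (sval a u); exists a.
  + by move=> [b _]; apply: le_trans; have [/sublinear_on0] := svalP b.
  have Sp u : D u -> inf (S u) <= p u.
    move=> Du; apply: Sle => //; exists a => //; have [_] := svalP a; exact.
  exists (exist _ _ (conj Ssub Sp) : T) => b Ab; apply/asboolP => u Du /=.
  by apply: Sle => //; exists b.
have [hq qp] := svalP q; exists (sval q); split=> // q' hq' q'q.
have q'p u : D u -> q' u <= p u.
  by move=> Du; apply: le_trans (q'q _ Du) (qp _ Du).
have /qmin/asboolP : le q (exist _ q' (conj hq' q'p) : T) by apply/asboolP.
exact.
Qed.

(* A minimal sublinear functional q is linear: it cannot exceed
   u |-> inf_(t >= 0) (q (u + t v) - t q v), which is sublinear too. *)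
Theorem hahn_banach_cone (S : V -> R -> Prop) :
  (forall t u r, 0 < t -> D u -> S u r -> S (t *: u) (t * r)) ->
  (forall u v r s, D u -> D v -> S u r -> S v s -> S (u + v) (r + s)) ->
  (forall u, D u -> exists r, S u r) -> (forall r, S 0 r -> 0 <= r) ->
  exists f : V -> R,
    (forall a u v, D u -> D v -> f (a *: u + v) = a * f u + f v) /\
    (forall u r, D u -> S u r -> f u <= r).
Proof.
move=> SZ SD Sex S0; have [Sle Ssub] := cone_infimum SZ SD Sex S0.
have [q [hq qS qmin]] := minimal_sublinear_on Ssub.
have qD u v : D u -> D v -> q (u + v) = q u + q v.
  move=> Du Dv; apply/eqP; rewrite eq_le hq.2//= addrC.
  pose Q w r := exists2 t, 0 <= t & q (w + t *: v) - t * q v <= r.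
  have [|||r|Qle Qsub] := @cone_infimum Q.
  - move=> t w r t0 Dw [s s0 sr]; exists (t * s); first by rewrite mulr_ge0// ltW.
    rewrite -scalerA -scalerDr -mulrA -(ler_pM2l t0) in sr *.
    apply: le_trans sr; rewrite mulrBr lerB//; apply: hq.1 => //.
    by apply: D_add => //; exact: D_scale.
  - move=> w w' r r' Dw Dw' [s s0 sr] [s' s'0 s'r].
    exists (s + s'); first exact: addr_ge0.
    rewrite scalerDl addrACA mulrDl.
    have := hq.2 _ _ (D_add Dw (D_scale s Dv)) (D_add Dw' (D_scale s' Dv)); lra.
  - by move=> w Dw; exists (q (w + 0 *: v) - 0 * q v); exists 0.
  - move=> [s]; rewrite add0r le_eqVlt => /predU1P[<-|s0].
      by rewrite scale0r mul0r subr0; apply: le_trans (sublinear_on0 hq).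
    apply: le_trans; rewrite subr_ge0.
    have := hq.1 s^-1 (s *: v); rewrite invr_gt0 => /(_ s0 (D_scale s Dv)).
    by rewrite scalerA mulVf ?gt_eqF// scale1r ler_pdivlMl.
  have Qq w : D w -> inf (Q w) <= q w.
    move=> Dw; apply: Qle => //; exists 0 => //.
    by rewrite scale0r addr0 mul0r subr0.
  (* Minimality gives q u <= inf (Q u), and t = 1 gives inf (Q u) <= q (u + v) - q v: together,
     superadditivity. *)
  have := qmin _ Qsub Qq u Du.
  have : inf (Q u) <= q (u + v) - q v.
    by apply: Qle => //; exists 1; rewrite ?ler01// scale1r mul1r.
  lra.
have q0 : q 0 = 0 by have := qD 0 0 D0 D0; rewrite addr0; lra.
have qN u : D u -> q (- u) = - q u.
  by move=> Du; have := qD _ _ Du (D_opp Du); rewrite subrr q0; lra.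
have qZp t u : 0 < t -> D u -> q (t *: u) = t * q u.
  move=> t0 Du; apply/eqP; rewrite eq_le hq.1//=.
  have := hq.1 t (- u) t0 (D_opp Du); rewrite scalerN !qN//; first lra.
  exact: D_scale.
have qZ t u : D u -> q (t *: u) = t * q u.
  move=> Du; have [t0|t0|->] := ltgtP t 0; last by rewrite scale0r mul0r.
    have := qZp (- t) u; rewrite oppr_gt0 => /(_ t0 Du).
    rewrite scaleNr qN; [lra|exact: D_scale].
  exact: qZp.
exists q; split=> [a u v Du Dv|u r Du Sur].
  by rewrite qD ?qZ//; exact: D_scale.
exact: le_trans (qS _ Du) (Sle _ _ Du Sur).
Qed.

End HahnBanach.

(** * Subgradients of convex functions and the Lagrangian *)

Section Subgradient.
Variable R : realType.

(** The bounds in [S d] are those above some difference quotient of h at z along d, so their infimum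
    is the one-sided directional derivative; convexity makes it subadditive. The quotient with t = 1
    gives the stated inequality. *)
Lemma subgradient_exists (V : lmodType R) (h : V -> R) (z : V) :
  (forall t x y, 0 <= t <= 1 ->
     h (t *: x + (1 - t) *: y) <= t * h x + (1 - t) * h y) ->
  exists f : V -> R, (forall a u v, f (a *: u + v) = a * f u + f v) /\
    forall d, f d <= h (z + d) - h z.
Proof.
move=> hc.
pose S d r := exists2 t, 0 < t & h (z + t *: d) - h z <= t * r.
have [//||||r|f [flin fS]] := @hahn_banach_cone R V setT _ I S.
- move=> s d r s0 _ [t t0 tr]; exists (t / s); first exact: divr_gt0.
  by rewrite scalerA mulrA !divfK ?gt_eqF.
- move=> d d' r r' _ _ [t t0 tr] [s s0 sr].
  have ts0 : 0 < t + s by exact: addr_gt0.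
  (* With this step, z + step (d + d') is the convex combination of z + t d and z + s d' with
     weights s / (t + s) and t / (t + s). *)
  exists (t * s / (t + s)); first by rewrite divr_gt0// mulr_gt0.
  have -> : z + (t * s / (t + s)) *: (d + d') =
      (s / (t + s)) *: (z + t *: d) + (1 - s / (t + s)) *: (z + s *: d').
    have -> : 1 - s / (t + s) = t / (t + s) by field; rewrite gt_eqF.
    rewrite !scalerDr !scalerA addrACA -scalerDl -mulrDl [s + t]addrC.
    by rewrite divff ?gt_eqF// scale1r !(mulrAC _ _^-1) [s * t]mulrC.
  have := hc (s / (t + s)) (z + t *: d) (z + s *: d').
  have -> : 0 <= s / (t + s) <= 1.
    by rewrite ler_pdivrMr// mul1r lerDr !ltW ?divr_gt0.
  move=> /(_ isT).
  have -> : 1 - s / (t + s) = t / (t + s) by field; rewrite gt_eqF.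
  move=> hle.
  have : (s / (t + s)) * (h (z + t *: d) - h z) <= (s / (t + s)) * (t * r).
    by rewrite ler_wpM2l// divr_ge0// ltW.
  have : (t / (t + s)) * (h (z + s *: d') - h z) <= (t / (t + s)) * (s * r').
    by rewrite ler_wpM2l// divr_ge0// ltW.
  have e : h z = s / (t + s) * h z + t / (t + s) * h z.
    by field; rewrite gt_eqF.
  have -> : t * s / (t + s) * (r + r') =
      s / (t + s) * (t * r) + t / (t + s) * (s * r').
    by field; rewrite gt_eqF.
  rewrite !mulrBr; lra.
- by move=> d _; exists (h (z + 1 *: d) - h z); exists 1; rewrite ?ltr01// mul1r.
- move=> [t t0]; rewrite scaler0 addr0 subrr pmulr_rge0//.
exists f; split=> [a u v|d]; first exact: flin.
by apply: fS => //; exists 1; rewrite ?ltr01// scale1r mul1r.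
Qed.

End Subgradient.

Section DotProduct.
Context {R : realType} {n : nat}.
Implicit Types x y z : 'rV[R]_n.

Lemma dotpDl x y z : dotp (x + y) z = dotp x z + dotp y z.
Proof.
by rewrite /dotp -big_split; apply: eq_bigr => j _; rewrite !mxE mulrDl.
Qed.

Lemma dotpC x y : dotp x y = dotp y x.
Proof. by apply: eq_bigr => j _; rewrite mulrC. Qed.

Lemma dotpDr x y z : dotp x (y + z) = dotp x y + dotp x z.
Proof. by rewrite dotpC dotpDl ![dotp x _]dotpC. Qed.

Lemma dotpZl a x y : dotp (a *: x) y = a * dotp x y.
Proof.
by rewrite /dotp mulr_sumr; apply: eq_bigr => j _; rewrite mxE mulrA.
Qed.

Lemma dotpZr a x y : dotp x (a *: y) = a * dotp x y.
Proof. by rewrite dotpC dotpZl dotpC. Qed.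

Lemma dotp0r x : dotp x 0 = 0.
Proof. by rewrite /dotp big1// => j _; rewrite mxE mulr0. Qed.

Lemma dotpNr x y : dotp x (- y) = - dotp x y.
Proof. by rewrite -scaleN1r dotpZr mulN1r. Qed.

Lemma dotp_delta x j : dotp x (delta_mx 0 j) = x 0 j.
Proof.
rewrite /dotp (bigD1 j)//= big1 ?addr0 ?mxE ?eqxx ?mulr1// => i ij.
by rewrite !mxE (negbTE ij) andbF mulr0.
Qed.

Lemma dotp_const x (a : R) : dotp x (const_mx a) = (\sum_(j < n) x 0 j) * a.
Proof. by rewrite /dotp mulr_suml; apply: eq_bigr => j _; rewrite mxE. Qed.

Lemma linear_dotp (f : 'rV[R]_n -> R) :
  (forall a u v, f (a *: u + v) = a * f u + f v) ->
  forall x, f x = dotp (\row_j f (delta_mx 0 j)) x.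
Proof.
move=> flin x.
have f0 : f 0 = 0 by have := flin 1 0 0; rewrite scale1r addr0 mul1r; lra.
rewrite {1}(row_sum_delta x) /dotp.
elim/big_rec2: _ => // j a y _ <-; rewrite flin mxE mulrC; congr (_ * _ + _).
Qed.

End DotProduct.

Section LagrangianSubgradient.
Context {R : realType} {n m : nat}.
Variable H : 'I_m -> torus R n -> 'rV[R]_n -> 'rV[R]_m -> R.
Hypothesis H_convex : hamiltonian_convex H.

Lemma lagrangian_ge i x xi eta p u :
  ((dotp xi p + dotp eta u - H i x p u)%:E <= lagrangian H i x xi eta)%E.
Proof. by apply: ereal_sup_ubound; exists (p, u). Qed.

(** Equality case of the Fenchel-Young inequality: for a subgradient (xi, eta) at (p, u), the
    supremum that defines the Lagrangian is attained at (p, u), so it is finite. *)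
Lemma hamiltonian_subgradient i x p u : exists xi eta,
  (forall q w, dotp xi q + dotp eta w <= H i x (p + q) (u + w) - H i x p u) /\
  lagrangian H i x xi eta = (dotp xi p + dotp eta u - H i x p u)%:E.
Proof.
pose h (w : 'rV[R]_n * 'rV[R]_m) := H i x w.1 w.2.
have [t w w' /andP[t0 t1]|f [flin fle]] := subgradient_exists (h := h) (p, u).
  pose t' := Itv01 t0 t1.
  by have := H_convex x i t' (in_setT w) (in_setT w').
pose xi : 'rV[R]_n := \row_j f (delta_mx 0 j, 0).
pose eta : 'rV[R]_m := \row_j f (0, delta_mx 0 j).
have fE q w : f (q, w) = dotp xi q + dotp eta w.
  have -> : (q, w) = 1 *: (q, 0) + (0, w).
    by rewrite scale1r; congr pair; rewrite /= ?addr0 ?add0r.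
  rewrite flin mul1r (@linear_dotp _ _ (fun q => f (q, 0))); last first.
    move=> a q1 q2; rewrite -flin; congr (f _); congr pair.
    by rewrite /= scaler0 addr0.
  rewrite (@linear_dotp _ _ (fun w => f (0, w)))// => a w1 w2.
  by rewrite -flin; congr (f _); congr pair; rewrite /= scaler0 addr0.
have sub q w : dotp xi q + dotp eta w <= H i x (p + q) (u + w) - H i x p u.
  by rewrite -fE; exact: fle.
exists xi, eta; split=> //; apply/eqP; rewrite eq_le lagrangian_ge andbT.
apply: ge_ereal_sup => _ [[q w] _ <-]; rewrite lee_fin /=.
have := sub (q - p) (w - u); rewrite !(addrC _ (_ - _)) !subrK.
by rewrite !dotpDr !dotpNr; lra.
Qed.

End LagrangianSubgradient.

(** * Calculus on the torus *)

Section ScalarContinuity.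
Context {R : realType} {T : topologicalType}.
Implicit Types f g : T -> R.

Lemma fun_cst_continuous (a : R) : continuous (fun _ : T => a).
Proof. by move=> x; exact: cvg_cst. Qed.

Lemma fun_add_continuous f g :
  continuous f -> continuous g -> continuous (fun x => f x + g x).
Proof. by move=> fc gc x; apply: cvgD; [exact: fc|exact: gc]. Qed.

Lemma fun_opp_continuous f : continuous f -> continuous (fun x => - f x).
Proof. by move=> fc x; apply: cvgN; exact: fc. Qed.

Lemma fun_mul_continuous f g :
  continuous f -> continuous g -> continuous (fun x => f x * g x).
Proof. by move=> fc gc x; apply: cvgM; [exact: fc|exact: gc]. Qed.

Lemma fun_comp_continuous (U W : topologicalType) (h : T -> U) (g : U -> W) :
  continuous h -> continuous g -> continuous (fun x => g (h x)).
Proof. by move=> hc gc x; apply: continuous_comp; [exact: hc|exact: gc]. Qed.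

Lemma fun_pair_continuous (U W : topologicalType) (h : T -> U) (g : T -> W) :
  continuous h -> continuous g -> continuous (fun x => (h x, g x)).
Proof. by move=> hc gc x; apply: cvg_pair; [exact: hc|exact: gc]. Qed.

Lemma fun_fst_continuous (U W : topologicalType) :
  continuous (fun w : U * W => w.1).
Proof. by move=> w; exact: cvg_fst. Qed.

Lemma fun_snd_continuous (U W : topologicalType) :
  continuous (fun w : U * W => w.2).
Proof. by move=> w; exact: cvg_snd. Qed.

Lemma fun_sum_continuous n (h : 'I_n -> T -> R) :
  (forall j, continuous (h j)) -> continuous (fun x => \sum_(j < n) h j x).
Proof.
move=> hc x; apply: (@cvg_big _ _ +%R 0 xpredT add_continuous) => j _; exact: hc.
Qed.

End ScalarContinuity.

Section RowVectors.
Context {R : realType}.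

Lemma norm_coord_le n (x : 'rV[R]_n) j : `|x 0 j| <= `|x|.
Proof.
rewrite [leRHS]mx_normrE; exact: (@le_bigmax _ _ _ 0 (fun ij => `|x ij.1 ij.2|) (0, j)).
Qed.

Lemma row_norm_le n (x : 'rV[R]_n) a :
  0 <= a -> (forall j, `|x 0 j| <= a) -> `|x| <= a.
Proof.
move=> a0 xa; rewrite [leLHS]mx_normrE; apply/bigmax_leP; split=> // -[i j] _ /=.
by rewrite ord1.
Qed.

Lemma row_cvg {T : Type} n (F : set_system T) (FF : Filter F)
    (g : 'I_n -> T -> R) (l : 'rV[R]_n) :
  (forall j, g j t @[t --> F] --> l 0 j) -> \row_j g j t @[t --> F] --> l.
Proof.
move=> gl; apply/cvgrPdist_le => e e0; near=> t.
apply: row_norm_le => [|j]; first exact: ltW.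
rewrite !mxE; move: (j); near: t; apply: filter_forall => i.
by have /cvgrPdist_le/(_ e e0) := gl i.
Unshelve. all: by end_near. Qed.

Lemma row_continuous {T : topologicalType} n (g : 'I_n -> T -> R) :
  (forall j, continuous (g j)) -> continuous (fun t => \row_j g j t).
Proof. by move=> gc x; apply: row_cvg => j; rewrite mxE; exact: gc. Qed.

Lemma dotp_continuous {T : topologicalType} n (f g : T -> 'rV[R]_n) :
  continuous f -> continuous g -> continuous (fun t => dotp (f t) (g t)).
Proof.
move=> fc gc; apply: fun_sum_continuous => j; apply: fun_mul_continuous.
  apply: (@fun_comp_continuous _ _ _ f (fun u : 'rV[R]_n => u 0 j)) => //.
  exact: coord_continuous.
apply: (@fun_comp_continuous _ _ _ g (fun u : 'rV[R]_n => u 0 j)) => //.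
exact: coord_continuous.
Qed.

(** Only x is confined to [K], the second point may leave it: [frozen_subsolution] compares a point
    of the unit cube with one that may lie outside. *)
Lemma compact_uniform_continuity (V : pseudoMetricType R) (F : V -> R)
    (K : set V) (e : R) : compact K -> continuous F -> 0 < e ->
  exists2 r, 0 < r & forall x y, K x -> ball x r y -> `|F x - F y| < e.
Proof.
move=> /compact_near_coveringP Kc Fc e0.
have := Kc R 0^'+ (fun r x => forall y, ball x r y -> `|F x - F y| < e) _.
case=> [x Kx|r /= r0 Hr]; last first.
  exists (r / 2); first by rewrite divr_gt0.
  move=> x y Kx xy; apply: (Hr (r / 2)) => //=; last by rewrite divr_gt0.
  by rewrite /ball_/= sub0r normrN gtr0_norm ?divr_gt0// ltr_pdivrMr// ltr_pMr// ltr1n.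
have /cvgrPdist_lt/(_ (e / 2)) := Fc x; rewrite divr_gt0// => /(_ isT).
move=> /nbhs_ballP[r /= r0 xr]; exists (ball x (r / 2), [set s | 0 < s < r / 2]).
  split; first by apply/nbhs_ballP; exists (r / 2) => //=; rewrite divr_gt0.
  exists (r / 2) => //=; first by rewrite divr_gt0.
  by move=> s /=; rewrite sub0r normrN => /ltr_normlW sr s0; rewrite s0.
move=> [x' s] [/= xx' /andP[s0 sr]] y x'y.
have hx' : `|F x - F x'| < e / 2.
  by apply: xr; apply: le_ball xx'; rewrite ler_pdivrMr// ler_peMr ?ltW// ltr1n.
have hy : `|F x - F y| < e / 2.
  apply: xr; rewrite [r]splitr; apply: ball_triangle xx' _.
  by apply: le_ball x'y; exact: ltW.
rewrite -(subrKA (F x)) [e]splitr (le_lt_trans (ler_normD _ _))//.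
by rewrite ltrD// distrC.
Qed.

End RowVectors.

Section TorusBasics.
Context {R : realType} {n : nat}.
Implicit Types x y : 'rV[R]_n.

Lemma to_torus_eqP x y :
  to_torus x = to_torus y <-> forall j, x 0 j - y 0 j \is a Num.int.
Proof.
split=> [/(@eqmodP _ (lattice_equiv R n))/forallP //|xy].
by apply/(@eqmodP _ (lattice_equiv R n))/forallP.
Qed.

Lemma of_torusK (x : torus R n) : to_torus (of_torus x) = x.
Proof. exact: reprK. Qed.

Lemma to_torus_continuous : continuous (@to_torus R n).
Proof. exact: pi_continuous. Qed.

Lemma torus_continuousP (T : topologicalType) (f : torus R n -> T) :
  continuous f <-> continuous (fun y => f (to_torus y)).
Proof. exact: quotient_continuous. Qed.

Definition unit_cube : set 'rV[R]_n := [set y | forall j, y ord0 j \in `[0, 1]].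

Lemma unit_cube_compact : compact unit_cube.
Proof.
have := @rV_compact R n (fun=> `[0 : R, 1]%classic) (fun=> @segment_compact R 0 1).
exact.
Qed.

Lemma unit_cube_rep (x : torus R n) : exists2 y, unit_cube y & to_torus y = x.
Proof.
pose y := of_torus x.
exists (\row_j (y 0 j - (Num.floor (y 0 j))%:~R)).
  move=> j; rewrite mxE in_itv/= subr_ge0 floor_le_tmp/=.
  by rewrite lerBlDl ltW// -[X in _ + X]mulr1z -intrD; exact: lt_succ_floor.
rewrite -[RHS]of_torusK; apply/to_torus_eqP => j.
by rewrite mxE addrAC subrr add0r rpredN intr_int.
Qed.

Lemma torus_compact : compact [set: torus R n].
Proof.
have -> : [set: torus R n] = @to_torus R n @` unit_cube.
  apply/seteqP; split=> // x _; have [y ? <-] := unit_cube_rep x.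
  by exists y.
apply: continuous_compact unit_cube_compact.
by apply: continuous_subspaceT; exact: to_torus_continuous.
Qed.

Lemma torus_max (I : finType) (i0 : I) (f : I -> torus R n -> R) :
  (forall i, continuous (f i)) ->
  exists (i : I) (x : torus R n), forall j (y : torus R n), f j y <= f i x.
Proof.
move=> fc.
have fmax i : exists x : torus R n, forall y : torus R n, f i y <= f i x.
  have [||x _ xmax] := @compact_EVT_max _ R (f i) _ _ torus_compact.
  - by exists point.
  - by apply: continuous_subspaceT; exact: fc.
  - by exists x => y; apply: xmax; rewrite inE.
have [g gmax] := choice fmax.
have [i _ imax] := @arg_maxP _ _ I i0 xpredT (fun i => f i (g i)) isT.
by exists i, (g i) => j y; apply: le_trans (gmax _ _) (imax _ isT).
Qed.

Lemma torus_bounded (f : torus R n -> R) :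
  continuous f -> exists2 M, 0 <= M & forall x : torus R n, `|f x| <= M.
Proof.
move=> fc; have [|i [x xmax]] := @torus_max unit tt (fun _ (y : torus R n) => `|f y|).
  by move=> _ y; apply: (@continuous_comp _ _ _ f Num.norm); [exact: fc|exact: norm_continuous].
by exists `|f x| => // y; exact: (xmax tt).
Qed.

End TorusBasics.

Section TorusC1.
Context {R : realType} {n : nat}.
Implicit Types (phi psi : torus R n -> R) (y : 'rV[R]_n).

Lemma periodic_lift_eq phi y y' :
  to_torus y = to_torus y' -> gradient (periodic_lift phi) y =
  gradient (periodic_lift phi) y'.
Proof.
move=> yy'; apply/rowP => j; rewrite !mxE /derive.
pose q z h : R := h^-1 *: ((periodic_lift phi \o shift z) (h *: delta_mx 0 j) -
  periodic_lift phi z).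
rewrite -/(q y) -/(q y'); suff -> : q y = q y' by [].
apply/funext => h; congr (h^-1 *: (_ - _)).
  rewrite /= /periodic_lift; congr (phi _); apply/to_torus_eqP => i.
  by move/to_torus_eqP : yy' => /(_ i); rewrite !mxE opprD addrACA subrr add0r.
by rewrite /periodic_lift yy'.
Qed.

Lemma torus_gradientE phi y :
  torus_gradient phi (to_torus y) = gradient (periodic_lift phi) y.
Proof. by apply: periodic_lift_eq; rewrite of_torusK. Qed.

Lemma torus_gradient_continuous phi :
  C1_torus phi -> continuous (torus_gradient phi).
Proof.
move=> [_ gc]; apply/torus_continuousP.
by rewrite (_ : (fun _ => _) = gradient (periodic_lift phi))//;
  apply/funext => y; rewrite torus_gradientE.
Qed.

Lemma C1_torus_continuous phi : C1_torus phi -> continuous phi.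
Proof.
move=> [dphi _]; apply/torus_continuousP => y.
exact: (differentiable_continuous (dphi y)).
Qed.

Lemma C1_torus_scaleD a phi psi : C1_torus phi -> C1_torus psi ->
  C1_torus (fun x => a * phi x + psi x) /\
  forall x, torus_gradient (fun x => a * phi x + psi x) x =
    a *: torus_gradient phi x + torus_gradient psi x.
Proof.
move=> [dphi cphi] [dpsi cpsi].
have liftE : periodic_lift (fun x => a * phi x + psi x) =
    (a *: periodic_lift phi) + periodic_lift psi by [].
have gE y : gradient (periodic_lift (fun x => a * phi x + psi x)) y =
    a *: gradient (periodic_lift phi) y + gradient (periodic_lift psi) y.
  apply/rowP => j; rewrite !mxE liftE deriveD; first last.
  - exact: diff_derivable.
  - by apply: diff_derivable; exact: differentiableZ.
  by rewrite deriveZ//; exact: diff_derivable.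
split=> [|x]; last by rewrite /torus_gradient gE.
split=> [y|]; first by rewrite liftE; apply: differentiableD => //; exact: differentiableZ.
rewrite (_ : gradient _ = fun y =>
  a *: gradient (periodic_lift phi) y + gradient (periodic_lift psi) y).
  move=> y; apply: (@cvgD _ _ _ _ _
    (fun y => a *: gradient (periodic_lift phi) y)
    (gradient (periodic_lift psi)) _ _ _ (cpsi y)).
  apply: (@continuous_comp _ _ _ (gradient (periodic_lift phi)) ( *:%R a)).
    exact: cphi.
  exact: scaler_continuous.
by apply/funext => y; rewrite gE.
Qed.

Lemma C1_torus_cst a : C1_torus (cst a : torus R n -> R) /\
  forall x, torus_gradient (cst a : torus R n -> R) x = 0.
Proof.
have gE y : gradient (periodic_lift (cst a : torus R n -> R)) y = 0.
  apply/rowP => j; rewrite !mxE.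
  by rewrite (_ : periodic_lift _ = cst a)// derive_cst.
split=> [|x]; last exact: gE.
split=> [y|].
  by rewrite (_ : periodic_lift _ = cst a)//; exact: differentiable_cst.
have -> : gradient (periodic_lift (cst a : torus R n -> R)) = cst 0.
  by apply/funext => y; rewrite gE.
by move=> y; apply: cvg_cst; exact: nbhs_filter.
Qed.

End TorusC1.

(** * A smooth periodic substitute for the squared distance *)

Section PeriodicBump.
Context {R : realType}.

Let tau : R := pi *+ 2.

(** Smooth, nonnegative, 1-periodic and zero exactly at the integers: it replaces the square in a
    penalty term and descends to the torus. *)
Definition ripple (s : R) : R := 1 - cos (tau * s).

Definition dripple (s : R) : R := tau * sin (tau * s).

Lemma tau_gt0 : 0 < tau.
Proof. by rewrite /tau mulrn_wgt0// pi_gt0. Qed.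

Lemma is_derive_ripple (s : R) : is_derive s 1 ripple (dripple s).
Proof.
have h : is_derive s 1 (fun s => tau * s) tau.
  by apply: is_derive_eq; rewrite [LHS]mulr1.
have hc := is_derive1_comp (is_derive_cos (tau * s)) h.
have -> : ripple = cst 1 - (cos \o (fun s => tau * s)) by [].
by apply: is_derive_eq; rewrite /dripple sub0r mulNr opprK mulrC.
Qed.

Lemma dripple_continuous : continuous dripple.
Proof.
move=> s; apply: cvgM; first exact: cvg_cst.
apply: (@continuous_comp _ _ _ (fun s => tau * s) sin).
  by apply: cvgM; [exact: cvg_cst|exact: cvg_id].
exact: continuous_sin.
Qed.

Lemma ripple_ge0 s : 0 <= ripple s.
Proof. by rewrite subr_ge0 cos_le1. Qed.

Lemma ripple0 : ripple 0 = 0.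
Proof. by rewrite /ripple mulr0 cos0 subrr. Qed.

Lemma ripple_nat s (k : nat) : ripple (s + k%:R) = ripple s.
Proof.
congr (1 - _); rewrite mulrDr mulr_natr; exact: (periodicn (@cosD2pi R)).
Qed.

Lemma ripple_int s k : k \is a Num.int -> ripple (s + k) = ripple s.
Proof.
move=> /intrP[[z|z] ->]; first exact: ripple_nat.
rewrite NegzE intrN -[in RHS](subrK (z.+1%:~R) s).
exact/esym/ripple_nat.
Qed.

Lemma ripple_small (rho : R) : 0 < rho ->
  exists2 c, 0 < c &
    forall s, ripple s < c -> exists2 k, k \is a Num.int & `|s - k| < rho.
Proof.
(* Up to 1/2 the angle [tau * r] stays in [0, pi], where cos is strictly decreasing; s is brought
   into that range by subtracting the nearest integer. *)
move=> rho0; pose r := Num.min rho 2^-1.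
have r0 : 0 < r by rewrite lt_min rho0/= invr_gt0.
have r2 : r <= 2^-1 by rewrite ge_min lexx orbT.
have taur s : 0 <= s <= 2^-1 -> tau * s \in `[0, pi].
  move=> /andP[s0 s2]; rewrite in_itv/= mulr_ge0 ?(ltW tau_gt0)//=.
  rewrite (le_trans (ler_wpM2l (ltW tau_gt0) s2))// /tau.
  by move: (pi : R) => p; lra.
exists (ripple r).
  have ir : tau * r \in `[0, pi] by rewrite taur// ltW.
  rewrite subr_gt0 -[ltRHS]cos0 (ltr_cos _ ir); first by rewrite mulr_gt0 ?tau_gt0.
  by rewrite in_itv/= lexx pi_ge0.
move=> s; pose k : R := (Num.floor (s + 2^-1))%:~R.
have [k1 k2] : k <= s + 2^-1 /\ s + 2^-1 < k + 1.
  split; first by rewrite /k floor_le_tmp.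
  by rewrite /k -[X in _ < _ + X]mulr1z -intrD; exact: lt_succ_floor.
have sk2 : `|s - k| <= 2^-1 by rewrite ler_norml; lra.
rewrite -(subrK k s) ripple_int ?intr_int// subrK => srr.
exists k; first exact: intr_int.
suff : `|s - k| < r by move=> /lt_le_trans; apply; rewrite ge_min lexx.
have isk : tau * `|s - k| \in `[0, pi] by rewrite taur// normr_ge0.
have ir : tau * r \in `[0, pi] by rewrite taur// ltW.
rewrite -(ltr_pM2l tau_gt0) -(ltr_cos isk ir).
have -> : cos (tau * `|s - k|) = cos (tau * (s - k)).
  by rewrite -[tau]gtr0_norm ?tau_gt0// -normrM cos_norm gtr0_norm ?tau_gt0.
by move: srr; rewrite /ripple ltrD2l ltrN2.
Qed.

Context {n : nat}.
Implicit Types a y : 'rV[R]_n.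

(** [of_torus] picks an arbitrary representative; the periodicity of [ripple] makes the choice
    invisible. *)
Definition torus_bump a : torus R n -> R :=
  fun x => \sum_(j < n) ripple (of_torus x 0 j - a 0 j).

Lemma torus_bump_lift a y : torus_bump a (to_torus y) = \sum_(j < n) ripple (y 0 j - a 0 j).
Proof.
apply: eq_bigr => j _.
have /to_torus_eqP/(_ j) := of_torusK (to_torus y).
set y' := of_torus _ => kint.
by rewrite -(ripple_int (y 0 j - a 0 j) kint); congr ripple; ring.
Qed.

Lemma torus_bump_ge0 a x : 0 <= torus_bump a x.
Proof. by apply: sumr_ge0 => j _; exact: ripple_ge0. Qed.

Lemma torus_bump_center a : torus_bump a (to_torus a) = 0.
Proof. by rewrite torus_bump_lift big1// => j _; rewrite subrr ripple0. Qed.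

(** One threshold c serves every centre a, which matters because the penalty in [line_descent] is
    centred at a moving point. *)
Lemma torus_bump_small (rho : R) : 0 < rho -> exists2 c, 0 < c &
  forall a x, torus_bump a x < c -> exists2 y, to_torus y = x & `|y - a| < rho.
Proof.
move=> rho0.
have [c c0 hc] : exists2 c, 0 < c & forall s, ripple s < c ->
    exists2 k, k \is a Num.int & `|s - k| < rho / 2.
  by apply: ripple_small; rewrite divr_gt0.
exists c => // a x ax.
have kex j : exists k, k \is a Num.int /\ `|of_torus x 0 j - a 0 j - k| < rho / 2.
  have [|k] := hc (of_torus x 0 j - a 0 j); last by exists k.
  apply: le_lt_trans ax; rewrite /torus_bump (bigD1 j)//= lerDl.
  by apply: sumr_ge0 => i _; exact: ripple_ge0.
have [k kP] := choice kex.
exists (\row_j (of_torus x 0 j - k j)).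
  rewrite -[RHS]of_torusK; apply/to_torus_eqP => j.
  by rewrite mxE addrAC subrr add0r rpredN; have [] := kP j.
apply: (@le_lt_trans _ _ (rho / 2)); last by rewrite ltr_pdivrMr// ltr_pMr// ltr1n.
apply: row_norm_le => [|j]; first by rewrite divr_ge0// ltW.
by rewrite !mxE addrAC ltW//; have [] := kP j.
Qed.

Lemma torus_bump_gradient (K : R) a y :
  gradient (periodic_lift (fun x => K * torus_bump a x)) y =
  \row_j (K * dripple (y 0 j - a 0 j)).
Proof.
apply/rowP => l; rewrite !mxE.
have hd := is_derive_ripple (y 0 l - a 0 l).
rewrite -[dripple _](@derive_val _ _ _ _ _ _ _ hd).
rewrite -[RHS]deriveZ /derive//.
set F := (X in lim (X @ _)); set G := (X in _ = lim (X @ _)).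
suff -> : F = G by [].
apply/funext => h; rewrite /F /G /=; congr (h^-1 *: _).
rewrite /periodic_lift !torus_bump_lift /GRing.scale/= -!mulrBr; congr (K * _).
rewrite (bigD1 l)//= [X in _ - X](bigD1 l)//= !mxE !eqxx !mulr1.
rewrite opprD addrACA [X in _ + X](_ : _ = 0) ?addr0.
  by rewrite addrA.
rewrite -sumrB big1// => j jl.
by rewrite !mxE (negbTE jl) andbF mulr0 add0r subrr.
Qed.

Lemma torus_bump_C1 (K : R) a : C1_torus (fun x => K * torus_bump a x).
Proof.
have dcoord j y : differentiable (fun y : 'rV[R]_n => y 0 j - a 0 j) y.
  by apply: differentiableB; [exact: differentiable_coord|exact: differentiable_cst].
split=> [y|].
  have -> : periodic_lift (fun x => K * torus_bump a x) =
      K *: \sum_(j < n) (fun y : 'rV[R]_n => ripple (y 0 j - a 0 j)).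
    by apply/funext => z; rewrite /periodic_lift torus_bump_lift fctE fct_sumE.
  apply: differentiableZ; apply: differentiable_sum => j.
  apply: (@differentiable_comp _ _ _ _ (fun y : 'rV[R]_n => y 0 j - a 0 j)).
    exact: dcoord.
  apply/derivable1_diffP.
  exact: (@ex_derive _ _ _ _ _ _ _ (is_derive_ripple (y 0 j - a 0 j))).
have -> : gradient (periodic_lift (fun x => K * torus_bump a x)) =
    fun y => \row_j (K * dripple (y 0 j - a 0 j)).
  by apply/funext => y; rewrite torus_bump_gradient.
apply: row_continuous => j; apply: fun_mul_continuous.
  exact: fun_cst_continuous.
apply: (@fun_comp_continuous _ _ _ (fun y : 'rV[R]_n => y 0 j - a 0 j) dripple).
  by move=> y; exact: differentiable_continuous.
exact: dripple_continuous.
Qed.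

End PeriodicBump.

(** * Growth along segments, controlled by test functions *)

Section LineDescent.
Context {R : realType}.

Lemma ripple_continuous : continuous (@ripple R).
Proof.
move=> s; apply/differentiable_continuous/derivable1_diffP.
exact: (@ex_derive _ _ _ _ _ _ _ (is_derive_ripple s)).
Qed.

(** Only increments to the left of s are used, so a maximum at the final time T of [line_descent]
    needs no separate case. *)
Lemma derive_ge0_right_end (g : R -> R) (s dg : R) : 0 < s ->
  is_derive s 1 g dg -> (forall t, 0 <= t <= s -> g t <= g s) -> 0 <= dg.
Proof.
move=> s0 [gs <-] gmax; rewrite leNgt; apply/negP => D0.
have /cvgrPdist_lt/(_ (- 'D_1 g s)) := gs; rewrite oppr_gt0 => /(_ D0).
move=> [r /= r0 Hr]; pose h := Num.min (r / 2) s.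
have h0 : 0 < h by rewrite lt_min s0 andbT divr_gt0.
have hr : h < r.
  by rewrite (@le_lt_trans _ _ (r / 2)) ?ge_min ?lexx// ltr_pdivrMr// ltr_pMr// ltr1n.
have hs : h <= s by rewrite ge_min lexx orbT.
have : `|'D_1 g s - (- h)^-1 * (g (- h + s) - g s)| < - 'D_1 g s.
  have := Hr (- h); rewrite /= sub0r opprK gtr0_norm// oppr_eq0 gt_eqF//.
  by move=> /(_ hr isT); rewrite [- h *: 1]mulr1.
have : g (- h + s) <= g s by apply: gmax; rewrite addrC subr_ge0 hs/= gerBl ltW.
rewrite -subr_le0 => gneg.
have : 0 <= (- h)^-1 * (g (- h + s) - g s).
  by rewrite mulr_le0// invr_le0 oppr_le0 ltW.
move: (_ * _) ('D_1 g s) D0 => q d d0 q0; rewrite ltr_norml; lra.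
Qed.

Context {n : nat}.

(* The supremum over y of f y - K |y - (y0 + t xi)|^2, with a periodic
   substitute for the square, grows in t at rate at most c: at a maximum point
   in (t, y) the time derivative of the penalty is minus its xi-derivative in
   y, which is controlled by the hypothesis on test functions. *)
Lemma line_descent (f : torus R n -> R) (y0 xi : 'rV[R]_n) (T c rho : R) :
  continuous f -> 0 < rho -> 0 <= T ->
  (forall phi x t y, C1_torus phi ->
     (forall x', f x' - phi x' <= f x - phi x) ->
     0 <= t <= T -> to_torus y = x -> `|y - (y0 + t *: xi)| < rho ->
     dotp xi (torus_gradient phi x) <= c) ->
  f (to_torus (y0 + T *: xi)) <= f (to_torus y0) + c * T.
Proof.
move=> fc rho0 T0 ftest.
(* An error e is lost at the initial point and e per unit of time in the slope, hence e (T + 1) in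
   all. *)
apply/ler_addgt0Pl => e' e'0; pose e := e' / (T + 1).
have T1 : 0 < T + 1 by lra.
have e0 : 0 < e by rewrite divr_gt0.
have -> : e' = e * (T + 1) by rewrite divfK// gt_eqF.
have [M M0 fM] := torus_bounded fc.
have fc' : continuous (fun y => f (to_torus y)) by exact/torus_continuousP.
have [r r0 fr] : exists2 r, 0 < r & forall y, `|y - y0| < r ->
    f (to_torus y) <= f (to_torus y0) + e.
  have /cvgrPdist_lt/(_ e e0)/nbhs_ballP[r /= r0 Hr] := fc' y0.
  exists r => // y yr; have := Hr y; rewrite -ball_normE/= distrC => /(_ yr).
  by rewrite ltr_norml; lra.
have rr0 : 0 < Num.min rho r by rewrite lt_min rho0.
have [c0 c00 hc0] := @torus_bump_small R n _ rr0.
(* The function f oscillates by at most 2 M, so with this K a maximum point must have a bump below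
   c0, hence a lift close to the moving centre. *)
pose K := (2 * M + 1) / c0.
have K0 : 0 < K by rewrite divr_gt0//; lra.
pose P (t : R) (y : 'rV[R]_n) :=
  \sum_(j < n) ripple (y 0 j - (y0 + t *: xi) 0 j).
have PE t y : P t y = torus_bump (y0 + t *: xi) (to_torus y) by rewrite torus_bump_lift.
pose Phi (w : R * 'rV[R]_n) := f (to_torus w.2) + - ((c + e) * w.1) +
  - (K * P w.1 w.2).
have Phic : continuous Phi.
  have fstc : continuous (fun w : R * 'rV[R]_n => w.1) by move=> w; exact: cvg_fst.
  have sndc : continuous (fun w : R * 'rV[R]_n => w.2) by move=> w; exact: cvg_snd.
  apply: fun_add_continuous; first apply: fun_add_continuous.
  - exact: (fun_comp_continuous sndc fc').
  - apply: fun_opp_continuous; apply: fun_mul_continuous => //.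
    exact: fun_cst_continuous.
  - apply: fun_opp_continuous; apply: fun_mul_continuous.
      exact: fun_cst_continuous.
    apply: fun_sum_continuous => j.
    apply: (fun_comp_continuous _ ripple_continuous).
    apply: fun_add_continuous.
      exact: (fun_comp_continuous sndc (@coord_continuous _ _ _ 0 j)).
    apply: fun_opp_continuous.
    rewrite (_ : (fun _ => _) = fun w : R * 'rV[R]_n => y0 0 j + w.1 * xi 0 j).
      apply: fun_add_continuous; first exact: fun_cst_continuous.
      by apply: fun_mul_continuous => //; exact: fun_cst_continuous.
    by apply/funext => w; rewrite !mxE.
have [|||[t y]] := @compact_EVT_max _ R Phi (`[0, T]%classic `*` unit_cube).
- exists (0, 0); split => /=; first by rewrite in_itv/= lexx.
  by move=> j; rewrite mxE in_itv/= lexx ler01.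
- exact: compact_setX (@segment_compact _ _ _) unit_cube_compact.
- exact: continuous_subspaceT.
rewrite inE => -[/= + ycube] tymax; rewrite in_itv/= => /andP[t0 tT].
have {tymax}tymax t' x : 0 <= t' <= T ->
    f x - (c + e) * t' - K * torus_bump (y0 + t' *: xi) x <=
    f (to_torus y) - (c + e) * t - K * torus_bump (y0 + t *: xi) (to_torus y).
  move=> t'T; have [y' y'cube <-] := unit_cube_rep x.
  by rewrite -!PE; apply: (tymax (t', y')); rewrite inE; split=> //=; rewrite in_itv.
have [y' y'y y'near] : exists2 y', to_torus y' = to_torus y &
    `|y' - (y0 + t *: xi)| < Num.min rho r.
  apply: hc0; rewrite -(ltr_pM2l K0) {2}/K divfK ?gt_eqF//.
  have := tymax t (to_torus (y0 + t *: xi)); rewrite t0 tT torus_bump_center => /(_ isT).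
  have := fM (to_torus y); have := fM (to_torus (y0 + t *: xi)).
  rewrite !ler_norml; lra.
move: y'near; rewrite lt_min => /andP[y'rho y'r].
(* A maximum at time 0 has a lift within r of y0, where f is at most f (y0) + e; comparing it with
   the point (T, y0 + T xi) gives the claim. *)
have [t_eq0|t_neq0] := eqVneq t 0.
  have := tymax T (to_torus (y0 + T *: xi)); rewrite T0 lexx torus_bump_center.
  move=> /(_ isT).
  have := fr y'; rewrite y'y; move: y'r; rewrite t_eq0 scale0r addr0 => -> /(_ isT).
  have := mulr_ge0 (ltW K0) (torus_bump_ge0 y0 (to_torus y)); lra.
(* At a positive time the penalty is a test function, so its xi-derivative K S is at most c, whereas
   maximality in time forces K S >= c + e: a contradiction. *)
have t_gt0 : 0 < t by rewrite lt_def t_neq0.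
have grad_le : dotp xi (torus_gradient (fun x => K * torus_bump (y0 + t *: xi) x)
    (to_torus y)) <= c.
  apply: (ftest _ _ t y' (torus_bump_C1 K (y0 + t *: xi))) => //; last by rewrite t0.
  by move=> x; have := tymax t x; rewrite t0 tT => /(_ isT); lra.
pose S := \sum_(j < n) xi 0 j * dripple (y 0 j - (y0 + t *: xi) 0 j).
have gradE : dotp xi (torus_gradient (fun x => K * torus_bump (y0 + t *: xi) x)
    (to_torus y)) = K * S.
  rewrite torus_gradientE torus_bump_gradient /dotp /S mulr_sumr.
  by apply: eq_bigr => j _; rewrite !mxE; ring.
have dP : is_derive t 1 (fun s => P s y) (- S).
  rewrite /S -sumrN.
  have -> : (fun s => P s y) = \sum_(j < n) (fun s => ripple (y 0 j - (y0 + s *: xi) 0 j)).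
    by apply/funext => s; rewrite fct_sumE.
  apply: is_derive_sum => j.
  have h1 : is_derive t 1 (fun s : R => y 0 j - (y0 + s *: xi) 0 j) (- xi 0 j).
    have -> : (fun s : R => y 0 j - (y0 + s *: xi) 0 j) =
        cst (y 0 j - y0 0 j) - xi 0 j *: id.
      apply/funext => s; rewrite !mxE -[RHS]/(y 0 j - y0 0 j - xi 0 j * s).
      by ring.
    by apply: is_derive_eq; rewrite sub0r [_ *: _]mulr1.
  have := @is_derive1_comp _ _ (fun s : R => y 0 j - (y0 + s *: xi) 0 j) _ _ _
    (is_derive_ripple (y 0 j - (y0 + t *: xi) 0 j)) h1.
  by rewrite mulrN mulrC.
have dg : is_derive t 1 (fun s => - ((c + e) * s) + - (K * P s y)) (- (c + e) + K * S).
  have -> : (fun s => - ((c + e) * s) + - (K * P s y)) =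
    - ((c + e) *: id) - K *: (fun s => P s y) by [].
  apply: is_derive_eq.
  by rewrite [(c + e) *: 1]mulr1 [K *: _]mulrN opprK.
have : 0 <= - (c + e) + K * S.
  apply: (derive_ge0_right_end t_gt0 dg) => s /andP[s0 st].
  have := tymax s (to_torus y); rewrite s0 (le_trans st tT) -!PE => /(_ isT); lra.
rewrite -gradE; lra.
Qed.

End LineDescent.

(** * Smoothing by averages *)

Section Primitives.
Context {R : realType}.
Notation mu := (@lebesgue_measure R).

Definition has_primitive (g G : R -> R) := forall x : R, is_derive x 1 G (g x).

Lemma primitive_exists (g : R -> R) : continuous g -> exists G, has_primitive g G.
Proof.
move=> gc.
have gint a b : mu.-integrable `[a, b]%classic (EFin \o g).
  apply: continuous_compact_integrable; first exact: segment_compact.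
  exact: continuous_subspaceT.
pose J a x := (\int[mu]_(t in `[a, x]) g t)%R.
pose K x y := (\int[mu]_(t in `]x, y]) g t)%R.
have JB a x b : a <= x -> x <= b -> J a b - J a x = K x b.
  by move=> ax xb; apply: Rintegral_itvB; [exact: gint|rewrite bnd_simp..].
pose G x := if 0 <= x then K 0 x else - K x 0.
have GE a x : a <= 0 -> a <= x -> G x = J a x - J a 0.
  move=> a0 ax; rewrite /G; case: ifPn => [x0|]; first by rewrite JB.
  by rewrite -ltNge => x0; rewrite -(JB a)// ?opprB// ltW.
(* The base point a lies to the left of both 0 and x, so near x the two-case definition of G
   coincides with an integral from the fixed bound a, minus a constant. *)
exists G => x; pose a : R := - `|x| - 2.
have a0 : a <= 0 by have := normr_ge0 x; rewrite /a; lra.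
have ax : a < x by have := ler_norm (- x); rewrite normrN /a; lra.
have [dJ dJE] : derivable (J a) x 1 /\ derive1 (J a) x = g x.
  by apply: (@continuous_FTC1_closed _ _ _ _ (x + 1)) => //; [lra|exact: gc].
have h : is_derive x 1 (J a - cst (J a 0)) (g x).
  have h1 : is_derive x 1 (J a) (g x).
    by apply: DeriveDef; [exact: dJ|rewrite -derive1E; exact: dJE].
  by apply: is_derive_eq; rewrite subr0.
apply: near_eq_is_derive h.
near=> y; apply/esym/GE => //.
by near: y; apply: cvgr_ge ax; exact: cvg_id.
Unshelve. all: by end_near. Qed.

Lemma primitive_le (g1 g2 G1 G2 : R -> R) (d : R) : 0 <= d ->
  has_primitive g1 G1 -> has_primitive g2 G2 ->
  (forall s, 0 <= s <= d -> g1 s <= g2 s) -> G1 d - G1 0 <= G2 d - G2 0.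
Proof.
move=> d0 h1 h2 g12.
have dG (x : R) : is_derive x 1 (G2 - G1) (g2 x - g1 x).
  by have := h1 x; have := h2 x => ? ?; exact: is_deriveB.
have [|c] := MVT_segment d0 (fun x _ => dG x).
  apply: continuous_subspaceT => x; apply/differentiable_continuous.
  by apply/derivable1_diffP; exact: ex_derive.
rewrite in_itv/= => cd eqc.
have : 0 <= (G2 - G1) d - (G2 - G1) 0.
  by rewrite eqc subr0 mulr_ge0// subr_ge0 g12.
by rewrite !fctE; lra.
Qed.

(** The mean of g over [0, d], expressed by a chosen primitive; by [avg1E] the choice does not
    affect the value. *)
Definition avg1 (d : R) (g : R -> R) : R :=
  let G := xget (cst 0) [set G | has_primitive g G] in (G d - G 0) / d.

Variable d : R.
Hypothesis d0 : 0 < d.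

Lemma avg1E g G : has_primitive g G -> avg1 d g = (G d - G 0) / d.
Proof.
move=> gG; rewrite /avg1; case: xgetP => [G' _ /= gG'|/(_ G)//].
congr (_ / d); apply/eqP; rewrite eq_le.
by rewrite !(primitive_le (ltW d0) _ _ (fun s _ => lexx (g s))).
Qed.

Lemma avg1_le (g1 g2 : R -> R) : continuous g1 -> continuous g2 ->
  (forall s, 0 <= s <= d -> g1 s <= g2 s) -> avg1 d g1 <= avg1 d g2.
Proof.
move=> /primitive_exists[G1 h1] /primitive_exists[G2 h2] g12.
rewrite (avg1E h1) (avg1E h2) ler_pM2r ?invr_gt0//.
exact: primitive_le (ltW d0) h1 h2 g12.
Qed.

Lemma avg1_cst (a : R) : avg1 d (fun _ => a) = a.
Proof.
have h : has_primitive (fun _ => a) (fun s => a * s).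
  by move=> x; apply: is_derive_eq; rewrite [LHS]mulr1.
by rewrite (avg1E h) mulr0 subr0 mulfK// gt_eqF.
Qed.

Lemma avg1_scaleD (a : R) (g1 g2 : R -> R) : continuous g1 -> continuous g2 ->
  avg1 d (fun s => a * g1 s + g2 s) = a * avg1 d g1 + avg1 d g2.
Proof.
move=> /primitive_exists[G1 h1] /primitive_exists[G2 h2].
have h : has_primitive (fun s => a * g1 s + g2 s) (a *: G1 + G2).
  by move=> x; have := h1 x; have := h2 x => ? ?; apply: is_derive_eq.
rewrite (avg1E h1) (avg1E h2) (avg1E h).
rewrite -[(a *: G1 + G2) d]/(a * G1 d + G2 d) -[(a *: G1 + G2) 0]/(a * G1 0 + G2 0).
by field; rewrite gt_eqF.
Qed.

(* The average of [g] over [t, t + d] has t-derivative (g (t + d) - g t) / d. *)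
Lemma avg1_shift (g : R -> R) C t : 0 <= C ->
  (forall x y, `|g x - g y| <= C * `|x - y|) ->
  `|avg1 d (fun s => g (t + s)) - avg1 d g - t * ((g d - g 0) / d)|
    <= (2 * C / d) * t ^+ 2.
Proof.
move=> C0 gC.
have gc : continuous g.
  move=> x; apply/cvgrPdist_le => e e0; near=> y.
  apply: (le_trans (gC x y)).
  apply: (@le_trans _ _ ((C + 1) * `|x - y|)); first by rewrite ler_wpM2r//; lra.
  rewrite -ler_pdivlMl; last by lra.
  near: y; apply: cvgr_dist_le; first exact: cvg_id.
  by rewrite mulr_gt0// invr_gt0; lra.
have [G gG] := primitive_exists gc.
have h : has_primitive (fun s => g (t + s)) (fun s => G (t + s)).
  move=> x; have h1 : is_derive x 1 (fun s => t + s) 1.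
    by apply: is_derive_eq; rewrite add0r mulr1.
  by have := @is_derive1_comp _ _ _ _ _ _ (gG (t + x)) h1; rewrite mulr1.
rewrite (avg1E h) (avg1E gG).
(* First-order expansion of the primitive by the mean value theorem. Its remainders at x = d and x =
   0 add up to 2 C t^2, whence the constant 2 C / d. *)
have tay x : `|G (t + x) - G x - t * g x| <= C * t ^+ 2.
  have Gc a b : {within `[a, b], continuous G}.
    apply: continuous_subspaceT => y; apply/differentiable_continuous.
    by apply/derivable1_diffP; have := gG y => ?; exact: ex_derive.
  have [c cx ->] : exists2 c, `|c - x| <= `|t| & G (t + x) - G x = g c * t.
    have [t0|t0] := leP 0 t.
      have [|c] := MVT_segment (_ : x <= t + x) (fun y _ => gG y) (Gc _ _).
        by rewrite lerDr.
      rewrite in_itv/= => /andP[c1 c2] ->; exists c.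
        by rewrite !ger0_norm//; lra.
      by rewrite addrK.
    have [|c] := MVT_segment (_ : t + x <= x) (fun y _ => gG y) (Gc _ _).
      by rewrite gerDr ltW.
    rewrite in_itv/= => /andP[c1 c2] eqc; exists c.
      by rewrite ler_norml ltr0_norm//; lra.
    by rewrite -opprB eqc; ring.
  rewrite [g c * t]mulrC -mulrBr normrM.
  have -> : t ^+ 2 = `|t| * `|t| by rewrite -normrM -expr2 ger0_norm ?sqr_ge0.
  rewrite mulrCA ler_wpM2l//.
  by apply: (le_trans (gC _ _)); rewrite ler_wpM2l.
rewrite addr0.
have -> : (G (t + d) - G t) / d - (G d - G 0) / d - t * ((g d - g 0) / d) =
  ((G (t + d) - G d - t * g d) - (G (t + 0) - G 0 - t * g 0)) / d.
  by rewrite addr0; field; rewrite gt_eqF.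
rewrite normrM normfV (gtr0_norm d0) mulrAC ler_pM2r ?invr_gt0//.
apply: (le_trans (ler_normB _ _)); have := tay d; have := tay 0; lra.
Unshelve. all: by end_near. Qed.

End Primitives.

Lemma lipschitz_fun_continuous {R : realType} (V : normedModType R) (C : R)
    (g : V -> R) : 0 <= C ->
  (forall x y, `|g x - g y| <= C * `|x - y|) -> continuous g.
Proof.
move=> C0 gC x; apply/cvgrPdist_le => e e0; apply/nbhs_ballP.
have C1 : 0 < C + 1 by lra.
exists (e / (C + 1)); first by rewrite /= divr_gt0.
move=> y; rewrite -ball_normE /= => xy; apply: (le_trans (gC x y)).
apply: (@le_trans _ _ ((C + 1) * `|x - y|)); first by rewrite ler_wpM2r//; lra.
by rewrite mulrC -ler_pdivlMr// ltW.
Qed.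

Section Smoothing.
Context {R : realType} {n : nat}.
Implicit Types (f g : 'rV[R]_n -> R) (x y h : 'rV[R]_n) (l : seq 'I_n) (C : R).

Local Notation dir j := (delta_mx 0 j : 'rV[R]_n).

Definition lip C f := forall x y, `|f x - f y| <= C * `|x - y|.

Lemma dir_norm_le (t : R) j : `|t *: dir j| <= `|t|.
Proof.
apply: row_norm_le => // i; rewrite !mxE normrM ler_piMr//.
by case: (_ && _); rewrite ?normr1 ?normr0.
Qed.

Lemma lip_line C f y j : 0 <= C -> lip C f ->
  forall s t, `|f (y + s *: dir j) - f (y + t *: dir j)| <= C * `|s - t|.
Proof.
move=> C0 fC s t; apply: (le_trans (fC _ _)); rewrite ler_wpM2l//.
by rewrite opprD addrACA subrr add0r -scalerBl dir_norm_le.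
Qed.

Lemma lip_continuous C f : 0 <= C -> lip C f -> continuous f.
Proof. exact: lipschitz_fun_continuous. Qed.

Lemma lip_line_continuous C f y j : 0 <= C -> lip C f ->
  continuous (fun s : R => f (y + s *: dir j)).
Proof. move=> C0 fC.
by apply: (@lipschitz_fun_continuous R R^o C) => //; exact: lip_line. Qed.

Variable d : R.
Hypothesis d0 : 0 < d.

Definition avg_dir (j : 'I_n) f : 'rV[R]_n -> R :=
  fun y => avg1 d (fun s => f (y + s *: dir j)).

(** For [l = enum 'I_n] this is the mean over the cube y + [0, d]^n, taken one coordinate at a
    time. *)
Definition avgs l f : 'rV[R]_n -> R := foldr avg_dir f l.

Lemma avg_dir_le C f g j x y : 0 <= C -> lip C f -> lip C g ->
  (forall s, 0 <= s <= d -> f (x + s *: dir j) <= g (y + s *: dir j)) ->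
  avg_dir j f x <= avg_dir j g y.
Proof.
by move=> C0 fC gC; apply: avg1_le => //; exact: lip_line_continuous C0 _.
Qed.

Lemma avg_dir_scaleD C C' a f g j y : 0 <= C -> 0 <= C' -> lip C f -> lip C' g ->
  avg_dir j (fun y => a * f y + g y) y = a * avg_dir j f y + avg_dir j g y.
Proof.
move=> C0 C'0 fC gC; rewrite /avg_dir avg1_scaleD//.
  exact: lip_line_continuous C0 fC.
exact: lip_line_continuous C'0 gC.
Qed.

Lemma lip_add C C' a f g : lip C f -> lip C' g ->
  lip (`|a| * C + C') (fun y => a * f y + g y).
Proof.
move=> fC gC x y.
have -> : a * f x + g x - (a * f y + g y) = a * (f x - f y) + (g x - g y) by ring.
rewrite (le_trans (ler_normD _ _))// mulrDl lerD// normrM -mulrA.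
by rewrite ler_wpM2l.
Qed.

Lemma lip_cst C a : 0 <= C -> lip C (fun _ => a).
Proof. by move=> C0 x y; rewrite subrr normr0 mulr_ge0. Qed.

Lemma avg_dir_lip C f j : 0 <= C -> lip C f -> lip C (avg_dir j f).
Proof.
move=> C0 fC.
suff le x y : avg_dir j f x <= avg_dir j f y + C * `|x - y|.
  move=> x y; have := le x y; have := le y x; rewrite distrC ler_norml; lra.
have -> : avg_dir j f y + C * `|x - y| =
    avg_dir j (fun y' => 1 * f y' + C * `|x - y|) y.
  rewrite (avg_dir_scaleD 1 j y C0 C0 fC (lip_cst _ C0)) mul1r.
  by rewrite [X in _ = _ + X]avg1_cst.
have lip1 : lip (`|1| * C + C) (fun y' => 1 * f y' + C * `|x - y|).
  exact: lip_add fC (lip_cst _ C0).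
have lip2 : lip (`|1| * C + C) f.
  move=> x' y'; apply: (le_trans (fC x' y')).
  by rewrite ler_wpM2r// normr1 mul1r lerDl.
apply: (avg_dir_le _ lip2 lip1); first by rewrite normr1 mul1r addr_ge0.
move=> s _; rewrite mul1r -lerBlDl (le_trans (ler_norm _))//.
by rewrite (le_trans (fC _ _))// opprD addrACA subrr addr0.
Qed.

Lemma avgs_lip C f l : 0 <= C -> lip C f -> lip C (avgs l f).
Proof. by move=> C0 fC; elim: l => //= j l; exact: avg_dir_lip. Qed.

Lemma avgs_scaleD C C' a f g l y : 0 <= C -> 0 <= C' -> lip C f -> lip C' g ->
  avgs l (fun y => a * f y + g y) y = a * avgs l f y + avgs l g y.
Proof.
move=> C0 C'0 fC gC; elim: l y => // j l IH y /=.
have /funext -> := IH.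
by rewrite (avg_dir_scaleD a j y C0 C'0) //; exact: avgs_lip.
Qed.

Lemma avgs_cst l a y : avgs l (fun _ => a) y = a.
Proof. by elim: l y => //= j l /funext ->y; rewrite /avg_dir avg1_cst. Qed.

Lemma avgs_translate l f h y : avgs l (fun x => f (x + h)) y = avgs l f (y + h).
Proof.
elim: l y => //= j l /funext -> y; rewrite /avg_dir; congr avg1.
by apply/funext => s; rewrite addrAC.
Qed.

(** Each average moves the argument by at most d, so the value at x depends only on a neighbourhood
    of known size. Inequalities valid only near x can thus be averaged. *)
Lemma avgs_le C f g l x : 0 <= C -> lip C f -> lip C g ->
  (forall y, `|y - x| <= (size l)%:R * d -> f y <= g y) ->
  avgs l f x <= avgs l g x.
Proof.
move=> C0 fC gC; elim: l x => [|j l IH] x fg /=.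
  by apply: fg; rewrite subrr normr0 mul0r.
apply: (avg_dir_le C0); [exact: avgs_lip..|] => s /andP[s0 sd].
apply: IH => y yx; apply: fg.
rewrite -(subrKA (x + s *: dir j)) (le_trans (ler_normD _ _))//.
rewrite /= -natr1 mulrDl mul1r lerD// addrC addKr.
by rewrite (le_trans (dir_norm_le _ _))// ger0_norm.
Qed.

(** Here g is the partial derivative of f along j, with a remainder uniform in y. Unlike mere
    differentiability, such a bound passes directly to averages in other directions. *)
Definition quad_partial C j f g :=
  forall (t : R) y, `|f (y + t *: dir j) - f y - t * g y| <= C * t ^+ 2.

(** By [avg1_shift] the derivative of a sliding mean is the difference quotient over its length; as
    a difference of values of f divided by d, it inherits a Lipschitz bound. *)
Lemma avg_dir_partial C f j : 0 <= C -> lip C f ->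
  let g y := (f (y + d *: dir j) - f y) / d in
  lip (2 * C / d) g /\ quad_partial (2 * C / d) j (avg_dir j f) g.
Proof.
move=> C0 fC g; split=> [x y|t y].
  have -> : g x - g y =
    ((f (x + d *: dir j) - f (y + d *: dir j)) - (f x - f y)) / d.
    by rewrite /g; field; rewrite gt_eqF.
  rewrite normrM normfV (gtr0_norm d0) mulrAC ler_pM2r ?invr_gt0//.
  rewrite (le_trans (ler_normB _ _))//.
  have := fC (x + d *: dir j) (y + d *: dir j); rewrite opprD addrACA subrr addr0.
  have := fC x y; lra.
have := avg1_shift d0 t C0 (lip_line y j C0 fC).
rewrite scale0r addr0 /avg_dir.
by under [in X in X -> _]eq_fun do rewrite scalerDl addrA.
Qed.

(** The remainder D is a linear combination of f, g and a translate of f, and averaging commutes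
    with both operations; an average of values bounded by K t^2 keeps that bound. *)
Lemma avg_dir_quad_partial C K i j f g : 0 <= C -> 0 <= K -> lip C f -> lip C g ->
  quad_partial K j f g -> quad_partial K j (avg_dir i f) (avg_dir i g).
Proof.
move=> C0 K0 fC gC fg t y.
pose D z := (- t) * g z + ((-1) * f z + f (z + t *: dir j)).
have transC : lip C (fun z => f (z + t *: dir j)).
  move=> z z'; have := fC (z + t *: dir j) (z' + t *: dir j).
  by rewrite opprD addrACA subrr addr0.
have ND := lip_add (-1) fC transC.
have ND0 : 0 <= `|-1 : R| * C + C by rewrite addr_ge0// mulr_ge0.
have DC := lip_add (- t) gC ND.
have DC0 : 0 <= `|- t| * C + (`|-1 : R| * C + C) by rewrite addr_ge0// mulr_ge0.
have -> : avg_dir i f (y + t *: dir j) - avg_dir i f y - t * avg_dir i g y =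
    avg_dir i D y.
  rewrite (avg_dir_scaleD _ _ _ C0 ND0 gC ND) (avg_dir_scaleD _ _ _ C0 C0 fC transC).
  have -> : avg_dir i (fun z => f (z + t *: dir j)) y = avg_dir i f (y + t *: dir j).
    exact: (avgs_translate [:: i]).
  ring.
have Dle z : `|D z| <= K * t ^+ 2.
  have -> : D z = f (z + t *: dir j) - f z - t * g z by rewrite /D; ring.
  exact: fg.
have cE : K * t ^+ 2 = avg_dir i (fun _ => K * t ^+ 2) y by rewrite /avg_dir avg1_cst.
have cNE : - (K * t ^+ 2) = avg_dir i (fun _ => - (K * t ^+ 2)) y.
  by rewrite /avg_dir avg1_cst.
rewrite ler_norml; apply/andP; split.
  rewrite [leLHS]cNE; apply: (avg_dir_le DC0) => //; first exact: lip_cst.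
  by move=> s _; have := Dle (y + s *: dir i); rewrite ler_norml => /andP[].
rewrite [leRHS]cE; apply: (avg_dir_le DC0) => //; first exact: lip_cst.
by move=> s _; have := Dle (y + s *: dir i); rewrite ler_norml => /andP[].
Qed.

Lemma avgs_partial C f l j : 0 <= C -> lip C f -> j \in l -> exists g,
  lip (2 * C / d) g /\ quad_partial (2 * C / d) j (avgs l f) g.
Proof.
move=> C0 fC.
have K0 : 0 <= 2 * C / d by rewrite divr_ge0 ?mulr_ge0// ltW.
elim: l => // i l IH; rewrite inE => /predU1P[->|/IH[g [gK gq]]] /=.
  by have [gK gq] := avg_dir_partial i C0 (avgs_lip l C0 fC); eexists; split; eauto.
exists (avg_dir i g); split; first exact: avg_dir_lip.
pose C' := C + 2 * C / d.
have C'0 : 0 <= C' by rewrite addr_ge0.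
apply: (avg_dir_quad_partial i C'0) => //.
  move=> x y; apply: (le_trans (avgs_lip l C0 fC x y)).
  by rewrite ler_wpM2r// lerDl.
by move=> x y; apply: (le_trans (gK x y)); rewrite ler_wpM2r// lerDr.
Qed.

End Smoothing.

Section QuadraticExpansion.
Context {R : realType} {n : nat}.
Implicit Types (x y h : 'rV[R]_n).
Local Notation dir j := (delta_mx 0 j : 'rV[R]_n).

(** The increment h is switched on one coordinate at a time. Each of the n steps costs K |h|^2 for
    the remainder and K |h|^2 for moving the partial derivative back to y, whence the factor 2 n. *)
Lemma partial_expansion (K : R) (f : 'rV[R]_n -> R) (g : 'I_n -> 'rV[R]_n -> R) :
  0 <= K -> (forall j, lip K (g j)) -> (forall j, quad_partial K j f (g j)) ->
  forall y h, `|f (y + h) - f y - dotp h (\row_j g j y)| <= 2 * n%:R * K * `|h| ^+ 2.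
Proof.
move=> K0 gK fg y h.
pose p k : 'rV[R]_n := \row_j (if (j < k)%N then h 0 j else 0).
have pn : p n = h by apply/rowP => j; rewrite mxE ltn_ord.
have ple k : `|p k| <= `|h|.
  apply: row_norm_le => // j; rewrite mxE; case: ifP => _; last by rewrite normr0.
  exact: norm_coord_le.
pose S k := \sum_(j < n | (j < k)%N) h 0 j * g j y.
have -> : dotp h (\row_j g j y) = S n.
  by rewrite /dotp /S; apply: eq_big => [j|j _]; rewrite ?ltn_ord// mxE.
suff main k : (k <= n)%N -> `|f (y + p k) - f y - S k| <= 2 * k%:R * K * `|h| ^+ 2.
  by rewrite -{1}pn; exact: main.
elim: k => [_|k IH kn].
  have -> : p 0 = 0 by apply/rowP => j; rewrite !mxE.
  by rewrite addr0 /S big_pred0// !subrr normr0 mulr0 !mul0r.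
pose j := Ordinal kn.
have pS : p k.+1 = p k + h 0 j *: dir j.
  apply/rowP => i; rewrite !mxE ltnS leq_eqVlt /=.
  have [->|ij] := eqVneq i j; first by rewrite eqxx ltnn add0r mulr1.
  by rewrite mulr0 addr0 (_ : (_ == k) = false)//; exact: negbTE ij.
have SS : S k.+1 = S k + h 0 j * g j y.
  rewrite /S (bigD1 j)//= addrC; congr (_ + _).
  apply: eq_bigl => i; rewrite ltnS leq_eqVlt -(inj_eq val_inj) /=.
  by case: (ltngtP i k).
rewrite pS SS addrA.
have -> : f (y + p k + h 0 j *: dir j) - f y - (S k + h 0 j * g j y) =
  (f (y + p k) - f y - S k) +
  (f (y + p k + h 0 j *: dir j) - f (y + p k) - h 0 j * g j (y + p k)) +
  h 0 j * (g j (y + p k) - g j y) by ring.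
have hj : `|h 0 j| <= `|h| by exact: norm_coord_le.
have e1 : `|f (y + p k + h 0 j *: dir j) - f (y + p k) - h 0 j * g j (y + p k)|
    <= K * `|h| ^+ 2.
  apply: (le_trans (fg _ _ _)); rewrite ler_wpM2l//.
  by rewrite -[X in X <= _]ger0_norm ?sqr_ge0// normrX lerXn2r ?nnegrE.
have e2 : `|h 0 j * (g j (y + p k) - g j y)| <= K * `|h| ^+ 2.
  rewrite normrM expr2 mulrCA ler_pM//.
  by apply: (le_trans (gK _ _ _)); rewrite addrAC subrr add0r ler_wpM2l.
have e3 := IH (ltnW kn).
rewrite (le_trans (ler_normD _ _))// (le_trans (lerD (ler_normD _ _) (lexx _)))//.
by move: e1 e2 e3; rewrite -natr1; lra.
Qed.

Lemma quadratic_expansion_differentiable (K : R) (f : 'rV[R]_n -> R)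
    (g : 'rV[R]_n -> 'rV[R]_n) : 0 <= K ->
  (forall y h, `|f (y + h) - f y - dotp h (g y)| <= K * `|h| ^+ 2) ->
  forall y, differentiable f y /\ gradient f y = g y.
Proof.
move=> K0 fg y.
have lin : linear (fun h => dotp h (g y) : (R : normedModType R)).
  by move=> a u w; rewrite dotpDl dotpZl.
pose L : {linear 'rV[R]_n -> (R : normedModType R)} :=
  HB.pack (fun h => dotp h (g y)) (GRing.isLinear.Build _ _ _ _ _ lin).
have Lc : continuous L.
  have h1 : continuous (fun h : 'rV[R]_n => h) by move=> h; exact: cvg_id.
  have h2 : continuous (fun _ : 'rV[R]_n => g y) 
    by move=> h; apply: cvg_cst; exact: nbhs_filter.
  exact: (dotp_continuous h1 h2).
have fo (e : R) : 0 < e ->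
    \forall h \near nbhs (0 : 'rV[R]_n), `|f (h + y) - (f y + L h)| <= e * `|h|.
  move=> e0; have K1 : 0 < K + 1 by lra.
  apply/nbhs_ballP; exists (e / (K + 1)); first by rewrite /= divr_gt0.
  move=> h; rewrite -ball_normE/= sub0r normrN => hK.
  rewrite [h + y]addrC opprD addrA; apply: (le_trans (fg y h)).
  apply: (@le_trans _ _ ((K + 1) * `|h| ^+ 2)); first by rewrite ler_wpM2r//; lra.
  rewrite expr2 mulrA ler_wpM2r// mulrC.
  by rewrite -ler_pdivlMr// ltW.
have dL : 'd f y = L :> ('rV[R]_n -> R).
  by apply: diff_unique Lc _; apply/eqaddoP; exact: fo.
have df : differentiable f y.
  by apply/diff_locallyP; rewrite dL; split=> //; apply/eqaddoP; exact: fo.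
split=> //; apply/rowP => j; rewrite mxE deriveE// dL /=.
by rewrite dotpC dotp_delta.
Qed.

End QuadraticExpansion.

(** * Smooth approximate subsolutions *)

Section EuclideanNorm.
Context {R : realType} {n : nat}.
Implicit Types x : 'rV[R]_n.

Lemma coord_le_enorm x j : `|x 0 j| <= enorm x.
Proof.
rewrite -sqrtr_sqr ler_wsqrtr// /dotp (bigD1 j)//= -expr2 lerDl.
by apply: sumr_ge0 => i _; rewrite -expr2 sqr_ge0.
Qed.

Lemma enorm_le x (a : R) : 0 <= a -> (forall j, `|x 0 j| <= a) ->
  enorm x <= Num.sqrt (n%:R * a ^+ 2).
Proof.
move=> a0 xa; rewrite ler_wsqrtr// /dotp.
apply: (@le_trans _ _ (\sum_(j < n) a ^+ 2)).
  apply: ler_sum => j _; rewrite -expr2 -[leLHS]ger0_norm ?sqr_ge0// normrX.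
  by rewrite lerXn2r ?nnegrE.
by rewrite sumr_const card_ord mulr_natl.
Qed.

Lemma dotp_abs_le (x y : 'rV[R]_n) : `|dotp x y| <= (\sum_(j < n) `|x 0 j|) * `|y|.
Proof.
rewrite /dotp mulr_suml (le_trans (ler_norm_sum _ _ _))//.
by apply: ler_sum => j _; rewrite normrM ler_wpM2l// norm_coord_le.
Qed.

End EuclideanNorm.

Lemma uniform_radius {R : realType} (I : finType) (Q : I -> R -> Prop) :
  (forall i, exists2 r : R, 0 < r & forall s : R, 0 < s <= r -> Q i s) ->
  exists2 r : R, 0 < r & forall i, Q i r.
Proof.
move=> hQ; have [r rP] := choice (fun i => let: ex_intro2 r h1 h2 := hQ i in
  ex_intro (fun r : R => 0 < r /\ forall s : R, 0 < s <= r -> Q i s) r (conj h1 h2)).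
have min0 : 0 < \big[Num.min/1]_i r i.
  elim/big_ind : _ => [|x y x0 y0|i _]; first exact: ltr01.
    by rewrite lt_min x0.
  by have [] := rP i.
exists (\big[Num.min/1]_i r i) => // i; have [_] := rP i; apply.
by rewrite min0 bigmin_le_cond.
Qed.

(** The limit t -> 0+ in the form in which auxiliary errors are removed throughout. *)
Lemma le0_of_linear_bound {R : realType} (a K t0 : R) : 0 < t0 ->
  (forall t, 0 < t <= t0 -> a <= K * t) -> a <= 0.
Proof.
move=> t00 aK; rewrite leNgt; apply/negP => a0.
have K1 : 0 < `|K| + 1 by have := normr_ge0 K; lra.
pose t := Num.min t0 (a / (2 * (`|K| + 1))).
have t_gt0 : 0 < t by rewrite lt_min t00/= divr_gt0// mulr_gt0.
have ta : t * (2 * (`|K| + 1)) <= a.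
  by rewrite -ler_pdivlMr ?mulr_gt0// ge_min lexx orbT.
have := aK t; rewrite t_gt0 ge_min lexx => /(_ isT).
have : K * t <= `|K| * t by rewrite ler_wpM2r ?ler_norm// ltW.
by move: ta; rewrite mulrA mulrDr mulr1 -mulrA => *; nra.
Qed.

Section SubsolutionRegularity.
Context {R : realType} {n m : nat}.
Variables (H : 'I_m -> torus R n -> 'rV[R]_n -> 'rV[R]_m -> R) (lambda : R).
Variable v : 'I_m -> torus R n -> R.
Hypotheses (H_continuous : hamiltonian_continuous H)
  (H_coercive : hamiltonian_coercive H) (lambda_gt0 : 0 < lambda)
  (v_sub : viscosity_subsolution H lambda v).

Let v_continuous i : continuous (v i). Proof. exact: v_sub.1. Qed.

Definition touches_above (phi f : torus R n -> R) (x : torus R n) :=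
  C1_torus phi /\ forall y, f y - phi y <= f x - phi x.

Lemma solution_bounded : exists2 M, 0 <= M & forall i x, `|v i x| <= M.
Proof.
have vM i : exists M, 0 <= M /\ forall x, `|v i x| <= M.
  by have [M ? ?] := torus_bounded (@v_continuous i); exists M.
have [M MP] := choice vM; exists (\sum_i M i).
  by apply: sumr_ge0 => i _; have [] := MP i.
move=> i x; have [_ /(_ x)] := MP i => /le_trans; apply.
by rewrite (bigD1 i)//= lerDl; apply: sumr_ge0 => j _; have [] := MP j.
Qed.

(** At a touching point the subsolution property gives H <= - lambda v_i <= lambda M, and coercivity
    at that level bounds the gradient. The radius r exceeds the Euclidean norm of every value of
    v. *)
Lemma touching_gradient_bounded : exists2 C, 0 <= C &
  forall i phi x j, touches_above phi (v i) x -> `|torus_gradient phi x 0 j| <= C.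
Proof.
have [M M0 vM] := solution_bounded.
pose r := Num.sqrt (m%:R * M ^+ 2) + 1.
have r0 : 0 < r by rewrite ltr_wpDl// sqrtr_ge0.
have KP i := H_coercive i r0 (lambda * M).
have [K {}KP] := choice KP.
exists (\sum_i `|K i|) => [|i phi x j [phiC1 touch]].
  by apply: sumr_ge0.
apply: (@le_trans _ _ `|K i|); last first.
  by rewrite (bigD1 i)//= lerDl; apply: sumr_ge0.
apply: (le_trans (coord_le_enorm _ j)).
apply: (le_trans _ (ler_norm _)); rewrite leNgt; apply/negP => /(KP i).
have := v_sub.2 i phi x phiC1 touch; set p := torus_gradient phi x => sub.
apply/negP; rewrite -leNgt; apply: (@le_trans _ _ (H i x p (tuple_at v x))%:E).
  apply: ereal_inf_lbound; exists (x, tuple_at v x) => //=.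
  rewrite /r (@le_lt_trans _ _ (Num.sqrt (m%:R * M ^+ 2))) ?ltrDl//.
  by apply: enorm_le => // k; rewrite mxE.
rewrite lee_fin; have := vM i x; rewrite ler_norml => /andP[vM1 _].
have : lambda * - M <= lambda * v i x by rewrite ler_wpM2l// ltW.
by rewrite mulrN; lra.
Qed.

(** [line_descent] turns the bound on touching gradients into a Lipschitz bound; the factor n comes
    from summing the n gradient coordinates against the sup norm of xi. As the gradient bound is
    global, the radius 1 is arbitrary. *)
Lemma solution_lip : exists2 C, 0 <= C & forall i, lip C (periodic_lift (v i)).
Proof.
have [C C0 gC] := touching_gradient_bounded.
exists (n%:R * C) => [|i]; first by rewrite mulr_ge0.
have step y xi : v i (to_torus (y + xi)) <= v i (to_torus y) + n%:R * C * `|xi|.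
  rewrite -{1}(scale1r xi) -[X in _ <= _ + X]mulr1.
  apply: (line_descent (rho := 1) (@v_continuous i)) => // phi x t y' C1 touch _ _ _.
  apply: (le_trans (ler_norm _)); rewrite dotpC; apply: (le_trans (dotp_abs_le _ _)).
  rewrite ler_wpM2r// (le_trans (ler_sum _ (fun j _ => gC i phi x j (conj C1 touch))))//.
  by rewrite sumr_const card_ord mulr_natl.
move=> x y; have := step x (y - x); have := step y (x - y).
rewrite !(addrC _ (_ - _)) !subrK (distrC y x) /periodic_lift ler_norml; lra.
Qed.

(** Touching gradients and values of v range over compact boxes, where H is uniformly continuous, so
    moving x to x0 costs at most e. With x frozen, the Lagrangian at the single point x0 can be used
    on a whole neighbourhood. *)
Lemma frozen_subsolution (e : R) : 0 < e -> exists2 r, 0 < r &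
  forall i phi y x0, touches_above phi (v i) (to_torus y) -> `|y - x0| < r ->
  lambda * v i (to_torus y) + H i (to_torus x0) (torus_gradient phi (to_torus y))
    (tuple_at v (to_torus y)) <= e.
Proof.
move=> e0; apply: uniform_radius => i.
have [C C0 gC] := touching_gradient_bounded.
have [M M0 vM] := solution_bounded.
pose box k (a : R) : set 'rV[R]_k := [set y | forall j, y ord0 j \in `[- a, a]].
have boxc k a : compact (box k a).
  exact: (@rV_compact R k (fun=> `[- a, a]%classic) (fun=> @segment_compact R (- a) a)).
have Gc : continuous (fun w : 'rV[R]_n * 'rV[R]_n * 'rV[R]_m =>
    H i (to_torus w.1.1) w.1.2 w.2).
  apply: (@fun_comp_continuous _ _ _
    (fun w : 'rV[R]_n * 'rV[R]_n * 'rV[R]_m => (to_torus w.1.1, w.1.2, w.2))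
    (fun w => H i w.1.1 w.1.2 w.2)); last exact: H_continuous.
  apply: fun_pair_continuous; last exact: fun_snd_continuous.
  apply: fun_pair_continuous.
    apply: (fun_comp_continuous _ (@to_torus_continuous R n)).
    exact: (fun_comp_continuous (@fun_fst_continuous _ _) (@fun_fst_continuous _ _)).
  exact: (fun_comp_continuous (@fun_fst_continuous _ _) (@fun_snd_continuous _ _)).
have [r r0 Hr] := compact_uniform_continuity
  (compact_setX (compact_setX unit_cube_compact (boxc n C)) (boxc m M)) Gc e0.
exists r => // s /andP[s0 sr] phi y x0 touch yx0.
have [y1 y1cube y1y] := unit_cube_rep (to_torus y).
(* The lattice translation that brings y into the unit cube is applied to x0 too: distance and torus
   point are kept, though x1 may leave the cube. *)
pose x1 := x0 + (y1 - y).
have x1x0 : to_torus x1 = to_torus x0.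
  apply/to_torus_eqP => j; move/to_torus_eqP : y1y => /(_ j).
  by rewrite !mxE [x0 0 j + _]addrC addrK.
set p := torus_gradient _ _; set u := tuple_at _ _.
have sub := v_sub.2 i phi (to_torus y) touch.1 touch.2; rewrite -/p -/u in sub.
have inbox : (unit_cube `*` box n C `*` box m M) (y1, p, u).
  split; last by move=> j /=; rewrite in_itv/= -ler_norml mxE.
  by split=> //= j; rewrite in_itv/= -ler_norml; exact: gC touch.
have near1 : ball (y1, p, u) r (x1, p, u).
  split; last exact: ballxx.
  split; last exact: ballxx.
  rewrite -ball_normE /= /x1 opprD opprB addrA addrC subrKA.
  exact: lt_le_trans yx0 sr.
by move: (Hr _ _ inbox near1) => /=; rewrite y1y x1x0 ltr_norml; lra.
Qed.

(* For fixed x0, xi, eta, the frozen inequality bounds the xi-derivative of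
   [v i] near x0 by the affine function g of v. *)
Lemma line_growth (e r : R) (i : 'I_m) (x0 xi : 'rV[R]_n) (eta : 'rV[R]_m) (ell : R)
    (g := fun y => ell + e - (lambda * v i (to_torus y) +
                              dotp eta (tuple_at v (to_torus y)))) :
  0 < r ->
  (forall phi y, touches_above phi (v i) (to_torus y) -> `|y - x0| < r ->
    lambda * v i (to_torus y) + H i (to_torus x0) (torus_gradient phi (to_torus y))
      (tuple_at v (to_torus y)) <= e) ->
  (forall p u, dotp xi p + dotp eta u - H i (to_torus x0) p u <= ell) ->
  exists t0 K, [/\ 0 < t0, 0 <= K & forall t y, 0 < t <= t0 -> `|y - x0| <= r / 2 ->
    v i (to_torus (y + t *: xi)) <= v i (to_torus y) + t * g y + K * t ^+ 2].
Proof.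
move=> r0 frozen Lle; have [C C0 vC] := solution_lip.
pose Cg := (lambda + \sum_(j < m) `|eta 0 j|) * C.
have Cg0 : 0 <= Cg.
  by rewrite mulr_ge0// addr_ge0 ?(ltW lambda_gt0)// sumr_ge0.
have gC y y' : g y <= g y' + Cg * `|y - y'|.
  have -> : Cg * `|y - y'| =
      lambda * (C * `|y - y'|) + (\sum_(j < m) `|eta 0 j|) * (C * `|y - y'|).
    by rewrite /Cg; ring.
  have h1 : lambda * (v i (to_torus y') - v i (to_torus y)) <= lambda * (C * `|y - y'|).
    rewrite ler_wpM2l ?(ltW lambda_gt0)// (le_trans (ler_norm _))// distrC.
    exact: vC.
  have h2 : dotp eta (tuple_at v (to_torus y')) - dotp eta (tuple_at v (to_torus y)) <=
      (\sum_(j < m) `|eta 0 j|) * (C * `|y - y'|).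
    rewrite -dotpNr -dotpDr (le_trans (ler_norm _))// (le_trans (dotp_abs_le _ _))//.
    rewrite ler_wpM2l ?sumr_ge0//; apply: row_norm_le => [|j]; first exact: mulr_ge0.
    by rewrite !mxE distrC; exact: vC.
  by rewrite /g; lra.
(* The tube around the segment is given radius t, so it stays within t b of y. There g exceeds g y
   by at most Cg t b, which over a time t costs the term K t^2; t0 keeps the tube within r of x0. *)
pose b := 1 + `|xi|; have b0 : 0 < b by rewrite ltr_wpDr.
exists (r / (2 * b)), (Cg * b); split; first by rewrite divr_gt0// mulr_gt0.
  by rewrite mulr_ge0// ltW.
move=> t y /andP[t0 tt0] yx0.
have near0 s y' : 0 <= s <= t -> `|y' - (y + s *: xi)| < t -> `|y' - y| < t * b.
  move=> /andP[s0 st] y't; rewrite -(subrKA (y + s *: xi)).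
  rewrite (le_lt_trans (ler_normD _ _))// mulrDr mulr1 ltr_leD//.
  by rewrite addrAC subrr add0r normrZ ger0_norm// ler_wpM2r.
have tb : t * b <= r / 2.
  by move: tt0; rewrite ler_pdivlMr ?mulr_gt0//; lra.
apply: (le_trans (line_descent (c := g y + Cg * (t * b)) (@v_continuous i) t0
  (ltW t0) _)); last lra.
move=> phi x s y' C1 touch st y'x y's.
have y'y := near0 s y' st y's.
have touch' : touches_above phi (v i) (to_torus y') by rewrite y'x.
have y'x0 : `|y' - x0| < r.
  rewrite -(subrKA y) (le_lt_trans (ler_normD _ _))// [r]splitr ltr_leD//.
  exact: lt_le_trans y'y tb.
have := frozen phi y' touch' y'x0.
have := Lle (torus_gradient phi (to_torus y')) (tuple_at v (to_torus y')).
have := gC y' y; have : Cg * `|y' - y| <= Cg * (t * b) by rewrite ler_wpM2l// ltW.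
by rewrite -y'x /g; lra.
Qed.

End SubsolutionRegularity.

Section AverageRegularity.
Context {R : realType} {n : nat}.
Variables (d C : R) (d0 : 0 < d) (C0 : 0 <= C).

Lemma lip_affine (I : Type) (s : seq I) (b : I -> R) (F : I -> 'rV[R]_n -> R) (k : R) :
  (forall i, lip C (F i)) ->
  lip ((\sum_(i <- s) `|b i|) * C) (fun y => k + \sum_(i <- s) b i * F i y).
Proof.
move=> FC x y; rewrite opprD addrACA subrr add0r -sumrB mulr_suml mulr_suml.
rewrite (le_trans (ler_norm_sum _ _ _))//; apply: ler_sum => i _.
by rewrite -mulrBr normrM -mulrA ler_wpM2l//; exact: FC.
Qed.

Lemma avgs_affine (I : Type) (s : seq I) (b : I -> R) (F : I -> 'rV[R]_n -> R) (k : R) l x :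
  (forall i, lip C (F i)) ->
  avgs d l (fun y => k + \sum_(i <- s) b i * F i y) x =
  k + \sum_(i <- s) b i * avgs d l (F i) x.
Proof.
move=> FC; elim: s => [|i s IH].
  rewrite big_nil addr0 -[RHS](avgs_cst d0 l k x); congr (avgs d l _ x).
  by apply/funext => y; rewrite big_nil addr0.
rewrite big_cons addrCA -IH.
have SC0 : 0 <= (\sum_(i <- s) `|b i|) * C.
  by apply: mulr_ge0 => //; exact: sumr_ge0.
rewrite -(avgs_scaleD d0 (b i) l x C0 SC0 (FC i) (lip_affine s b k FC)).
by congr (avgs d l _ x); apply/funext => y; rewrite big_cons addrCA.
Qed.

Lemma avgs_expansion (f : 'rV[R]_n -> R) : lip C f -> exists G K,
  [/\ continuous G, 0 <= K & forall y h,
    `|avgs d (enum 'I_n) f (y + h) - avgs d (enum 'I_n) f y - dotp h (G y)| <=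
      K * `|h| ^+ 2].
Proof.
move=> fC.
have gP j := avgs_partial d0 C0 fC (mem_enum 'I_n j).
have [g {}gP] := choice gP.
have K0 : 0 <= 2 * C / d by rewrite divr_ge0 ?mulr_ge0// ltW.
exists (fun y => \row_j g j y), (2 * n%:R * (2 * C / d)); split.
- apply: row_continuous => j; have [gl _] := gP j; exact: (lip_continuous K0 gl).
- by apply: mulr_ge0 => //; exact: mulr_ge0.
- by apply: partial_expansion => // j; [exact: (gP j).1|exact: (gP j).2].
Qed.

End AverageRegularity.

Section SmoothSubsolution.
Context {R : realType} {n m : nat}.
Variables (H : 'I_m -> torus R n -> 'rV[R]_n -> 'rV[R]_m -> R) (lambda : R).
Variable v : 'I_m -> torus R n -> R.
Hypotheses (H_continuous : hamiltonian_continuous H)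
  (H_coercive : hamiltonian_coercive H) (lambda_gt0 : 0 < lambda)
  (v_sub : viscosity_subsolution H lambda v).

Definition adjoint (w : 'I_m -> torus R n -> R) (i : 'I_m) (x : torus R n)
    (xi : 'rV[R]_n) (eta : 'rV[R]_m) : R :=
  dotp xi (torus_gradient (w i) x) + dotp eta (tuple_at w x) + lambda * w i x.

(** The gradient bound C does not depend on e, because [weak_duality] fixes its box before e is
    chosen. Points with infinite Lagrangian are covered vacuously, as ell is a real upper bound. *)
Lemma smooth_subsolution : exists2 C, 0 <= C & forall e : R, 0 < e ->
  exists w : 'I_m -> torus R n -> R,
  [/\ forall i, C1_torus (w i), forall i x, `|w i x - v i x| <= e,
      forall i x j, `|torus_gradient (w i) x 0 j| <= C &
      forall i x xi eta ell,
        (forall p u, dotp xi p + dotp eta u - H i x p u <= ell) ->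
        adjoint w i x xi eta <= ell + e].
Proof.
have [C C0 vC] := solution_lip H_coercive lambda_gt0 v_sub.
exists C => // e e0.
have [r r0 frozen] := frozen_subsolution H_continuous H_coercive lambda_gt0 v_sub e0.
(* An average over n directions reaches as far as n d: this must not exceed r / 2, for [line_growth]
   to apply, nor e / (C + 1), for W to stay within e of v. *)
pose d := Num.min (r / 2) (e / (C + 1)) / n.+1%:R.
have C1 : 0 < C + 1 by lra.
have mn0 : 0 < Num.min (r / 2) (e / (C + 1)) by rewrite lt_min !divr_gt0.
have d0 : 0 < d by exact: divr_gt0.
pose l := enum 'I_n.
have ld : (size l)%:R * d <= Num.min (r / 2) (e / (C + 1)).
  rewrite size_enum_ord /d mulrCA ler_piMr//; first exact: ltW.
  by rewrite ler_pdivrMr// mul1r ler_nat.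
have ldr : (size l)%:R * d <= r / 2 by rewrite (le_trans ld)// ge_min lexx.
have lde : C * ((size l)%:R * d) <= e.
  rewrite (@le_trans _ _ ((C + 1) * (e / (C + 1))))//; last first.
    by rewrite mulrC divfK// gt_eqF.
  rewrite ler_pM//; [by rewrite mulr_ge0// ltW|lra|].
  by rewrite (le_trans ld)// ge_min lexx orbT.
pose W i := avgs d l (periodic_lift (v i)).
pose w i x := W i (of_torus x).
(* Averages commute with translations, in particular by lattice vectors, so [W i] is the lift of a
   function on the torus. *)
have liftE i : periodic_lift (w i) = W i.
  apply/funext => y; rewrite /periodic_lift /w; set y' := of_torus _.
  have -> : y' = y + (y' - y) by rewrite addrC subrK.
  rewrite /W -avgs_translate; congr (avgs d l _ y); apply/funext => x.
  rewrite /periodic_lift; congr (v i _); apply/to_torus_eqP => j.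
  have /to_torus_eqP/(_ j) := of_torusK (to_torus y).
  by rewrite -/y' !mxE addrAC subrr add0r.
have WC i : lip C (W i) by apply: avgs_lip => //; exact: vC.
have expand i := avgs_expansion d0 C0 (vC i).
have [G {}expand] := choice expand.
have [K {}expand] := choice expand.
have K0 i : 0 <= K i by have [] := expand i.
have dW i y : differentiable (W i) y /\ gradient (W i) y = G i y.
  by have [_ _ h] := expand i; exact: (quadratic_expansion_differentiable (K0 i) h).
have wG i x : torus_gradient (w i) x = G i (of_torus x).
  by rewrite /torus_gradient liftE (dW i _).2.
exists w; split.
- move=> i; split=> [y|]; first by rewrite liftE; exact: (dW i y).1.
  have -> : gradient (periodic_lift (w i)) = G i.
    by apply/funext => y; rewrite liftE (dW i y).2.
  by have [] := expand i.
- move=> i x; rewrite -[X in v i X](of_torusK x) /w /W.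
  set y := of_torus x; set f := periodic_lift (v i).
  have close y' : `|y' - y| <= (size l)%:R * d -> `|f y' - f y| <= e.
    move=> y'y; apply: (le_trans (vC i _ _)); apply: (le_trans _ lde).
    by rewrite ler_wpM2l.
  rewrite ler_norml; apply/andP; split.
    rewrite lerBrDl -[v i (to_torus y)]/(f y) -[leLHS](avgs_cst d0 l _ y).
    apply: (avgs_le d0 C0 (lip_cst _ C0) (vC i)) => y' /close.
    by rewrite /= -/f ler_norml; lra.
  rewrite lerBlDl -[v i (to_torus y)]/(f y) -[leRHS](avgs_cst d0 l _ y).
  apply: (avgs_le d0 C0 (vC i) (lip_cst _ C0)) => y' /close.
  by rewrite /= -/f ler_norml; lra.
(* The expansion at step t along the j-th direction is compared with the Lipschitz bound C t and
   divided by t; letting t -> 0 leaves C. *)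
- move=> i x j; rewrite wG -subr_le0; set y := of_torus x.
  apply: (@le0_of_linear_bound _ _ (K i) 1) => // t /andP[t0 _].
  have [_ _ /(_ y (t *: delta_mx 0 j))] := expand i.
  rewrite dotpC dotpZr dotp_delta => hq.
  have tn : `|t *: delta_mx 0 j : 'rV[R]_n| <= t.
    by rewrite (le_trans (dir_norm_le _ _))// gtr0_norm.
  have {}hq : `|t * G i y 0 j| <= C * t + K i * t ^+ 2.
    have hl : `|W i (y + t *: delta_mx 0 j) - W i y| <= C * t.
      by apply: (le_trans (WC i _ _)); rewrite addrAC subrr add0r ler_wpM2l.
    have hn : K i * `|t *: delta_mx 0 j : 'rV[R]_n| ^+ 2 <= K i * t ^+ 2.
      by rewrite ler_wpM2l// lerXn2r// nnegrE// ltW.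
    move: hq hl; rewrite -/(W i (y + t *: delta_mx 0 j)) -/(W i y).
    by move: (W i _ - W i _) => q; rewrite !ler_norml; lra.
  rewrite -(ler_pM2l t0) mulrBr lerBlDl.
  by move: hq; rewrite normrM gtr0_norm// expr2; lra.
- move=> i x xi eta ell Lle; rewrite /adjoint wG; set x0 := of_torus x.
  have frozen_i phi y := frozen i phi y x0.
  have Lle' p u : dotp xi p + dotp eta u - H i (to_torus x0) p u <= ell.
    by rewrite of_torusK.
  have [t0 [K1 [t00 K10 growth]]] :=
    line_growth H_coercive lambda_gt0 v_sub r0 frozen_i Lle'.
  rewrite -subr_le0; apply: (@le0_of_linear_bound _ _ (K1 + K i * `|xi| ^+ 2) t0) => // t.
  move=> /andP[t_gt0 tt0].
  (* With these b and k the bound of [line_growth] reads v_i (y + t xi) <= k + sum_j b_j v_j (y),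
     with constant coefficients, so it can be averaged. Expanding W_i (x0 + t xi), dividing by t and
     letting t -> 0 leaves A W <= ell + e. *)
  pose b j : R := (j == i)%:R - t * (lambda * (j == i)%:R + eta 0 j).
  pose k := t * (ell + e) + K1 * t ^+ 2.
  have sumE (a : 'I_m -> R) : \sum_(j < m) b j * a j =
      a i - t * (lambda * a i + dotp eta (\row_j a j)).
    have -> : a i = \sum_(j < m) (j == i)%:R * a j.
      rewrite (bigD1 i)//= eqxx mul1r big1 ?addr0// => j /negbTE ->.
      by rewrite mul0r.
    rewrite /dotp mulr_sumr -big_split mulr_sumr -sumrB; apply: eq_bigr => j _.
    by rewrite /b /= mxE; ring.
  have up : W i (x0 + t *: xi) <= k + \sum_(j < m) b j * W j x0.
    rewrite /W -(avgs_affine d0 C0 _ _ _ _ _ vC) -avgs_translate.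
    pose C' := C + (\sum_(j < m) `|b j|) * C.
    have bC0 : 0 <= (\sum_(j < m) `|b j|) * C by rewrite mulr_ge0// sumr_ge0.
    have C'0 : 0 <= C' by rewrite addr_ge0.
    apply: (avgs_le d0 C'0).
    - move=> y y'; apply: (le_trans (vC i _ _)).
      by rewrite opprD addrACA subrr addr0 ler_wpM2r// lerDl.
    - move=> y y'; apply: (le_trans (lip_affine _ _ _ vC y y')).
      by rewrite ler_wpM2r// lerDr.
    move=> y yx0; rewrite sumE /k.
    have := growth t y; rewrite t_gt0 tt0 => /(_ isT (le_trans yx0 ldr)).
    rewrite /periodic_lift /tuple_at; lra.
  have lo : W i x0 + t * dotp xi (G i x0) - K i * (t ^+ 2 * `|xi| ^+ 2) <= W i (x0 + t *: xi).
    have [_ _ /(_ x0 (t *: xi))] := expand i.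
    rewrite -/(W i (x0 + t *: xi)) -/(W i x0) dotpC dotpZr (dotpC _ xi).
    by rewrite normrZ exprMn (gtr0_norm t_gt0) ler_norml; lra.
  move: up; rewrite sumE => /(le_trans lo).
  rewrite /k /tuple_at /w -/x0 => final.
  by rewrite -(ler_pM2l t_gt0); move: final; rewrite expr2; lra.
Qed.

End SmoothSubsolution.

(** * Weak duality *)

Definition box {R : realType} (k : nat) (a : R) : set 'rV[R]_k :=
  [set y | forall j, `|y 0 j| <= a].
Arguments box {R} k a.

Lemma row_combination {R : realType} k (a b : R) (p q : 'rV[R]_k) j :
  (a *: p + b *: q) 0 j = a * p 0 j + b * q 0 j.
Proof. by rewrite !mxE. Qed.

Section WeakDuality.
Context {R : realType} {n m : nat}.
Variables (H : 'I_m -> torus R n -> 'rV[R]_n -> 'rV[R]_m -> R) (lambda : R).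
Variable v : 'I_m -> torus R n -> R.
Hypotheses (H_continuous : hamiltonian_continuous H)
  (H_coercive : hamiltonian_coercive H) (H_convex : hamiltonian_convex H)
  (H_monotone : hamiltonian_monotone H) (lambda_gt0 : 0 < lambda)
  (v_sol : viscosity_solution H lambda v).

Lemma box_compact k (a : R) : compact (box k a).
Proof.
have -> : box k a = [set y | forall j, y ord0 j \in `[- a, a]].
  by apply/seteqP; split=> y ya j; have := ya j; rewrite /= in_itv/= ler_norml.
exact: (@rV_compact R k (fun=> `[- a, a]%classic) (fun=> @segment_compact R (- a) a)).
Qed.

Lemma hamiltonian_bounded (a : R) : exists2 B, 0 <= B &
  forall i x p u, box n a p -> box m a u -> `|H i x p u| <= B.
Proof.
have Bi i : exists B, 0 <= B /\
    forall x p u, box n a p -> box m a u -> `|H i x p u| <= B.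
  have [[p0 [u0 [pa ua]]]|no] :=
    pselect (exists p u, box n a p /\ box m a u); last first.
    by exists 0; split=> // x p u pa ua; case: no; exists p, u.
  have [|||[[x p] u] _ hmax] := @compact_EVT_max _ R
    (fun w : torus R n * 'rV[R]_n * 'rV[R]_m => `|H i w.1.1 w.1.2 w.2|)
    ([set: torus R n] `*` box n a `*` box m a).
  - by exists (point, p0, u0).
  - exact: compact_setX (compact_setX torus_compact (@box_compact n a)) (@box_compact m a).
  - apply: continuous_subspaceT.
    apply: (@fun_comp_continuous _ _ _
      (fun w : torus R n * 'rV[R]_n * 'rV[R]_m => H i w.1.1 w.1.2 w.2) Num.norm).
      exact: H_continuous.
    exact: norm_continuous.
  exists `|H i x p u|; split=> // x' p' u' pa' ua'.
  by apply: (hmax (x', p', u')); rewrite inE.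
have [B BP] := choice Bi; exists (\sum_i B i).
  by apply: sumr_ge0 => i _; have [] := BP i.
move=> i x p u pa ua; have [_ /(_ x p u pa ua)] := BP i => /le_trans; apply.
by rewrite (bigD1 i)//= lerDl; apply: sumr_ge0 => j _; have [] := BP j.
Qed.

Lemma dotp_shift_le k (xi : 'rV[R]_k) (B : R) :
  (forall j (t : R), `|t| <= 1 -> dotp xi (t *: delta_mx 0 j) <= B) -> box k B xi.
Proof.
move=> xiB j; have := xiB j 1; have := xiB j (- 1).
rewrite !dotpZr dotp_delta normrN normr1 lexx ler_norml => /(_ isT) ? /(_ isT) ?.
lra.
Qed.

(** Testing the subgradient inequality at shifts by plus or minus one along a coordinate bounds that
    coordinate by a difference of two values of H, both taken in the boxes widened by 1. *)
Lemma bounded_subgradient (a : R) : exists2 B, 0 <= B &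
  forall i x p u, box n a p -> box m a u -> exists xi eta,
    [/\ box n B xi, box m B eta &
        lagrangian H i x xi eta = (dotp xi p + dotp eta u - H i x p u)%:E].
Proof.
have [B B0 HB] := hamiltonian_bounded (a + 1).
exists (2 * B) => [|i x p u pa ua]; first by rewrite mulr_ge0.
have [xi [eta [sub LE]]] := hamiltonian_subgradient H_convex i x p u.
have widen k (y : 'rV[R]_k) : box k a y -> box k (a + 1) y.
  by move=> ya j; apply: (le_trans (ya j)); rewrite lerDl.
have shift k (y : 'rV[R]_k) j (t : R) : `|t| <= 1 -> box k a y ->
    box k (a + 1) (y + t *: delta_mx 0 j).
  move=> t1 ya l; rewrite !mxE (le_trans (ler_normD _ _))// lerD// normrM.
  by rewrite (le_trans _ t1)// ler_piMr//; case: (_ && _); rewrite ?normr1 ?normr0.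
have Hpu := HB i x p u (widen _ _ pa) (widen _ _ ua).
exists xi, eta; split=> //; apply: dotp_shift_le => j t t1.
  have := sub (t *: delta_mx 0 j) 0; rewrite dotp0r !addr0.
  have := HB i x _ u (shift _ p j t t1 pa) (widen _ _ ua).
  by move: Hpu; rewrite !ler_norml; lra.
have := sub 0 (t *: delta_mx 0 j); rewrite dotp0r add0r addr0.
have := HB i x p _ (widen _ _ pa) (shift _ u j t t1 ua).
by move: Hpu; rewrite !ler_norml; lra.
Qed.

Lemma lagrangian_fin_ge i x xi eta ell p u : lagrangian H i x xi eta = ell%:E ->
  dotp xi p + dotp eta u - H i x p u <= ell.
Proof. by move=> LE; rewrite -lee_fin -LE; exact: lagrangian_ge. Qed.

(** By monotonicity H at (0, - s 1) is at most H at (0, 0) for s > 0, so a negative sum of eta would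
    make the Lagrangian infinite. Hence lambda + sum eta >= lambda where the Lagrangian is finite,
    and constant families can dominate any bounded function there. *)
Lemma lagrangian_fin_sum_ge0 i x xi eta ell : lagrangian H i x xi eta = ell%:E ->
  0 <= \sum_(j < m) eta 0 j.
Proof.
move=> LE; rewrite -oppr_le0; set S := \sum_(_ < _) _.
apply: (@le0_of_linear_bound _ _ (ell + H i x 0 0) 1) => // t /andP[t0 _].
have := lagrangian_fin_ge 0 (const_mx (- t^-1)) LE.
have : H i x 0 (const_mx (- t^-1)) <= H i x 0 0.
  by apply: H_monotone => [j|]; rewrite !mxE opprK add0r// invr_ge0 ltW.
rewrite dotp0r add0r dotp_const -/S => h1 h2.
have : S * - t^-1 <= ell + H i x 0 0 by lra.
by rewrite mulrN -mulNr ler_pdivrMr.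
Qed.

Lemma C1_family_bounded (w : 'I_m -> torus R n -> R) : (forall i, C1_torus (w i)) ->
  exists2 B, 0 <= B & forall i x, `|w i x| <= B /\ box n B (torus_gradient (w i) x).
Proof.
move=> wC1.
have Bw i : exists B, 0 <= B /\ forall x, `|w i x| <= B.
  by have [B ? ?] := torus_bounded (C1_torus_continuous (wC1 i)); exists B.
have Bg (ij : 'I_m * 'I_n) : exists B, 0 <= B /\
    forall x, `|torus_gradient (w ij.1) x 0 ij.2| <= B.
  have gc : continuous (fun x => torus_gradient (w ij.1) x 0 ij.2).
    apply: (@fun_comp_continuous _ _ _ (torus_gradient (w ij.1))
      (fun y : 'rV[R]_n => y 0 ij.2)); first exact: torus_gradient_continuous.
    exact: coord_continuous.
  by have [B ? ?] := torus_bounded gc; exists B.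
have [b bP] := choice Bw; have [g gP] := choice Bg.
have Sb0 : 0 <= \sum_i b i by apply: sumr_ge0 => i _; have [] := bP i.
have Sg0 : 0 <= \sum_ij g ij by apply: sumr_ge0 => ij _; have [] := gP ij.
exists (\sum_i b i + \sum_ij g ij) => [|i x]; first exact: addr_ge0.
split=> [|j].
  have [_ /(_ x) h] := bP i; apply: (le_trans h); rewrite (bigD1 i)//= -addrA lerDl.
  by rewrite addr_ge0//; apply: sumr_ge0 => l _; have [] := bP l.
have [_ /(_ x) h] := gP (i, j); apply: (le_trans h).
rewrite addrC (bigD1 (i, j))//= -addrA lerDl.
by rewrite addr_ge0//; apply: sumr_ge0 => l _; have [] := gP l.
Qed.

Lemma family_combination (a b : R) (w1 w2 : 'I_m -> torus R n -> R)
    (w := fun i x => a * w1 i x + b * w2 i x) :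
  (forall i, C1_torus (w1 i)) -> (forall i, C1_torus (w2 i)) ->
  (forall i, C1_torus (w i)) /\ forall i x,
    [/\ torus_gradient (w i) x =
          a *: torus_gradient (w1 i) x + b *: torus_gradient (w2 i) x,
        tuple_at w x = a *: tuple_at w1 x + b *: tuple_at w2 x &
        forall xi eta, adjoint lambda w i x xi eta =
          a * adjoint lambda w1 i x xi eta + b * adjoint lambda w2 i x xi eta].
Proof.
move=> C1 C2.
have zC i : C1_torus (fun x => b * w2 i x + 0) /\
    forall x, torus_gradient (fun x => b * w2 i x + 0) x = b *: torus_gradient (w2 i) x.
  have [cC cG] := @C1_torus_cst R n 0.
  have [h1 h2] := C1_torus_scaleD b (C2 i) cC.
  by split=> // x; have := h2 x; rewrite cG addr0.
have zE i : (fun x => b * w2 i x + 0) = (fun x => b * w2 i x).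
  by apply/funext => x; rewrite addr0.
have {}zC i : C1_torus (fun x => b * w2 i x) /\
    forall x, torus_gradient (fun x => b * w2 i x) x = b *: torus_gradient (w2 i) x.
  by have := zC i; rewrite zE.
have wC i := C1_torus_scaleD a (C1 i) (zC i).1.
split=> [i|i x]; first exact: (wC i).1.
have gE : torus_gradient (w i) x =
    a *: torus_gradient (w1 i) x + b *: torus_gradient (w2 i) x.
  by rewrite (wC i).2 (zC i).2.
have tE : tuple_at w x = a *: tuple_at w1 x + b *: tuple_at w2 x.
  by apply/rowP => j; rewrite !mxE.
split=> // xi eta.
by rewrite /adjoint gE tE !dotpDr !dotpZr /w; ring.
Qed.

(* The C^1 subsolution is itself the test function for the supersolution v. *)
Lemma comparison (w : 'I_m -> torus R n -> R) (e : R) : 0 <= e ->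
  (forall i, C1_torus (w i)) ->
  (forall i x, lambda * w i x + H i x (torus_gradient (w i) x) (tuple_at w x) <= e) ->
  forall i x, w i x - v i x <= e / lambda.
Proof.
move=> e0 wC1 wsub k z.
have [|i [x imax]] := @torus_max R n 'I_m k (fun i x => w i x + - v i x).
  move=> i; apply: fun_add_continuous; first exact: C1_torus_continuous.
  by apply: fun_opp_continuous; exact: v_sol.1.1.
apply: (le_trans (imax k z)); rewrite ler_pdivlMr//.
have [neg|pos] := leP (w i x + - v i x) 0.
  by apply: le_trans e0; rewrite pmulr_lle0.
have sup := v_sol.2.2 i (w i) x (wC1 i).
have {sup} : 0 <= lambda * v i x + H i x (torus_gradient (w i) x) (tuple_at v x).
  by apply: sup => y; have := imax i y; lra.
have : H i x (torus_gradient (w i) x) (tuple_at v x) <=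
    H i x (torus_gradient (w i) x) (tuple_at w x).
  by apply: H_monotone => [j|]; rewrite !mxE; [exact: imax|exact: ltW].
have := wsub i x; lra.
Qed.

(* Mixing w with a small weight into a smooth subsolution keeps the gradient in
   a fixed box, so that only (xi, eta) in the box of size B, which does not
   depend on w, are ever tested. *)
Lemma weak_duality : exists2 B, 0 <= B &
  forall (w : 'I_m -> torus R n -> R) (s : R), 0 <= s ->
    (forall i, C1_torus (w i)) ->
    (forall i x xi eta ell, box n B xi -> box m B eta ->
       lagrangian H i x xi eta = ell%:E -> adjoint lambda w i x xi eta <= s * ell) ->
    forall i x, w i x <= s * v i x.
Proof.
have [C C0 smooth] := smooth_subsolution H_continuous H_coercive lambda_gt0 v_sol.1.
have [M M0 vM] := solution_bounded v_sol.1.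
(* Room for W, with gradients bounded by C and values by M + e <= M + 1, plus 1 for the contribution
   b w. *)
have [B B0 subg] := bounded_subgradient (C + M + 2).
exists B => // w s s0 wC1 wsub k z.
have [Bw Bw0 wB] := C1_family_bounded wC1.
pose t : R := (2 * (Bw + 1))^-1.
have Bw1 : 0 < 2 * (Bw + 1) by lra.
have t0 : 0 < t by rewrite invr_gt0.
have tB : t * (2 * (Bw + 1)) = 1 by rewrite mulVf// gt_eqF.
have t2 : t <= 2^-1 by nra.
pose q : R := 1 - t + t * s.
have ts0 : 0 <= t * s by rewrite mulr_ge0// ltW.
have q0 : 0 < q by rewrite /q; lra.
(* The normalization a + b s = 1 makes a L + b (s L) equal to L, and the choice of t bounds b w and
   the coordinates of its gradient by 1. *)
pose a : R := (1 - t) / q; pose b : R := t / q.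
have b0 : 0 < b by rewrite divr_gt0.
have a0 : 0 <= a by rewrite divr_ge0; lra.
have ab : a + b * s = 1.
  by rewrite /a /b mulrAC -mulrDl divff// gt_eqF.
have bs0 : 0 <= b * s by rewrite mulr_ge0// ltW.
have a1 : a <= 1 by lra.
have bBw : b * Bw <= 1.
  by rewrite /b mulrAC ler_pdivrMr// /q mul1r; nra.
clearbody a b.
suff : b * (w k z - s * v k z) <= 0 by rewrite pmulr_rle0// subr_le0.
apply: (@le0_of_linear_bound _ _ (1 + lambda^-1) 1) => // e /andP[e0 e1].
have [W [WC1 Wv WC Wsub]] := smooth e e0.
pose h i x := a * W i x + b * w i x.
have [hC1 hE] := family_combination a b WC1 wC1.
have lin1 (y1 y2 D1 D2 : R) : `|y1| <= D1 -> `|y2| <= Bw -> D1 + 1 <= D2 ->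
    `|a * y1 + b * y2| <= D2.
  move=> h1 h2 hD; rewrite (le_trans (ler_normD _ _))// !normrM.
  rewrite (ger0_norm a0) (gtr0_norm b0).
  have : a * `|y1| <= `|y1| by rewrite ler_piMl.
  have : b * `|y2| <= b * Bw by rewrite ler_wpM2l// ltW.
  lra.
(* At a subgradient in the box, the Fenchel equality turns lambda h_i + H (x, Dh_i, h) into A h - L,
   which the bounds on A W and A w keep below a e <= e. *)
have hsub i x : lambda * h i x + H i x (torus_gradient (h i) x) (tuple_at h x) <= e.
  have [gE tE adjE] := hE i x.
  have [||xi [eta [xiB etaB LE]]] := subg i x (torus_gradient (h i) x) (tuple_at h x).
  - move=> j; rewrite gE row_combination; apply: (lin1 _ _ C); [exact: WC|exact: (wB i x).2|lra].
  - move=> j; rewrite tE row_combination !mxE; apply: (lin1 _ _ (M + 1)); [|exact: (wB j x).1|lra].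
    have := Wv j x; have := vM j x; rewrite !ler_norml; lra.
  have := adjE xi eta; rewrite {1}/adjoint => adjE'.
  set ell := _ - _ in LE.
  have hW := Wsub i x xi eta ell (fun p u => lagrangian_fin_ge p u LE).
  have hw := wsub i x xi eta ell xiB etaB LE.
  have : a * adjoint lambda W i x xi eta <= a * (ell + e) by rewrite ler_wpM2l.
  have : b * adjoint lambda w i x xi eta <= b * (s * ell) by rewrite ler_wpM2l// ltW.
  have : a * e <= e by rewrite ler_piMl// ltW.
  have : a * ell + b * (s * ell) = ell by rewrite mulrA -mulrDl ab mul1r.
  by move: adjE'; rewrite /ell -/(h i x); lra.
(* Since a = 1 - b s, comparing h with v leaves b (w - s v) <= e + e / lambda, where b does not
   depend on e. *)
have := comparison (ltW e0) hC1 hsub k z.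
rewrite /h mulrC [_ * v k z]mulrC => comp.
have := Wv k z; rewrite ler_norml => /andP[Wv1 _].
have : a * (v k z - e) <= a * W k z by rewrite ler_wpM2l//; lra.
have : a * e <= e by rewrite ler_piMl// ltW.
have aE : a = 1 - b * s by lra.
move: comp; rewrite aE; lra.
Qed.

End WeakDuality.

(** * Riesz representation through the Cantor space *)

(* A finitely additive content on clopen sets is automatically sigma-additive,
   a countable clopen partition of a clopen set being finite by compactness. *)
Definition clopen_algebra : Type := cantor_space.

HB.instance Definition _ := Pointed.on clopen_algebra.

Lemma cantor_clopenC : setC_closed (@clopen cantor_space).
Proof. by move=> A; exact: clopenC. Qed.

HB.instance Definition _ := @isAlgebraOfSets.Build default_measure_display
  clopen_algebra (@clopen cantor_space) (@clopen0 _) (@clopenU _) cantor_clopenC.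

Definition borel_cantor : Type :=
  g_sigma_algebraType (@measurable _ clopen_algebra).

HB.instance Definition _ := Measurable.on borel_cantor.

Section Cylinders.

Definition cylinder (b : seq bool) : set cantor_space :=
  [set s | forall k, (k < size b)%N -> s k = nth false b k].

Lemma bit_continuous k : continuous (fun s : cantor_space => s k).
Proof. exact: (@proj_continuous nat (fun=> bool) k). Qed.

Lemma bit_clopen k c : clopen [set s : cantor_space | s k = c].
Proof.
have -> : [set s : cantor_space | s k = c] = (fun s => s k) @^-1` [set c] by [].
split.
  by move/continuousP: (@bit_continuous k); apply; exact: discrete_open.
by move/continuous_closedP: (@bit_continuous k); apply; exact: discrete_closed.
Qed.

Lemma cylinder_clopen b : clopen (cylinder b).
Proof.
elim/last_ind: b => [|b c IH].
  by have -> : cylinder [::] = setT; [apply/seteqP|exact: clopenT].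
have -> : cylinder (rcons b c) = cylinder b `&` [set s | s (size b) = c].
  apply/seteqP; split=> [s bs|s [bs sc] k]; last first.
    rewrite size_rcons ltnS leq_eqVlt nth_rcons => /predU1P[->|kb].
      by rewrite ltnn eqxx.
    by rewrite kb; exact: bs.
  split=> [k kb|].
    by have := bs k; rewrite size_rcons ltnS nth_rcons kb; apply; exact: ltnW.
  by have := bs (size b); rewrite size_rcons ltnS leqnn nth_rcons ltnn eqxx; exact.
by apply: clopenI => //; exact: bit_clopen.
Qed.

(** The cylinders around s generate a filter that converges to s coordinatewise, that is, in the
    product topology. *)
Lemma cylinder_nbhs (s : cantor_space) (U : set cantor_space) :
  nbhs s U -> exists N, cylinder (mkseq s N) `<=` U.
Proof.
pose F : set_system (nat -> bool) :=
  filter_from [set: nat] (fun N => cylinder (mkseq s N)).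
have FF : Filter F.
  apply: filter_from_filter; first by exists 0%N.
  move=> i j _ _; exists (maxn i j) => // t tij; split=> k; rewrite size_mkseq => kl.
    by have := tij k; rewrite size_mkseq leq_max kl !nth_mkseq ?leq_max ?kl//; exact.
  have := tij k; rewrite size_mkseq leq_max kl orbT.
  by rewrite !nth_mkseq ?leq_max ?kl ?orbT//; exact.
have : {ptws, F --> (s : nat -> bool)}.
  apply/pointwise_cvgP => k; apply/discrete_cvg; exists k.+1 => // t tk /=.
  by have := tk k; rewrite size_mkseq nth_mkseq//; exact.
by move=> /(_ U) + sU => /(_ sU)[N _ NU]; exists N.
Qed.

Lemma cylinder_self (s : cantor_space) N : cylinder (mkseq s N) s.
Proof. by move=> k; rewrite size_mkseq => kN; rewrite nth_mkseq. Qed.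

End Cylinders.

Section CantorCovers.
Context {R : realType}.

Lemma cantor_finite_subcover (V : cantor_space -> set cantor_space) :
  (forall s, clopen (V s) /\ V s s) -> exists N (s : nat -> cantor_space),
    [set: cantor_space] `<=` \big[setU/set0]_(i < N) V (s i).
Proof.
move=> VP; have := cantor_space_compact; rewrite compact_cover.
move=> /(_ _ [set: cantor_space] V)[|s _|D _ DV].
- by move=> s _; have [[]] := VP s.
- by exists s => //; have [] := VP s.
exists (size (enum_fset D)), (nth point (enum_fset D)) => x /DV[s /= sD Vx].
rewrite -(bigcup_mkord _ (fun i => V (nth point (enum_fset D) i))).
exists (index s (enum_fset D)); first by rewrite /= index_mem.
by rewrite nth_index.
Qed.

(** Compactness gives finitely many clopen sets, on each of which F stays within e of one value;
    removing from each the earlier ones makes them disjoint and keeps them clopen. *)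
Lemma clopen_step_approximation (F : cantor_space -> R) (e : R) :
  continuous F -> 0 < e ->
  exists N (a : nat -> R) (U : nat -> set cantor_space), (forall i, clopen (U i)) /\
    forall s, `|F s - \sum_(i < N) a i * \1_(U i) s| <= e.
Proof.
move=> Fc e0.
have VP s : exists V, (clopen V /\ V s) /\ forall s', V s' -> `|F s - F s'| <= e.
  have /cvgrPdist_le/(_ e e0)/cylinder_nbhs[N NF] := Fc s.
  exists (cylinder (mkseq s N)); split; last by move=> s' /NF.
  by split; [exact: cylinder_clopen|exact: cylinder_self].
have [V {}VP] := choice VP.
have [N [s cover]] := cantor_finite_subcover (fun s => (VP s).1).
pose W i := V (s i); have Wc i : clopen (W i) by exact: (VP (s i)).1.1.
exists N, (fun i => F (s i)), (seqDU W); split=> [i|x].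
  rewrite /seqDU setDE; apply: clopenI => //; apply: cantor_clopenC.
  by elim/big_ind : _ => // [|A B]; [exact: clopen0|exact: clopenU].
have : (\big[setU/set0]_(i < N) seqDU W i) x by rewrite -bigsetU_seqDU; exact: cover.
rewrite -(bigcup_mkord _ (seqDU W)) => -[i /= iN Wx].
rewrite (bigD1 (Ordinal iN))//= indicE mem_set// mulr1 big1 ?addr0.
  by rewrite distrC; apply: (VP (s i)).2; exact: (subset_seqDU Wx).
move=> j ji; rewrite indicE memNset ?mulr0// => Wjx.
move/eqP: ji; apply; apply/val_inj => /=.
by apply: (@trivIset_seqDU _ W j i) => //; exists x.
Qed.

Lemma cantor_bounded (F : cantor_space -> R) :
  continuous F -> exists M, forall s, `|F s| <= M.
Proof.
move=> Fc; have [|||s _ smax] := @compact_EVT_max _ R (fun s => `|F s|) setT.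
- by exists point.
- exact: cantor_space_compact.
- apply: continuous_subspaceT.
  by apply: (@fun_comp_continuous _ _ _ F Num.norm Fc); exact: norm_continuous.
- by exists `|F s| => s'; apply: smax; rewrite inE.
Qed.

(** The sigma-algebra is generated by the clopen sets; open sets belong to it because the cylinders
    are countably many, indexed by finite words. *)
Lemma borel_cantor_open (U : set cantor_space) :
  open U -> measurable (U : set borel_cantor).
Proof.
move=> Uo.
have -> : U = \bigcup_(b in [set b | cylinder b `<=` U]) cylinder b.
  apply/seteqP; split=> [s Us|s [b bU /bU]]//.
  have [N NU] := cylinder_nbhs (open_nbhs_nbhs (conj Uo Us)).
  by exists (mkseq s N) => //; exact: cylinder_self.
rewrite bigcup_set_type; apply: countable_bigcupT_measurable => [|b].
  by rewrite (eq_countable (card_setT _)); exact: countableP.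
by apply: sub_sigma_algebra; exact: cylinder_clopen.
Qed.

End CantorCovers.

(** * Positive linear functionals on bounded functions *)

Section BoundedFunctionals.
Context {R : realType} {T : Type}.
Implicit Types F G : T -> R.

Definition bounded_on_type F := exists M, forall s, `|F s| <= M.

Lemma bounded_scaleD (a : R) F G : bounded_on_type F -> bounded_on_type G ->
  bounded_on_type (fun s => a * F s + G s).
Proof.
move=> [M FM] [N GN]; exists (`|a| * M + N) => s.
by rewrite (le_trans (ler_normD _ _))// normrM lerD// ler_wpM2l.
Qed.

Lemma bounded_on_type_cst (a : R) : bounded_on_type (fun _ => a).
Proof. by exists `|a|. Qed.

Lemma bounded_indic (U : set T) : bounded_on_type (\1_U : T -> R).
Proof.
by exists 1 => s; rewrite indicE; case: (_ \in _); rewrite ?normr1 ?normr0.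
Qed.

Variable Lam : (T -> R) -> R.
Hypothesis Lam_lin : forall a F G, bounded_on_type F -> bounded_on_type G ->
  Lam (fun s => a * F s + G s) = a * Lam F + Lam G.
Hypothesis Lam_le0 : forall F, bounded_on_type F -> (forall s, F s <= 0) -> Lam F <= 0.

Lemma functional0 : Lam (fun _ => 0) = 0.
Proof.
have := Lam_lin 1 (bounded_on_type_cst 0) (bounded_on_type_cst 0).
rewrite (_ : (fun s : T => 1 * 0 + 0) = (fun _ => 0)); first lra.
by apply/funext => s; rewrite mulr0 addr0.
Qed.

Lemma functional_le F G : bounded_on_type F -> bounded_on_type G ->
  (forall s, F s <= G s) -> Lam F <= Lam G.
Proof.
move=> Fb Gb FG; rewrite -subr_le0.
have -> : Lam F - Lam G = Lam (fun s => (-1) * G s + F s) by rewrite Lam_lin//; ring.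
by apply: Lam_le0 => [|s]; [exact: bounded_scaleD|have := FG s; lra].
Qed.

Lemma functional_cst a : Lam (fun _ => a) = a * Lam (fun _ => 1).
Proof.
transitivity (Lam (fun _ => a * 1 + 0)).
  by congr Lam; apply/funext => s; rewrite mulr1 addr0.
by rewrite (Lam_lin a (bounded_on_type_cst 1) (bounded_on_type_cst 0)) functional0 addr0.
Qed.

Lemma functional_sum (a : nat -> R) (U : nat -> set T) N :
  Lam (fun s => \sum_(i < N) a i * \1_(U i) s) = \sum_(i < N) a i * Lam \1_(U i) /\
  bounded_on_type (fun s => \sum_(i < N) a i * \1_(U i) s).
Proof.
elim: N => [|N [IH IHb]].
  have -> : (fun s => \sum_(i < 0) a i * \1_(U i) s) = (fun _ : T => 0 : R).
    by apply/funext => s; rewrite big_ord0.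
  by rewrite big_ord0 functional0; split=> //; exact: bounded_on_type_cst.
have -> : (fun s => \sum_(i < N.+1) a i * \1_(U i) s) =
    (fun s => a N * \1_(U N) s + \sum_(i < N) a i * \1_(U i) s).
  by apply/funext => s; rewrite big_ord_recr addrC.
split; last by apply: bounded_scaleD => //; exact: bounded_indic.
by rewrite Lam_lin//; [rewrite IH big_ord_recr addrC|exact: bounded_indic].
Qed.

Lemma functional_close F G e : bounded_on_type F -> bounded_on_type G ->
  (forall s, `|F s - G s| <= e) -> `|Lam F - Lam G| <= e * Lam (fun _ => 1).
Proof.
move=> Fb Gb FG; rewrite -functional_cst ler_norml.
have -> : Lam F - Lam G = Lam (fun s => (-1) * G s + F s) by rewrite Lam_lin//; ring.
have Db : bounded_on_type (fun s => (-1) * G s + F s) by exact: bounded_scaleD.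
apply/andP; split; last first.
  apply: functional_le => // [|s]; first exact: bounded_on_type_cst.
  by have := FG s; rewrite ler_norml; lra.
rewrite functional_cst -mulNr -functional_cst.
apply: functional_le => // [|s]; first exact: bounded_on_type_cst.
by have := FG s; rewrite ler_norml; lra.
Qed.

End BoundedFunctionals.

Lemma measurable_fun_open {R : realType} d (T : measurableType d) (f : T -> R) :
  (forall U : set R, open U -> measurable (f @^-1` U)) -> measurable_fun setT f.
Proof.
move=> fo; apply: (measurability _ (measurable_realfun.RGenOpens.measurableE R)).
move=> _ [_ [a [b ->] <-]]; rewrite setTI; apply: fo; exact: interval_open.
Qed.

Section FiniteMeasureOf.
Context {R : realType} d (T : measurableType d) (mu : {measure set T -> \bar R}).
Hypothesis muT : (mu setT < +oo)%E.

Let copy (A : set T) : \bar R := mu A.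

HB.instance Definition _ := isMeasure.Build d T R copy
  (measure0 mu) (measure_ge0 mu) (@measure_semi_sigma_additive _ _ _ mu).

Let copy_fin : fin_num_fun copy.
Proof.
move=> A mA; rewrite ge0_fin_numE//; apply: le_lt_trans muT.
by apply: le_measure; rewrite ?inE.
Qed.

HB.instance Definition _ := Measure_isFinite.Build d T R copy copy_fin.

(** Extensions and push-forwards come as plain measures, whereas a [measure_family] consists of
    measures carrying the finiteness structure; [copy] is a fresh head on which to declare it. *)
Lemma finite_measure_of :
  exists nu : {finite_measure set T -> \bar R}, forall A, nu A = mu A.
Proof. by exists copy. Qed.

End FiniteMeasureOf.

Section CantorRiesz.
Context {R : realType}.
Variable Lam : (cantor_space -> R) -> R.
Hypothesis Lam_lin : forall a F G, bounded_on_type F -> bounded_on_type G ->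
  Lam (fun s => a * F s + G s) = a * Lam F + Lam G.
Hypothesis Lam_le0 : forall F, bounded_on_type F -> (forall s, F s <= 0) -> Lam F <= 0.

Let content (U : set clopen_algebra) : \bar R := (Lam \1_U)%:E.

Let content0 : content set0 = 0%E.
Proof.
by rewrite /content indic0 (functional0 Lam_lin).
Qed.

Let content_ge0 U : (0 <= content U)%E.
Proof.
rewrite lee_fin -(functional0 Lam_lin); apply: (functional_le Lam_lin Lam_le0) => //.
- exact: bounded_on_type_cst.
- exact: bounded_indic.
Qed.

Let content_sigma_additive : semi_sigma_additive content.
Proof.
move=> F mF tF mUF.
have [N FN] : exists N, \bigcup_n F n `<=` \big[setU/set0]_(i < N) F i.
  have Uc : compact (\bigcup_n F n : set cantor_space).
    apply: (subclosed_compact mUF.2 cantor_space_compact) => //.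
  move: Uc; rewrite compact_cover => /(_ _ [set: nat] F)[n _|//|D _ DF].
    exact: (mF n).1.
  exists (\max_(i <- enum_fset D) i).+1 => s /DF[i /= iD Fis].
  rewrite -(bigcup_mkord _ F); exists i => //=; rewrite ltnS.
  by rewrite (bigD1_seq i) ?fset_uniq//= leq_maxl.
have F0 i : (N <= i)%N -> F i = set0.
  move=> Ni; rewrite -subset0 => s Fis.
  have /FN : (\bigcup_n F n) s by exists i.
  rewrite -(bigcup_mkord _ F) => -[j /= jN Fjs].
  have ij := tF i j Logic.I Logic.I (ex_intro _ s (conj Fis Fjs)).
  by move: jN; rewrite -ij ltnNge Ni.
have UN : \bigcup_n F n = \big[setU/set0]_(i < N) F i.
  apply/seteqP; split=> // s; rewrite -(bigcup_mkord _ F) => -[i _ Fis].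
  by exists i.
have step n : (N <= n)%N -> (\sum_(0 <= i < n) content (F i))%E = content (\bigcup_n F n).
  move=> Nn; rewrite (@big_cat_nat _ _ _ N)//=.
  have -> : (\sum_(N <= i < n) content (F i))%E = 0%E.
    by rewrite big_nat_cond big1// => i /andP[/andP[Ni _] _]; rewrite F0.
  rewrite adde0.
  rewrite big_mkord /content sumEFin; congr EFin.
  have [h _] := functional_sum Lam_lin (fun=> 1) F N.
  have -> : \sum_(i < N) Lam \1_(F i) = \sum_(i < N) 1 * Lam \1_(F i).
    by apply: eq_bigr => i _; rewrite mul1r.
  rewrite -h; congr Lam; apply/funext => s; rewrite indicE UN.
  case: (boolP (s \in _)) => [|/negP sF].
    rewrite inE -(bigcup_mkord _ F) => -[i /= iN Fis].
    rewrite (bigD1 (Ordinal iN))//= indicE mem_set// mulr1 big1 ?addr0// => j ji.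
    rewrite indicE memNset ?mulr0// => Fjs; move/eqP: ji; apply; apply/val_inj => /=.
    by apply: (tF j i) => //; exists s.
  rewrite big1// => i _; rewrite indicE memNset ?mulr0// => Fis; apply: sF.
  by rewrite inE -(bigcup_mkord _ F); exists i => /=.
apply: cvg_near_cst; exists N => // n /= Nn; exact: step.
Qed.

HB.instance Definition _ := isMeasure.Build _ _ _ content
  content0 content_ge0 content_sigma_additive.

Let mu : {measure set borel_cantor -> \bar R} := measure_extension content.

Let muE U : clopen U -> mu U = (Lam \1_U)%:E.
Proof. by move=> Uc; rewrite /mu /= /measure_extension measurable_mu_extE. Qed.

(** The integral and [Lam] agree on clopen step functions, which approximate F uniformly; an error e
    costs each of them at most e [Lam (fun _ => 1)]. *)
Theorem cantor_riesz : exists mu : {finite_measure set borel_cantor -> \bar R},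
  forall F : cantor_space -> R, continuous F ->
    mu.-integrable setT (EFin \o F) /\ (\int[mu]_s (F s)%:E)%E = (Lam F)%:E.
Proof.
have [|nu nuE] := @finite_measure_of R _ borel_cantor mu.
  by rewrite (muE clopenT) ltry.
have nuU U : clopen U -> nu U = (Lam \1_U)%:E by rewrite nuE; exact: muE.
have nuT : nu setT = (Lam (fun _ => 1))%:E by rewrite (nuU _ clopenT) indicT.
exists nu => F Fc.
have Fb : bounded_on_type F by exact: cantor_bounded.
have mF : measurable_fun setT (F : borel_cantor -> R).
  apply: measurable_fun_open => U Uo; apply: borel_cantor_open.
  by move/continuousP: Fc; apply.
have intF : nu.-integrable setT (EFin \o F).
  apply: measurable_bounded_integrable => //.
    by rewrite [nu _]nuT ltry.
  have [M FM] := Fb; exists M; split=> [|x Mx s _]; first exact: num_real.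
  exact: le_trans (FM s) (ltW Mx).
split=> //.
have intfin : (\int[nu]_s (F s)%:E)%E \is a fin_num by exact: integrable_fin_num.
rewrite -(fineK intfin); congr EFin; apply/eqP; rewrite -subr_eq0 -normr_le0.
have Lam1_ge0 : 0 <= Lam (fun _ => 1).
  rewrite -(functional0 Lam_lin); apply: (functional_le Lam_lin Lam_le0) => //.
  - exact: bounded_on_type_cst.
  - exact: bounded_on_type_cst.
apply: (@le0_of_linear_bound _ _ (2 * Lam (fun _ => 1)) 1) => // e /andP[e0 _].
have [N [a [U [Uc Ue]]]] := clopen_step_approximation Fc e0.
pose G s := \sum_(i < N) a i * \1_(U i) s.
have [LG Gb] := functional_sum Lam_lin a U N.
have mU i : measurable (U i : set borel_cantor) by apply: sub_sigma_algebra; exact: Uc.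
have GE : (fun s : borel_cantor => (G s)%:E) =
    (fun s => \sum_(i < N) (a i)%:E * (\1_(U i) s)%:E)%E.
  by apply/funext => s; rewrite /G -sumEFin.
have intI i : nu.-integrable setT (fun s : borel_cantor => (\1_(U i) s)%:E).
  by apply: integrable_indic; exact: mU.
have intU (i : 'I_N) : nu.-integrable setT (fun s => (a i)%:E * (\1_(U i) s)%:E)%E.
  apply: integrableZl => //; exact: intI.
have intG : nu.-integrable setT (fun s : borel_cantor => (G s)%:E).
  rewrite GE; exact: (integrable_sum measurableT _ (fun i _ => intU i)).
have IG : (\int[nu]_s (G s)%:E)%E = (Lam G)%:E.
  rewrite GE (integral_sum measurableT intU).
  rewrite LG -sumEFin; apply: eq_bigr => i _.
  rewrite (integralZl measurableT (intI i)).
  by rewrite integral_indic// setIT nuU.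
have intFG : nu.-integrable setT (EFin \o (fun s => F s - G s)).
  rewrite (_ : EFin \o _ = (EFin \o F) \- (EFin \o G))%E//.
  exact: integrableB.
have FG : `|(\int[nu]_s F s)%R - (\int[nu]_s G s)%R| <= e * Lam (fun _ => 1).
  rewrite -RintegralB//; apply: (le_trans (le_normr_Rintegral _ _)) => //.
  have -> : e * Lam (fun _ => 1) = (\int[nu]_s e)%R.
    by rewrite Rintegral_cst// [nu _]nuT.
  apply: le_Rintegral => //.
  - exact: (integrable_abse intFG).
  - exact: (finite_measure_integrable_cst nu e measurableT).
have := functional_close Lam_lin Lam_le0 Gb Fb.
move=> /(_ e); have Ue' s : `|G s - F s| <= e by rewrite distrC; exact: Ue.
move=> /(_ Ue') LGF.
rewrite -[fine _]/(\int[nu]_s F s)%R.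
have IG' : (\int[nu]_s G s)%R = Lam G by rewrite /Rintegral IG.
rewrite -(subrKA (Lam G)) (le_trans (ler_normD _ _))//.
by move: FG; rewrite IG'; lra.
Qed.

End CantorRiesz.

(** * Parametrizing boxes of the phase space by the Cantor space *)

Section CubeSurjection.
Context {R : realType} (N : nat).

(** A type rather than a set, as [cantor_surj] is applied to a whole compact Hausdorff space. *)
Definition cube_type : Type := set_type (@unit_cube R N).

HB.instance Definition _ := PseudoMetric.on cube_type.

Let cube0 : cube_type.
Proof.
by exists 0; rewrite inE => j; rewrite mxE in_itv/= lexx ler01.
Qed.

HB.instance Definition _ := isPointed.Build cube_type cube0.

Lemma cube_val_continuous : continuous (set_val : cube_type -> 'rV[R]_N).
Proof. exact: initial_continuous. Qed.

Lemma cube_type_compact : compact [set: cube_type].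
Proof.
move=> F FF _.
have FK : ((set_val : cube_type -> 'rV[R]_N) @ F) (@unit_cube R N).
  rewrite /fmap /= (_ : _ @^-1` _ = [set: cube_type]); first exact: filterT.
  by apply/seteqP; split=> // -[x Kx] _; exact: set_mem Kx.
have [p [Kp clp]] :=
  @unit_cube_compact R N ((set_val : cube_type -> 'rV[R]_N) @ F) _ FK.
exists (SigSub (mem_set Kp)); split=> // A B FA.
case=> _ /= [[W Wo <-] /= Wp WB].
have FA' : ((set_val : cube_type -> 'rV[R]_N) @ F) (set_val @` A).
  by apply: (@filterS _ F _ A) => // x Ax; exists x.
have [|_ [[x Ax <-] Wx]] := clp _ W FA'; first by apply: open_nbhs_nbhs; split.
by exists x; split=> //; exact: WB.
Qed.

Lemma cube_type_hausdorff : hausdorff_space cube_type.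
Proof.
move=> p q pq; apply: val_inj.
apply: (@norm_hausdorff _ 'rV[R]_N) => A B pA qB.
have [x [Ax Bx]] := pq _ _ (cube_val_continuous pA) (cube_val_continuous qB).
by exists (set_val x).
Qed.

Lemma cantor_cube_surjection : exists c : cantor_space -> 'rV[R]_N,
  continuous c /\ forall y, unit_cube y -> exists s, c s = y.
Proof.
have [f fc] := cantor_surj cube_type_compact cube_type_hausdorff.
exists (fun s => set_val (f s)); split=> [|y Ky].
  exact: (fun_comp_continuous fc cube_val_continuous).
have [s _ sy] := @surj _ _ _ _ f (SigSub (mem_set Ky)) Logic.I.
by exists s; rewrite sy.
Qed.

End CubeSurjection.

Section PhaseSpace.
Context {R : realType} {n m : nat}.
Local Notation phase := (torus R n * 'rV[R]_n * 'rV[R]_m)%type.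

(** The torus is itself the image of a unit cube and the two boxes are affine images of cubes, so
    one cube of dimension n + (n + m) suffices. *)
Lemma phase_parametrization (a : R) : 0 < a -> exists c : cantor_space -> phase,
  continuous c /\
  forall x xi eta, box n a xi -> box m a eta -> exists s, c s = (x, xi, eta).
Proof.
move=> a0; have [c [cc csurj]] := @cantor_cube_surjection R (n + (n + m)).
have coord j : continuous (fun s => c s 0 j).
  apply: (@fun_comp_continuous _ _ _ c (fun y : 'rV[R]_(n + (n + m)) => y 0 j)) => //.
  exact: coord_continuous.
have scale j : continuous (fun s => 2 * a * c s 0 j + - a).
  apply: fun_add_continuous; last exact: fun_cst_continuous.
  by apply: fun_mul_continuous => //; exact: fun_cst_continuous.
exists (fun s => (to_torus (\row_j c s 0 (lshift (n + m) j)),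
  \row_j (2 * a * c s 0 (rshift n (lshift m j)) + - a),
  \row_j (2 * a * c s 0 (rshift n (rshift n j)) + - a))); split.
  apply: fun_pair_continuous; last by apply: row_continuous.
  apply: fun_pair_continuous; last by apply: row_continuous.
  apply: (fun_comp_continuous _ (@to_torus_continuous R n)).
  exact: row_continuous.
move=> x xi eta xia etaa; have [y1 y1cube <-] := unit_cube_rep x.
have a2 : 0 < 2 * a by lra.
pose r k (u : 'rV[R]_k) : 'rV[R]_k := \row_j ((u 0 j + a) / (2 * a)).
have rcube k (u : 'rV[R]_k) : box k a u -> unit_cube (r k u).
  move=> ua j; rewrite mxE in_itv/= ler_pdivlMr// ler_pdivrMr//.
  by have := ua j; rewrite ler_norml; lra.
have rK k (u : 'rV[R]_k) j : 2 * a * (r k u) 0 j + - a = u 0 j.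
  by rewrite mxE mulrC divfK ?gt_eqF// addrK.
have [|s sE] := csurj (row_mx y1 (row_mx (r n xi) (r m eta))).
  move=> j; case: (split_ordP j) => {}j ->; first by rewrite row_mxEl.
  rewrite row_mxEr; case: (split_ordP j) => {}j ->.
    by rewrite row_mxEl; exact: rcube.
  by rewrite row_mxEr; exact: rcube.
exists s; rewrite sE; congr (_, _, _).
- by congr to_torus; apply/rowP => j; rewrite mxE row_mxEl.
- by apply/rowP => j; rewrite mxE row_mxEr row_mxEl rK.
- by apply/rowP => j; rewrite mxE !row_mxEr rK.
Qed.

Lemma phase_open_measurable (U : set phase) :
  open U -> measurable (U : set (phase_space R n m)).
Proof. by move=> Uo; exact: sub_sigma_algebra. Qed.

Lemma phase_continuous_measurable (G : phase -> R) :
  continuous G -> measurable_fun setT (G : phase_space R n m -> R).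
Proof.
move=> Gc; apply: measurable_fun_open => U Uo; apply: phase_open_measurable.
by move/continuousP: Gc; apply.
Qed.

Lemma phase_riesz (c : cantor_space -> phase) (Lam : (cantor_space -> R) -> R) :
  continuous c ->
  (forall a F G, bounded_on_type F -> bounded_on_type G ->
     Lam (fun s => a * F s + G s) = a * Lam F + Lam G) ->
  (forall F, bounded_on_type F -> (forall s, F s <= 0) -> Lam F <= 0) ->
  exists mu : {finite_measure set (phase_space R n m) -> \bar R},
    forall G : phase -> R, continuous G ->
      mu.-integrable setT (fun w : phase_space R n m => (G w)%:E) /\
      (\int[mu]_w (G w)%:E)%E = (Lam (fun s => G (c s)))%:E.
Proof.
move=> cc Lam_lin Lam_le0; have [mu muE] := cantor_riesz Lam_lin Lam_le0.
have mc : measurable_fun setT (c : borel_cantor -> phase_space R n m).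
  apply: (@measurability _ _ borel_cantor (phase_space R n m) setT c (@open phase)).
    by [].
  move=> _ [U Uo <-].
  rewrite setTI; apply: borel_cantor_open.
  by move/continuousP: cc; apply.
pose nu0 : {measure set (phase_space R n m) -> \bar R} :=
  pushforward mu (c : borel_cantor -> phase_space R n m).
pose nu := nu0 mc.
have [|nu' nu'E] := @finite_measure_of R _ _ nu.
  rewrite /nu /= /pushforward preimage_setT.
  by rewrite -ge0_fin_numE//; exact: fin_num_measure.
exists nu' => G Gc.
have Gcc : continuous (fun s => G (c s)) by exact: (fun_comp_continuous cc Gc).
have [intG IG] := muE _ Gcc.
pose Ge : phase_space R n m -> \bar R := fun w => (G w)%:E.
have mG : measurable_fun setT Ge.
  by apply/measurable_EFinP; exact: phase_continuous_measurable.
have intnu : nu.-integrable setT Ge.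
  by apply: (integrable_pushforward mc) => //; rewrite preimage_setT.
split.
  case/integrableP : intnu => _ fin; apply/integrableP; split=> //.
  rewrite (_ : integral nu' _ _ = integral nu setT
    (fun w => `|Ge w|)%E)//.
  by apply: eq_measure_integral => A _ _; exact: nu'E.
rewrite (_ : integral nu' _ _ = integral nu setT
  Ge); last first.
  by apply: eq_measure_integral => A _ _; exact: nu'E.
rewrite (integral_pushforward mc mG) ?preimage_setT//.
Qed.

End PhaseSpace.

(** * The Lagrangian as a limit of continuous functions *)

Lemma rational_approximation {R : realType} k (y : 'rV[R]_k) (e : R) : 0 < e ->
  exists q : 'rV[rat]_k, `|y - map_mx ratr q| < e.
Proof.
move=> e0; pose P j q := y 0 j - e / 2 < ratr q < y 0 j + e / 2.
have Pex j : exists q : rat, P j q.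
  have [|q qE] := @rat_in_itvoo R (y 0 j - e / 2) (y 0 j + e / 2); first lra.
  by exists q; move: qE; rewrite in_itv.
have [q qP] := choice Pex; exists (\row_j q j).
apply: (@le_lt_trans _ _ (e / 2)); last by lra.
apply: row_norm_le => [|j]; first lra.
by rewrite !mxE ler_norml; have := qP j; rewrite /P; lra.
Qed.

(** Stated for signed integrals of functions that may be infinite, as the Lagrangian is: positive
    and negative parts are compared separately. *)
Lemma ge_real_integral {d} {T : measurableType d} {R : realType}
    (mu : {measure set T -> \bar R}) (f g : T -> \bar R) :
  measurable_fun setT f -> measurable_fun setT g -> (forall x, f x <= g x)%E ->
  (\int[mu]_x f x <= \int[mu]_x g x)%E.
Proof.
move=> mf mg fg; rewrite integralE [leRHS]integralE; apply: leeB.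
  apply: ge0_le_integral => //; [exact: measurable_funepos..|].
  by move=> x _; rewrite !funeposE; exact: le_max2.
apply: ge0_le_integral => //; [exact: measurable_funeneg..|].
by move=> x _; rewrite !funenegE; apply: le_max2; rewrite ?leeN2.
Qed.

Section LagrangianApproximation.
Context {R : realType} {n m : nat}.
Variables (H : 'I_m -> torus R n -> 'rV[R]_n -> 'rV[R]_m -> R).
Hypothesis H_continuous : hamiltonian_continuous H.
Local Notation phase := (torus R n * 'rV[R]_n * 'rV[R]_m)%type.

Let xi_continuous : continuous (fun w : phase => w.1.2).
Proof. exact: (fun_comp_continuous (@fun_fst_continuous _ _) (@fun_snd_continuous _ _)). Qed.

Let x_continuous : continuous (fun w : phase => w.1.1).
Proof. exact: (fun_comp_continuous (@fun_fst_continuous _ _) (@fun_fst_continuous _ _)). Qed.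

Lemma adjoint_continuous (lambda : R) (w : 'I_m -> torus R n -> R) i :
  (forall i, C1_torus (w i)) ->
  continuous (fun p : phase => adjoint lambda w i p.1.1 p.1.2 p.2).
Proof.
move=> wC1; have wc j := C1_torus_continuous (wC1 j).
apply: fun_add_continuous; last first.
  apply: fun_mul_continuous; first exact: fun_cst_continuous.
  exact: (fun_comp_continuous x_continuous (wc i)).
apply: fun_add_continuous; apply: dotp_continuous => //.
- exact: (fun_comp_continuous x_continuous (torus_gradient_continuous (wC1 i))).
- exact: fun_snd_continuous.
- apply: row_continuous => j; exact: (fun_comp_continuous x_continuous (wc j)).
Qed.

Lemma enorm_moment_continuous :
  continuous (fun w : phase => enorm w.1.2 + enorm w.2).
Proof.
have ec k : continuous (@enorm R k).
  apply: fun_comp_continuous (@sqrt_continuous R).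
  by apply: dotp_continuous => y; exact: cvg_id.
apply: fun_add_continuous; first exact: (fun_comp_continuous xi_continuous (ec n)).
exact: (fun_comp_continuous (@fun_snd_continuous _ _) (ec m)).
Qed.

Definition legendre_value i (q : 'rV[R]_n * 'rV[R]_m) (w : phase) : R :=
  dotp w.1.2 q.1 + dotp w.2 q.2 - H i w.1.1 q.1 q.2.

Lemma legendre_value_continuous i q : continuous (legendre_value i q).
Proof.
have cst k (y : 'rV[R]_k) : continuous (fun _ : phase => y).
  by move=> w; apply: cvg_cst; exact: nbhs_filter.
apply: fun_add_continuous; first apply: fun_add_continuous.
- by apply: dotp_continuous => //; exact: cst.
- by apply: dotp_continuous; [exact: fun_snd_continuous|exact: cst].
apply: fun_opp_continuous.
apply: (@fun_comp_continuous _ _ _ (fun w : phase => (w.1.1, q.1, q.2))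
  (fun w : phase => H i w.1.1 w.1.2 w.2)); last exact: H_continuous.
apply: fun_pair_continuous; last exact: cst.
by apply: fun_pair_continuous => //; exact: cst.
Qed.

Let rational_point N : 'rV[R]_n * 'rV[R]_m :=
  if choice.unpickle N is Some q then
    (map_mx ratr (q : 'rV[rat]_n * 'rV[rat]_m).1, map_mx ratr q.2)
  else 0.

(** Finite maxima over an enumeration of the rational pairs (p, u), started at the pair 0. Codes
    that decode to no pair also give 0 and so change nothing. *)
Fixpoint lagrangian_approx i N (w : phase) : R :=
  if N is N'.+1 then
    Num.max (lagrangian_approx i N' w) (legendre_value i (rational_point N') w)
  else legendre_value i 0 w.

Lemma lagrangian_approx_continuous i N : continuous (lagrangian_approx i N).
Proof.
elim: N => [|N IH] /=; first exact: legendre_value_continuous.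
by move=> w; apply: continuous_max; [exact: IH|exact: legendre_value_continuous].
Qed.

Lemma lagrangian_approx_nd i w : nondecreasing_seq (fun N => lagrangian_approx i N w).
Proof. by apply/nondecreasing_seqP => N /=; rewrite le_max lexx. Qed.

Lemma lagrangian_approx_le i N w :
  ((lagrangian_approx i N w)%:E <= lagrangian H i w.1.1 w.1.2 w.2)%E.
Proof.
elim: N => [|N IH] /=; first exact: lagrangian_ge.
by rewrite /Num.max; case: ifP => // _; exact: lagrangian_ge.
Qed.

Lemma lagrangian_approx_cvg i w :
  (lagrangian_approx i N w)%:E @[N --> \oo] --> lagrangian H i w.1.1 w.1.2 w.2.
Proof.
have nd : nondecreasing_seq (fun N => (lagrangian_approx i N w)%:E).
  by move=> M N MN; rewrite lee_fin; exact: lagrangian_approx_nd.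
have := ereal_nondecreasing_cvgn nd.
rewrite (_ : ereal_sup _ = lagrangian H i w.1.1 w.1.2 w.2)//.
apply/eqP; rewrite eq_le; apply/andP; split.
  by apply: ge_ereal_sup => _ [N _ <-]; exact: lagrangian_approx_le.
apply: ge_ereal_sup => _ [[p u] _ <-] /=.
apply/lee_addgt0Pr => e e0.
have vc : continuous (fun q => legendre_value i q w).
  apply: fun_add_continuous; first apply: fun_add_continuous.
  - apply: dotp_continuous; last exact: fun_fst_continuous.
    by move=> q; apply: cvg_cst; exact: nbhs_filter.
  - apply: dotp_continuous; last exact: fun_snd_continuous.
    by move=> q; apply: cvg_cst; exact: nbhs_filter.
  apply: fun_opp_continuous.
  apply: (@fun_comp_continuous _ _ _ (fun q : 'rV[R]_n * 'rV[R]_m => (w.1.1, q.1, q.2))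
    (fun w : phase => H i w.1.1 w.1.2 w.2)); last exact: H_continuous.
  apply: fun_pair_continuous; last exact: fun_snd_continuous.
  apply: fun_pair_continuous; last exact: fun_fst_continuous.
  by move=> q; apply: cvg_cst; exact: nbhs_filter.
have /cvgrPdist_lt/(_ e e0) := vc (p, u).
rewrite -nbhs_ballE => -[r /= r0 br].
have [q1 q1E] := rational_approximation p r0.
have [q2 q2E] := rational_approximation u r0.
have near_q : ball (p, u) r (map_mx ratr q1, map_mx ratr q2).
  by split; rewrite -ball_normE.
have := br _ near_q; rewrite /legendre_value /= => close.
pose N := choice.pickle (q1, q2).
have qN : rational_point N = (map_mx ratr q1, map_mx ratr q2).
  by rewrite /rational_point choice.pickleK.
(* The rational pair with code N enters the maximum at stage N + 1. *)
apply: (@le_trans _ _ ((lagrangian_approx i N.+1 w)%:E + e%:E)%E); last first.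
  by rewrite leeD2r//; apply: ereal_sup_ubound; exists N.+1.
rewrite -EFinD lee_fin /= -lerBlDr le_max; apply/orP; right.
rewrite qN /legendre_value /=; move: close; rewrite ltr_norml; lra.
Qed.

Lemma lagrangian_measurable i : measurable_fun setT
  (fun w : phase_space R n m => lagrangian H i w.1.1 w.1.2 w.2).
Proof.
apply: (@emeasurable_fun_cvg _ _ _ _
    (fun N (w : phase_space R n m) => (lagrangian_approx i N w)%:E)) => [N|w _].
  apply/measurable_EFinP; apply: phase_continuous_measurable.
  exact: lagrangian_approx_continuous.
exact: lagrangian_approx_cvg.
Qed.

End LagrangianApproximation.

(** * Integrals of the adjoint operator and the lower bound *)

Section AdjointIntegrals.
Context {R : realType} {n m : nat}.
Variable lambda : R.
Local Notation phase := (torus R n * 'rV[R]_n * 'rV[R]_m)%type.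
Implicit Types (w : 'I_m -> torus R n -> R) (nu : measure_family R n m).

(** For a = 1 this is the integrand of the normalization in [prob_family], which is thus closedness
    tested on a constant family. *)
Lemma adjoint_cst (a : R) i x xi eta :
  adjoint lambda (fun (_ : 'I_m) (_ : torus R n) => a) i x xi eta =
  a * (lambda + \sum_(j < m) eta 0 j).
Proof.
rewrite /adjoint (C1_torus_cst a).2 dotp0r add0r.
rewrite (_ : tuple_at _ x = const_mx a); last by apply/rowP => j; rewrite !mxE.
by rewrite dotp_const; ring.
Qed.

Lemma dotp_le_enorm k (x y : 'rV[R]_k) (B : R) : 0 <= B -> box k B y ->
  `|dotp x y| <= k%:R * B * enorm x.
Proof.
move=> B0 yB; apply: (le_trans (dotp_abs_le _ _)).
rewrite mulrAC ler_pM ?sumr_ge0//; last exact: row_norm_le.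
rewrite (le_trans (ler_sum _ (fun j _ => coord_le_enorm x j)))//.
by rewrite sumr_const card_ord mulr_natl.
Qed.

Lemma adjoint_growth w : (forall i, C1_torus (w i)) -> exists2 K, 0 <= K &
  forall i x xi eta, `|adjoint lambda w i x xi eta| <= K * (enorm xi + enorm eta) + K.
Proof.
move=> wC1; have [B B0 wB] := C1_family_bounded wC1.
exists ((n%:R + m%:R + `|lambda|) * B) => [|i x xi eta]; first by rewrite mulr_ge0// !addr_ge0.
have [wiB gB] := wB i x.
have h1 := dotp_le_enorm xi B0 gB.
have h2 : `|dotp eta (tuple_at w x)| <= m%:R * B * enorm eta.
  by apply: dotp_le_enorm => // j; rewrite mxE; exact: (wB j x).1.
have h3 : `|lambda * w i x| <= `|lambda| * B by rewrite normrM ler_wpM2l.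
have e1 : 0 <= enorm xi by exact: sqrtr_ge0.
have e2 : 0 <= enorm eta by exact: sqrtr_ge0.
have p1 : 0 <= n%:R * B by rewrite mulr_ge0.
have p2 : 0 <= m%:R * B by rewrite mulr_ge0.
have p3 : 0 <= `|lambda| * B by rewrite mulr_ge0.
rewrite /adjoint (le_trans (ler_normD _ _))//.
apply: (le_trans (lerD (ler_normD _ _) (lexx _))).
rewrite !mulrDl; set nB := n%:R * B in h1 p1 *; set mB := m%:R * B in h2 p2 *.
set lB := `|lambda| * B in h3 p3 *.
have : 0 <= nB * enorm eta by exact: mulr_ge0.
have : 0 <= mB * enorm xi by exact: mulr_ge0.
have : 0 <= lB * enorm xi by exact: mulr_ge0.
have : 0 <= lB * enorm eta by exact: mulr_ge0.
rewrite !mulrDr; lra.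
Qed.

Lemma adjoint_integrable nu w i : (forall i, C1_torus (w i)) ->
  (\int[nu i]_p (enorm p.1.2 + enorm p.2)%:E < +oo)%E ->
  (nu i).-integrable setT (fun p => (adjoint lambda w i p.1.1 p.1.2 p.2)%:E).
Proof.
move=> wC1 fin; have [K K0 wK] := adjoint_growth wC1.
have int1 : (nu i).-integrable setT
    (fun p : phase_space R n m => (enorm p.1.2 + enorm p.2)%:E).
  apply/integrableP; split.
    apply/measurable_EFinP; apply: phase_continuous_measurable.
    exact: enorm_moment_continuous.
  rewrite (eq_integral (fun p : phase_space R n m => (enorm p.1.2 + enorm p.2)%:E))// => p _.
  by rewrite gee0_abs// lee_fin addr_ge0 ?sqrtr_ge0.
have int2 := integrableD measurableT (integrableZl measurableT K int1)
  (finite_measure_integrable_cst (nu i) K measurableT).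
apply: (le_integrable measurableT _ _ int2) => [|p _].
  apply/measurable_EFinP; apply: phase_continuous_measurable.
  exact: adjoint_continuous.
rewrite /= lee_fin [leRHS]ger0_norm; first exact: wK.
by rewrite addr_ge0// mulr_ge0// addr_ge0 ?sqrtr_ge0.
Qed.

End AdjointIntegrals.

Section LowerBound.
Context {R : realType} {n m : nat}.
Variables (H : 'I_m -> torus R n -> 'rV[R]_n -> 'rV[R]_m -> R) (lambda : R).
Variable v : 'I_m -> torus R n -> R.
Hypotheses (H_continuous : hamiltonian_continuous H)
  (H_coercive : hamiltonian_coercive H) (lambda_gt0 : 0 < lambda)
  (v_sol : viscosity_solution H lambda v).

Lemma closed_family_pairing_ge (nu : measure_family R n m) z k :
  closed_family z k lambda nu -> ((v k z)%:E <= pairing nu (lagrangian H))%E.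
Proof.
move=> [[fin _] closed].
have [C _ smooth] := smooth_subsolution H_continuous H_coercive lambda_gt0 v_sol.1.
(* The error e is integrated against total mass T, which need not be 1: what is normalized is the
   integral of lambda + sum eta. *)
pose T : R := \sum_i fine (nu i setT).
have T0 : 0 <= T by apply: sumr_ge0 => i _; exact: fine_ge0.
have approx e : 0 < e -> ((v k z - (1 + T) * e)%:E <= pairing nu (lagrangian H))%E.
  move=> e0; have [W [WC1 Wv _ Wsub]] := smooth e e0.
  apply: (@le_trans _ _ (\sum_(i < m) (\int[nu i]_p
    (adjoint lambda W i p.1.1 p.1.2 p.2)%:E + (- e * fine (nu i setT))%:E))%E).
    rewrite big_split/= [X in (X + _)%E](closed W WC1) sumEFin -EFinD lee_fin -mulr_sumr -/T.
    by have := Wv k z; rewrite ler_norml; lra.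
  apply: lee_sum => i _.
  have intW := adjoint_integrable lambda WC1 (fin i).
  have intc := finite_measure_integrable_cst (nu i) (- e) measurableT.
  have -> : (- e * fine (nu i setT))%:E = (\int[nu i]_p (- e)%:E)%E.
    by rewrite integral_cst// EFinM fineK//; exact: fin_num_measure.
  rewrite -(integralD measurableT intW intc); apply: ge_real_integral.
  - by case/integrableP: (integrableD measurableT intW intc).
  - exact: lagrangian_measurable.
  move=> p; case LE : (lagrangian H i p.1.1 p.1.2 p.2) => [ell| |].
  - rewrite -EFinD lee_fin lerBlDr; apply: Wsub => P u.
    exact: lagrangian_fin_ge LE.
  - by rewrite leey.
  - by have := lagrangian_ge H i p.1.1 p.1.2 p.2 0 0; rewrite LE.
move: approx; case: pairing => [P| |] approx; last 2 first.
- exact: leey.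
- by have := approx 1 ltr01.
rewrite lee_fin -subr_le0.
apply: (@le0_of_linear_bound _ _ (1 + T) 1) => // t /andP[t0 _].
by have := approx t t0; rewrite lee_fin; lra.
Qed.

End LowerBound.

Section FiniteFamilies.
Context {R : realType} {T : Type} {Lam : (T -> R) -> R}.
Hypothesis Lam_lin : forall a F G, bounded_on_type F -> bounded_on_type G ->
  Lam (fun s => a * F s + G s) = a * Lam F + Lam G.

Lemma functional_big_sum (I : Type) (r : seq I) (F : I -> T -> R) :
  (forall i, bounded_on_type (F i)) ->
  bounded_on_type (fun s => \sum_(i <- r) F i s) /\
  Lam (fun s => \sum_(i <- r) F i s) = \sum_(i <- r) Lam (F i).
Proof.
move=> Fb; elim: r => [|i r [IHb IH]].
  have E : (fun s => \sum_(i <- [::]) F i s) = fun=> 0.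
    by apply/funext => s; rewrite big_nil.
  by rewrite E big_nil; split; [exact: bounded_on_type_cst|exact: functional0 Lam_lin].
have E : (fun s => \sum_(i <- i :: r) F i s) =
    (fun s => 1 * F i s + \sum_(i <- r) F i s).
  by apply/funext => s; rewrite big_cons mul1r.
rewrite E big_cons; split; first exact: bounded_scaleD.
by rewrite Lam_lin// IH mul1r.
Qed.

End FiniteFamilies.

Lemma cantor_family_bounded {R : realType} m (F : 'I_m -> cantor_space -> R) :
  (forall i, continuous (F i)) -> bounded_on_type (fun p => F p.1 p.2).
Proof.
move=> Fc; have [M MP] := choice (fun i => cantor_bounded (Fc i)).
exists (\sum_i `|M i|) => -[i s] /=; apply: (le_trans (MP i s)).
apply: (le_trans (ler_norm _)).
by rewrite (bigD1 i)//= lerDl; apply: sumr_ge0.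
Qed.

Section Representation.
Context {R : realType} {n m : nat}.
Local Notation phase := (torus R n * 'rV[R]_n * 'rV[R]_m)%type.
Variables (c : cantor_space -> phase) (Lam : ('I_m * cantor_space -> R) -> R).
Hypothesis c_continuous : continuous c.
Hypothesis Lam_lin : forall a F G, bounded_on_type F -> bounded_on_type G ->
  Lam (fun s => a * F s + G s) = a * Lam F + Lam G.
Hypothesis Lam_le0 : forall F, bounded_on_type F -> (forall s, F s <= 0) -> Lam F <= 0.

(** The functional is split over the m copies of the Cantor space: [ext i] places a function on the
    i-th copy and 0 on the others, and each restriction has its own Riesz measure. *)
Lemma family_riesz : exists mu : measure_family R n m,
  forall G : 'I_m -> phase -> R, (forall i, continuous (G i)) ->
    (forall i, (mu i).-integrable setT (fun w => (G i w)%:E)) /\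
    (\sum_(i < m) \int[mu i]_w (G i w)%:E)%E = (Lam (fun p => G p.1 (c p.2)))%:E.
Proof.
pose ext i (F : cantor_space -> R) (p : 'I_m * cantor_space) : R :=
  if p.1 == i then F p.2 else 0.
have extb i F : bounded_on_type F -> bounded_on_type (ext i F).
  move=> [M FM]; exists `|M| => -[j s]; rewrite /ext /=; case: ifP => _.
    exact: le_trans (FM s) (ler_norm _).
  by rewrite normr0.
have muP i : exists mu : {finite_measure set (phase_space R n m) -> \bar R},
    forall G : phase -> R, continuous G ->
      mu.-integrable setT (fun w : phase_space R n m => (G w)%:E) /\
      (\int[mu]_w (G w)%:E)%E = (Lam (ext i (fun s => G (c s))))%:E.
  apply: (@phase_riesz R n m c (fun F => Lam (ext i F))) => // [a F G Fb Gb|F Fb F0].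
    rewrite -Lam_lin; [|exact: extb..].
    congr Lam; apply/funext => p; rewrite /ext; case: ifP => // _.
    by rewrite mulr0 addr0.
  by apply: Lam_le0 => [|p]; [exact: extb|rewrite /ext; case: ifP].
have [mu {}muP] := choice muP; exists mu => G Gc.
have Gcc i : continuous (fun s => G i (c s)) by exact: (fun_comp_continuous c_continuous (Gc i)).
split=> [i|]; first by have [] := muP i _ (Gc i).
under eq_bigr => i _ do rewrite (muP i _ (Gc i)).2.
rewrite sumEFin; congr EFin.
have [//|_ <-] := functional_big_sum Lam_lin (index_enum 'I_m)
  (F := fun i => ext i (fun s => G i (c s))).
  by move=> i; apply: extb; exact: cantor_bounded.
congr Lam; apply/funext => -[j s] /=.
rewrite (bigD1 j)//= /ext /= eqxx big1 ?addr0// => i ij.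
by rewrite eq_sym (negbTE ij).
Qed.

End Representation.

(** * Existence of a minimizer *)

Section DualFunctional.
Context {R : realType} {n m : nat}.
Variables (H : 'I_m -> torus R n -> 'rV[R]_n -> 'rV[R]_m -> R) (lambda : R).
Variable v : 'I_m -> torus R n -> R.
Hypotheses (H_continuous : hamiltonian_continuous H)
  (H_coercive : hamiltonian_coercive H) (H_convex : hamiltonian_convex H)
  (H_monotone : hamiltonian_monotone H) (lambda_gt0 : 0 < lambda)
  (v_sol : viscosity_solution H lambda v).
Variables (z : torus R n) (k : 'I_m).
Local Notation phase := (torus R n * 'rV[R]_n * 'rV[R]_m)%type.

(** Hahn-Banach is applied to the cheapest domination of F: if F <= - A w + s L where L is finite,
    then - w_k(z) + s v_k(z) is an admissible bound for [Lam F]. Each property of [Lam] comes from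
    particular choices of (w, s). *)
Lemma dual_functional :
  exists (c : cantor_space -> phase) (Lam : ('I_m * cantor_space -> R) -> R),
  [/\ continuous c,
      forall a F G, bounded_on_type F -> bounded_on_type G ->
        Lam (fun s => a * F s + G s) = a * Lam F + Lam G,
      forall F, bounded_on_type F -> (forall s, F s <= 0) -> Lam F <= 0,
      forall w, (forall i, C1_torus (w i)) ->
        Lam (fun p => adjoint lambda w p.1 (c p.2).1.1 (c p.2).1.2 (c p.2).2) = w k z &
      forall F, bounded_on_type F -> (forall p,
          ((F p)%:E <= lagrangian H p.1 (c p.2).1.1 (c p.2).1.2 (c p.2).2)%E) ->
        Lam F <= v k z].
Proof.
have [B B0 dual] :=
  weak_duality H_continuous H_coercive H_convex H_monotone lambda_gt0 v_sol.
(* [phase_parametrization] needs a positive radius, while B may be 0. *)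
have B1 : 0 < B + 1 by lra.
have [c [cc csurj]] := @phase_parametrization R n m _ B1.
pose A w (p : 'I_m * cantor_space) : R :=
  adjoint lambda w p.1 (c p.2).1.1 (c p.2).1.2 (c p.2).2.
pose Lc (p : 'I_m * cantor_space) : \bar R :=
  lagrangian H p.1 (c p.2).1.1 (c p.2).1.2 (c p.2).2.
(* Weak duality says precisely that [S 0 r] implies [0 <= r]. *)
pose S (F : 'I_m * cantor_space -> R^o) (r : R) := exists w (s : R),
  [/\ forall i, C1_torus (w i), 0 <= s,
      forall p ell, Lc p = ell%:E -> F p <= - A w p + s * ell &
      - w k z + s * v k z <= r].
have cst0 (i : 'I_m) : C1_torus (fun _ : torus R n => 0 : R) := (C1_torus_cst 0).1.
have A0 p : A (fun _ _ => 0) p = 0 by rewrite /A adjoint_cst mul0r.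
have Ab w : (forall i, C1_torus (w i)) -> bounded_on_type (A w).
  move=> wC1; apply: (@cantor_family_bounded R m (fun i s => A w (i, s))) => i.
  apply: (@fun_comp_continuous _ _ _ c
    (fun p : phase => adjoint lambda w i p.1.1 p.1.2 p.2)) => //.
  exact: adjoint_continuous.
have [||||||Lam [Lam_lin LamS]] :=
    @hahn_banach_cone R ('I_m * cantor_space -> R^o) bounded_on_type _ _ S.
- by move=> a F G; exact: bounded_scaleD.
- exact: bounded_on_type_cst.
- move=> t F r t0 _ [w [s [wC1 s0 FS rS]]].
  have [twC1 twE] := family_combination lambda t 0 wC1 wC1.
  exists (fun i x => t * w i x + 0 * w i x), (t * s).
  split=> //; first by rewrite mulr_ge0// ltW.
    move=> p ell /FS h; rewrite /A; have [_ _ ->] := twE p.1 (c p.2).1.1.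
    by rewrite mul0r addr0 -mulrN -mulrA -mulrDr; exact: (ler_wpM2l (ltW t0) h).
  by rewrite mul0r addr0 -mulrN -mulrA -mulrDr ler_wpM2l// ltW.
- move=> F G r1 r2 _ _ [w1 [s1 [C1 s10 S1 h1]]] [w2 [s2 [C2 s20 S2 h2]]].
  have [C12 E12] := family_combination lambda 1 1 C1 C2.
  exists (fun i x => 1 * w1 i x + 1 * w2 i x), (s1 + s2).
  split=> //; first exact: addr_ge0.
    move=> p ell Lp; rewrite /A; have [_ _ ->] := E12 p.1 (c p.2).1.1.
    have := S1 p ell Lp; have := S2 p ell Lp; rewrite /A => g2 g1.
    rewrite (_ : (F + G) p = F p + G p)//.
    by move: (F p) (G p) g1 g2 => /= a b; lra.
  lra.
(* The constant family -a gives - A w = a (lambda + sum eta) >= a lambda = |M| wherever L is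
   finite. *)
- move=> F [M FM]; pose a := `|M| / lambda.
  have a0 : 0 <= a by rewrite divr_ge0// ltW.
  exists (- - a + 0 * v k z), (fun _ _ => - a), 0; split=> // [i|p ell Lp].
    exact: (C1_torus_cst _).1.
  rewrite mul0r addr0 /A adjoint_cst mulNr opprK mulrDr /a divfK ?gt_eqF//.
  apply: (le_trans (ler_norm _)); apply: (le_trans (FM p)).
  apply: (le_trans (ler_norm _)); rewrite lerDl mulr_ge0//.
  exact: (lagrangian_fin_sum_ge0 H_monotone Lp).
- move=> r [w [s [wC1 s0 wS]]]; apply: le_trans.
  rewrite addrC subr_ge0; apply: dual => // i x xi eta ell xiB etaB LE.
  have [||b bE] := csurj x xi eta.
  - by move=> j; apply: (le_trans (xiB j)); rewrite lerDl.
  - by move=> j; apply: (le_trans (etaB j)); rewrite lerDl.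
  have := wS (i, b) ell; rewrite /Lc /A /= bE /= => /(_ LE).
  by rewrite addrC subr_ge0.
have Ab0 : bounded_on_type (fun _ : 'I_m * cantor_space => 0 : R).
  exact: bounded_on_type_cst.
exists c, Lam; split=> //.
- move=> F Fb F0; apply: LamS => //; exists (fun _ _ => 0), 0; split=> //.
    by move=> p ell _; rewrite A0 oppr0 mul0r addr0; exact: F0.
  by rewrite oppr0 mul0r addr0.
(* Both inequalities use s = 0: the family - w bounds [Lam (A w)] from above, and w bounds
   [Lam (- A w)] from above. *)
- move=> w wC1; apply/eqP; rewrite eq_le; apply/andP; split.
    apply: LamS; first exact: Ab.
    have [NC1 NE] := family_combination lambda (-1) 0 wC1 wC1.
    exists (fun i x => -1 * w i x + 0 * w i x), 0; split=> //; last lra.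
    move=> p ell _; rewrite /A; have [_ _ ->] := NE p.1 (c p.2).1.1.
    by lra.
  have : Lam (fun p => -1 * A w p + 0) <= - w k z.
    apply: LamS; first exact: bounded_scaleD (Ab _ wC1) Ab0.
    exists w, 0; split=> //; last lra.
    by move=> p ell _; lra.
  rewrite (Lam_lin (-1) (A w) (fun=> 0))//; last exact: Ab.
  have -> : Lam (fun=> 0) = 0.
    by apply: (functional0 (Lam := Lam)) => a F G Fb Gb; rewrite -Lam_lin.
  rewrite /A; lra.
- move=> F Fb FL; apply: LamS => //; exists (fun _ _ => 0), 1; split=> //.
    move=> p ell Lp; rewrite A0 oppr0 mul1r add0r.
    by have := FL p; rewrite -/(Lc p) Lp lee_fin.
  by rewrite oppr0 mul1r add0r.
Qed.

End DualFunctional.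

Section OptimalMeasure.
Context {R : realType} {n m : nat}.
Variables (H : 'I_m -> torus R n -> 'rV[R]_n -> 'rV[R]_m -> R).
Hypothesis H_continuous : hamiltonian_continuous H.
Variable mu : measure_family R n m.
Hypothesis mu_integrable : forall (G : 'I_m -> torus R n * 'rV[R]_n * 'rV[R]_m -> R),
  (forall i, continuous (G i)) ->
  forall i, (mu i).-integrable setT (fun w => (G i w)%:E).

(** Monotone convergence is applied to nonnegative functions: the integrable stage 0 is subtracted
    first, and its integral is added back at the end. *)
Lemma pairing_lagrangian_le (b : R) :
  (forall N, \sum_(i < m) \int[mu i]_w (lagrangian_approx H i N w)%:E <= b%:E)%E ->
  (pairing mu (lagrangian H) <= b%:E)%E.
Proof.
move=> approx_le.
pose f i N (w : phase_space R n m) : \bar R := (lagrangian_approx H i N w)%:E.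
pose L i (w : phase_space R n m) : \bar R := lagrangian H i w.1.1 w.1.2 w.2.
have intf i N : (mu i).-integrable setT (f i N).
  apply: (@mu_integrable (fun i => lagrangian_approx H i N)) => j.
  exact: lagrangian_approx_continuous.
have mL i : measurable_fun setT (L i) by exact: lagrangian_measurable.
have mf i N : measurable_fun setT (f i N) by case/integrableP: (intf i N).
pose I i N : R := fine (\int[mu i]_w f i N w)%E.
have IE i N : (\int[mu i]_w f i N w)%E = (I i N)%:E.
  by rewrite fineK//; exact: (integrable_fin_num measurableT (intf i N)).
pose s0 : R := \sum_i I i 0%N.
pose g i N w := (f i N w - f i 0%N w)%E.
pose gL i w := (L i w - f i 0%N w)%E.
have g0 i N w : (0 <= g i N w)%E.
  by rewrite /g /f -EFinB lee_fin subr_ge0; exact: lagrangian_approx_nd.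
have gL0 i w : (0 <= gL i w)%E.
  by rewrite /gL sube_ge0//; exact: lagrangian_approx_le.
have mg i N : measurable_fun setT (g i N) by exact: emeasurable_funB.
have g_cvg i : (\int[mu i]_w g i N w)%E @[N --> \oo] --> (\int[mu i]_w gL i w)%E.
  have -> : gL i = (fun w => limn (fun N => g i N w)).
    apply/funext => w; apply/esym/cvg_lim => //; apply: cvgeD => //.
      by rewrite fin_num_adde_defl.
    - exact: lagrangian_approx_cvg.
    - exact: cvg_cst.
  apply: cvg_monotone_convergence => //.
  move=> w _ M N MN; rewrite /g leeD2r// lee_fin.
  exact: lagrangian_approx_nd.
have gN_le N : (\sum_(i < m) \int[mu i]_w g i N w <= (b - s0)%:E)%E.
  rewrite (eq_bigr (fun i => (I i N - I i 0%N)%:E)); last first.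
    by move=> i _; rewrite (integralB measurableT (intf i N) (intf i 0%N)) !IE.
  have := approx_le N; rewrite (eq_bigr (fun i => (I i N)%:E)); last first.
    by move=> i _; exact: IE.
  by rewrite !sumEFin !lee_fin sumrB lerD2r.
have gL_le : (\sum_(i < m) \int[mu i]_w gL i w <= (b - s0)%:E)%E.
  have cv : (\sum_(i < m) \int[mu i]_w g i N w)%E @[N --> \oo] -->
      (\sum_(i < m) \int[mu i]_w gL i w)%E.
    apply: cvg_nnesum => // i _; apply: nearW => N.
    by apply: integral_ge0 => w _.
  rewrite -(cvg_lim _ cv)//; apply: lime_le; first by apply/cvg_ex; eexists; exact: cv.
  by apply: nearW.
(* The summands are nonnegative, so the bound on their sum makes each one finite; additivity of the
   integral then restores stage 0. *)
have intgL i : (mu i).-integrable setT (gL i).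
  apply/integrableP; split; first exact: emeasurable_funB.
  rewrite (eq_integral (gL i)) => [|w _]; last by rewrite gee0_abs.
  apply: le_lt_trans (ltry (b - s0)); apply: le_trans gL_le.
  rewrite (bigD1 i)//= leeDl//; apply: sume_ge0 => j _.
  by apply: integral_ge0 => w _.
rewrite /pairing (eq_bigr (fun i => \int[mu i]_w gL i w + \int[mu i]_w f i 0%N w)%E).
  rewrite big_split/= [X in (_ + X)%E](eq_bigr (fun i => (I i 0%N)%:E)); last first.
    by move=> i _; exact: IE.
  by rewrite sumEFin (le_trans (leeD2r _ gL_le))// -EFinD subrK.
move=> i _; rewrite -(integralD measurableT (intgL i) (intf i 0%N)).
by apply: eq_integral => w _; rewrite /gL subeK.
Qed.

End OptimalMeasure.

Theorem theorem12 (R : realType) (n m : nat) (n_gt0 : (0 < n)%N)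
    (H : 'I_m -> torus R n -> 'rV[R]_n -> 'rV[R]_m -> R)
    (H_continuous : hamiltonian_continuous H)
    (H_coercive : hamiltonian_coercive H)
    (H_convex : hamiltonian_convex H)
    (H_monotone : hamiltonian_monotone H)
    (z : torus R n) (k : 'I_m) (lambda : R) (lambda_gt0 : 0 < lambda)
    (v : 'I_m -> torus R n -> R)
    (v_solution : viscosity_solution H lambda v) :
  exists mu : measure_family R n m,
    [/\ closed_family z k lambda mu,
        (v k z)%:E = pairing mu (lagrangian H)
      & forall nu : measure_family R n m, closed_family z k lambda nu ->
          (pairing mu (lagrangian H) <= pairing nu (lagrangian H))%E].
Proof.
have [c [Lam [cc Lam_lin Lam_le0 Lam_adj Lam_L]]] := dual_functional H_continuous
  H_coercive H_convex H_monotone lambda_gt0 v_solution z k.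
have [mu muE] := family_riesz cc Lam_lin Lam_le0.
have adjE w : (forall i, C1_torus (w i)) -> pairing mu (fun i x xi eta =>
    (adjoint lambda w i x xi eta)%:E) = (w k z)%:E.
  move=> wC1; rewrite -(Lam_adj w wC1).
  apply: (muE (fun i p => adjoint lambda w i p.1.1 p.1.2 p.2) _).2 => i.
  exact: adjoint_continuous.
have mu_closed : closed_family z k lambda mu.
  split; last by move=> psi psiC1; exact: adjE.
  split=> [i|].
    have int_moment := (muE _ (fun _ => enorm_moment_continuous)).1 i.
    by rewrite -ge0_fin_numE; [exact: (integrable_fin_num measurableT int_moment)|
      apply: integral_ge0 => w _; rewrite lee_fin addr_ge0 ?sqrtr_ge0].
  rewrite -(adjE (fun _ _ => 1)); last by move=> i; exact: (C1_torus_cst 1).1.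
  apply: eq_bigr => i _; apply: eq_integral => w _.
  by rewrite adjoint_cst mul1r.
(* [Lam] bounds only real functions below L, and L may be infinite, so it is reached through its
   continuous approximations. *)
have mu_le : (pairing mu (lagrangian H) <= (v k z)%:E)%E.
  apply: (pairing_lagrangian_le H_continuous) => [G Gc|N]; first exact: (muE G Gc).1.
  have phiC i : continuous (lagrangian_approx H i N).
    exact: lagrangian_approx_continuous.
  rewrite [leLHS](muE (fun i => lagrangian_approx H i N) phiC).2 lee_fin.
  apply: Lam_L => [|p]; last exact: lagrangian_approx_le.
  apply: (@cantor_family_bounded R m (fun i s => lagrangian_approx H i N (c s))) => i.
  exact: (@fun_comp_continuous _ _ _ c (lagrangian_approx H i N)).
have ge nu : closed_family z k lambda nu ->
    ((v k z)%:E <= pairing nu (lagrangian H))%E.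
  exact: (closed_family_pairing_ge H_continuous H_coercive lambda_gt0 v_solution).
have muL : (v k z)%:E = pairing mu (lagrangian H).
  by apply/eqP; rewrite eq_le mu_le ge.
by exists mu; split=> // nu nuC; rewrite -muL; exact: ge.
Qed.
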